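(* There exists a set $\mathcal{F}'\subset\mathbb{T}\times\mathbb{T}^2\times\mathbb{T}^2$ of full Lebesgue measure such that for every $(\alpha,\mathbf{p},\mathbf{q})\in\mathcal{F}'$ the corresponding reparametrized linear flow $(T_t)$ on $\mathbb{T}^2$ (for a reparametrizing function $\varphi$ as described in the context) has extreme historic behavior.
   Context: $\mathbb{T}=\mathbb{R}/\mathbb{Z}$ and $\mathbb{T}^2=\mathbb{R}^2/\mathbb{Z}^2$. Reparametrized linear flow. Let $(\alpha,\mathbf{p},\mathbf{q})\in\mathbb{T}\times\mathbb{T}^2\times\mathbb{T}^2$ with $\mathbf{p}\neq\mathbf{q}$ ($\alpha$ represented in $[0,1)$). Let $(L_t)$ be the linear flow on $\mathbb{T}^2$ generated by the constant vector field $X_0=(1,\alpha)$. Let $\varphi:\mathbb{T}^2\to\mathbb{R}_{\ge0}$ be a $C^3$ non-negative function vanishing exactly at the two points $\mathbf{p}$ and $\mathbf{q}$, and non-degenerate in the sense that the Hessians $D^2\varphi(\mathbf{p})$ and $D^2\varphi(\mathbf{q})$ are positive definite. A flow corresponding to $(\alpha,\mathbf{p},\mathbf{q})$ is the flow $(T_t)$ on $\mathbb{T}^2$ generated by the vector field $X=\varphi X_0$, for such a $\varphi$; it has exactly the two stopping points $\mathbf{p}$ and $\mathbf{q}$. Extreme historic behavior. For $\mathbf{x}\in\mathbb{T}^2$ and $t>0$ let $\mu_t(\mathbf{x})$ be the empirical probability measure $\mu_t(\mathbf{x})(f)=\frac1t\int_0^t f(T_s\mathbf{x})\,\mathrm{d}s$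 for continuous $f:\mathbb{T}^2\to\mathbb{R}$. The flow $(T_t)$ has extreme historic behavior if for Lebesgue-a.e. $\mathbf{x}\in\mathbb{T}^2$ the set of accumulation points (in the weak-* topology, as $t\to\infty$) of $\{\mu_t(\mathbf{x})\}_{t>0}$ is exactly the set of all $(T_t)$-invariant Borel probability measures. *)

(* Defs.v *)
From HB Require Import structures.
From mathcomp Require Import all_boot all_order all_algebra.
From mathcomp Require Import all_classical all_reals all_analysis.

Set Implicit Arguments.
Unset Strict Implicit.
Unset Printing Implicit Defensive.

Import Order.TTheory GRing.Theory Num.Theory.
Import numFieldNormedType.Exports.

Local Open Scope classical_set_scope.
Local Open Scope ring_scope.
Local Open Scope quotient_scope.

Section reparametrized_flow.
Variable R : realType.

Definition Zcongr (x y : R) : bool := x - y \is a Num.int.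

Lemma Zcongr_refl : reflexive Zcongr.
Proof. by move=> x; rewrite /Zcongr subrr rpred0. Qed.

Lemma Zcongr_sym : symmetric Zcongr.
Proof. by move=> x y; rewrite /Zcongr -rpredN opprB. Qed.

Lemma Zcongr_trans : transitive Zcongr.
Proof. by move=> y x z xy yz; rewrite /Zcongr -(subrKA y) rpredD. Qed.

Canonical Zcongr_equiv := EquivRel Zcongr Zcongr_refl Zcongr_sym Zcongr_trans.

(* R / Z, with the quotient topology *)
Definition circle : Type := quotient_topology {eq_quot Zcongr}.

HB.instance Definition _ := Quotient.on circle.
HB.instance Definition _ := PointedTopological.on circle.

(* Borel sigma-algebra *)
HB.instance Definition _ := @isMeasurable.Build (sigma_display (@open circle))
  circle <<s (@open circle) >> (@sigma_algebra0 _ setT _)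
  (@sigma_algebraC _ _) (@sigma_algebra_bigcup _ setT _).

Definition to_circle : measurableTypeR R -> circle := \pi_circle.

(* the representative in [0, 1) *)
Definition circle_rep (a : circle) : R := repr a - (Num.floor (repr a))%:~R.

Lemma to_circleP (x y : R) :
  to_circle x = to_circle y <-> x - y \is a Num.int.
Proof.
rewrite -/(Zcongr x y) /to_circle.
split=> [|xy]; first by move/eqmodP.
exact/eqmodP.
Qed.

Lemma circle_repK : cancel circle_rep to_circle.
Proof.
move=> a; rewrite -[RHS]reprK; apply/to_circleP.
by rewrite /circle_rep addrAC subrr add0r rpredN intr_int.
Qed.

Lemma circle_rep_itv (a : circle) : 0 <= circle_rep a < 1.
Proof.
rewrite /circle_rep subr_ge0 floor_le ltrBlDl.
by rewrite -[X in _ < _ + X]/(1%:~R) -intrD floorD1_gt.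
Qed.

Lemma measurable_to_circle :
  measurable_fun [set: measurableTypeR R] to_circle.
Proof.
apply: (@measurability _ _ _ _ _ _ (@open circle)) => // _ [U oU <-].
rewrite setTI; apply: measurable_realfun.open_measurable.
by move: U oU; apply/continuousP; exact: pi_continuous.
Qed.

HB.instance Definition _ :=
  isMeasurableFun.Build _ _ _ _ to_circle measurable_to_circle.

Definition lebesgue01 : set (measurableTypeR R) -> \bar R :=
  mrestr lebesgue_measure (measurable_itv `[0%R : R, 1%R[).

HB.instance Definition _ := Measure.on lebesgue01.

Lemma lebesgue01T : lebesgue01 [set: R] = 1%E.
Proof.
rewrite /lebesgue01 /mrestr setTI lebesgue_measure_itv /= lte_fin ltr01.
by rewrite -EFinB subr0.
Qed.

HB.instance Definition _ :=
  Measure_isProbability.Build _ _ _ lebesgue01 lebesgue01T.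

(* Lebesgue measure of the circle, the image of that of [0, 1) *)
Definition circle_lebesgue : probability circle R :=
  distribution lebesgue01 to_circle.

(* R^2 / Z^2, with the product topology and the product sigma-algebra; the
   latter is the Borel one since the circle is second countable. *)
Definition torus : Type := (circle * circle)%type.

HB.instance Definition _ := Topological.on torus.
HB.instance Definition _ := Measurable.on torus.

Definition to_torus (z : R * R) : torus := (to_circle z.1, to_circle z.2).

Definition torus_rep (x : torus) : R * R := (circle_rep x.1, circle_rep x.2).

Definition torus_lebesgue : probability torus R :=
  (circle_lebesgue \x circle_lebesgue)%E.

Definition param_lebesgue : probability (circle * torus * torus)%type R :=
  ((circle_lebesgue \x torus_lebesgue) \x torus_lebesgue)%E.

Definition full_measure d (T : measurableType d) (m : set T -> \bar R)
  (A : set T) := m.-negligible (~` A).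

(* Fréchet differentiability at every order below k, all derivatives of order k
   being continuous. *)
Fixpoint Ck (k : nat) (f : R * R -> R) : Prop :=
  if k is k'.+1 then
    (forall z, differentiable f z) /\ forall v, Ck k' (fun z => 'D_v f z)
  else continuous f.

(* the bilinear form D^2 f(z)(u, v) *)
Definition hessian (f : R * R -> R) (z u v : R * R) : R :=
  'D_u (fun w => 'D_v f w) z.

Definition positive_definite (B : R * R -> R * R -> R) : Prop :=
  forall v, v != 0 -> 0 < B v v.

(* Phi is a one-parameter group and each of its orbits lifts to an integral curve
   in R^2 of the (lifted) vector field X, from any lift z of the initial point. *)
Definition flow_generated (X : torus -> R * R) (Phi : R -> torus -> torus) :=
  [/\ forall x, Phi 0 x = x,
      forall s t x, Phi (s + t) x = Phi s (Phi t x) &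
      forall z : R * R, exists gamma : R -> R * R,
        [/\ gamma 0 = z,
            forall t, to_torus (gamma t) = Phi t (to_torus z) &
            forall t : R, is_derive t 1 gamma (X (to_torus (gamma t)))]].

Record reparam (p q : torus) (phi : torus -> R) : Prop := {
  reparam_C3 : Ck 3 (phi \o to_torus) ;
  reparam_ge0 : forall x, 0 <= phi x ;
  reparam_zero : forall x, phi x = 0 <-> x = p \/ x = q ;
  reparam_hessp : positive_definite (hessian (phi \o to_torus) (torus_rep p)) ;
  reparam_hessq : positive_definite (hessian (phi \o to_torus) (torus_rep q))
}.

Definition corresponding_flow (a : circle) (p q : torus)
    (Phi : R -> torus -> torus) : Prop :=
  p <> q /\ exists2 phi : torus -> R, reparam p q phi &
    flow_generated (fun x => phi x *: (1, circle_rep a)) Phi.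

Definition empirical (Phi : R -> torus -> torus) (x : torus) (t : R)
    (f : continuousType torus R) : R :=
  t^-1 * \int[lebesgue_measure]_(s in `[0, t]) f (Phi s x).

(* The weak-* topology on measures, seen as functionals on C(torus), is that of
   pointwise convergence on C(torus). *)
Definition accumulation_points (Phi : R -> torus -> torus) (x : torus) :
    set (probability torus R) :=
  [set mu : probability torus R | cluster (empirical Phi x @ +oo
                       : set_system {ptws continuousType torus R -> R})
              (fun f => \int[mu]_y f y)].

Definition invariant_probabilities (Phi : R -> torus -> torus) :
    set (probability torus R) :=
  [set mu : probability torus R |
    forall t A, measurable A -> mu (Phi t @^-1` A) = mu A].

Definition extreme_historic (Phi : R -> torus -> torus) : Prop :=
  {ae torus_lebesgue, forall x,
    accumulation_points Phi x = invariant_probabilities Phi}.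

End reparametrized_flow.

(* Main.v *)
(** Seen from [x], the lattice translates of [p] and [q] lie at heights [U n] and
    [V n] modulo 1 above the [n]-th turn of the linear orbit of [x].  Since [phi]
    vanishes to second order at [p] and [q], the flow spends a time of order
    [1/|U n| + 1/|V n|] on that turn, where [|.|] denotes the distance to the
    integers.  For irrational [al] the sums of [1/|n al + y|] over [n < N] grow
    faster than [N], so that the orbits advance by [o(t)] in time [t], uniformly
    in [x]: invariant measures and accumulation points of empirical measures are
    carried by [p] and [q].  They are determined by the weight of [p], which along
    an orbit varies continuously with [t]; all weights are thus reached once both
    0 and 1 are.  This happens as soon as, for every [K], [1/|V N|] exceeds [K]
    times the sum of [1/|U n|] over [n < N + 4] for infinitely many [N], and
    similarly with [U] and [V] exchanged.

    For fixed [x] and random [(al, p, q)] the [U n] are uniform modulo 1, pairwise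
    independent and independent of the [V n], while the sum of the [1/|V n|] over
    [n < N] is [O(N log N)] with high probability.  The series of the
    [1/(N log N)] diverges, and the second moment method produces the required
    returns almost surely.  Fubini's theorem exchanges [x] and [(al, p, q)]. *)

Require Import Defs.
From HB Require Import structures.
From mathcomp Require Import all_boot all_order all_algebra.
From mathcomp Require Import all_classical all_reals all_analysis measurable_realfun.
From mathcomp Require Import ring lra zify.

Set Implicit Arguments.
Unset Strict Implicit.
Unset Printing Implicit Defensive.

Import Order.TTheory GRing.Theory Num.Theory.
Import numFieldNormedType.Exports.

Local Open Scope classical_set_scope.
Local Open Scope ring_scope.

(** * Rotations of the circle *)

(** The set of parameters is fixed before [phi] and the flow are known. The bad event is therefore
    written with the heights alone, and whatever depends on [phi], namely the constants of its
    quadratic bounds at [p] and [q], is absorbed by letting [K] be arbitrarily large. The field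
    being a multiple of a constant vector, a trajectory reduces to one scalar function, its
    displacement, whose derivative is [phi] along the orbit. Integrals of continuous functions along
    an orbit are bounded by the increment of an explicit function of time and displacement, once the
    derivatives compare. For the visits to one stopping point this function is a sum of arctangents,
    which varies by at most [pi] times the sum of the inverse heights; a single crossing near the
    other point bounds the elapsed time from below. The inverse of a uniform height is not
    integrable, so expectations cannot be used directly. It is truncated at a dyadic level and
    dominated by piecewise linear tents: each dyadic scale contributes a bounded mean, and the
    number of scales produces the logarithm in [N log N]. *)

Section dist_to_int.
Variable R : realType.
Implicit Types x y : R.

(** Distance to the nearest integer. The closed form names an integer that achieves it; [nrm_le]
    recovers the minimum over all integers. *)
Definition nrm y : R := `|y - (Num.floor (y + 2^-1))%:~R|.

Lemma nrm_half y : nrm y <= 2^-1.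
Proof.
rewrite /nrm; have := floor_le (y + 2^-1); have := floorD1_gt (y + 2^-1).
rewrite intrD1 ler_norml; lra.
Qed.

Lemma nrm_ge0 y : 0 <= nrm y. Proof. exact: normr_ge0. Qed.

Lemma nrm_le y (k : int) : nrm y <= `|y - k%:~R|.
Proof.
have h := nrm_half y.
have [<-//|kn] := eqVneq (Num.floor (y + 2^-1)) k.
have : 1 <= `|(Num.floor (y + 2^-1))%:~R - k%:~R| :> R.
  by rewrite -intrB -intr_norm ler1z -gtz0_ge1 normr_gt0 subr_eq0.
have := ler_distD y (Num.floor (y + 2^-1))%:~R k%:~R.
rewrite (distrC (Num.floor _)%:~R y) -/(nrm y); lra.
Qed.

Lemma nrmDz y (k : int) : nrm (y + k%:~R) = nrm y.
Proof.
apply/eqP; rewrite eq_le; apply/andP; split.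
  rewrite {2}/nrm; have := nrm_le (y + k%:~R) (Num.floor (y + 2^-1) + k).
  by rewrite intrD opprD addrACA subrr addr0.
rewrite {2}/nrm; have := nrm_le y (Num.floor (y + k%:~R + 2^-1) - k).
by rewrite intrB opprB addrA.
Qed.

Lemma nrmDnat y (k : nat) : nrm (y + k%:R) = nrm y.
Proof. exact: (nrmDz y k). Qed.

Lemma nrmN y : nrm (- y) = nrm y.
Proof.
suff h z : nrm (- z) <= nrm z.
  by apply/eqP; rewrite eq_le h /=; have := h (- y); rewrite opprK.
have := nrm_le (- z) (- Num.floor (z + 2^-1)).
by rewrite intrN -opprD normrN.
Qed.

Lemma nrm_dist x y : nrm x <= nrm y + `|x - y|.
Proof.
apply: (le_trans (nrm_le x (Num.floor (y + 2^-1)))).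
by rewrite [leRHS]addrC; exact: ler_distD.
Qed.

Lemma nrm_eq0 y : nrm y = 0 <-> y \is a Num.int.
Proof.
split=> [/normr0_eq0/eqP|/intrP[k ->]].
  by rewrite subr_eq0 => /eqP ->; exact: intr_int.
apply/eqP; rewrite eq_le nrm_ge0 andbT.
by apply: (le_trans (nrm_le _ k)); rewrite subrr normr0.
Qed.

Lemma nrm_continuous : continuous nrm.
Proof.
move=> x; apply/cvgrPdist_le => e e0; near=> y.
have xy : `|x - y| <= e by near: y; exact: cvgr_dist_le.
have h1 := nrm_dist x y; have h2 := nrm_dist y x; rewrite (distrC y x) in h2.
by rewrite ler_norml; apply/andP; split; lra.
Unshelve. all: by end_near. Qed.

End dist_to_int.

Section irrational_rotation.
Variable R : realType.
Implicit Types (a x y : R).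

Lemma harmonic_unbounded (K : R) : exists n : nat, K <= \sum_(i < n) i.+1%:R^-1.
Proof.
apply: contrapT => /forallNP h; apply: (@dvg_harmonic R).
apply: (@nondecreasing_is_cvgn _ (series harmonic)).
  by apply/nondecreasing_seqP => n; rewrite /series /= big_nat_recr //= lerDl.
exists K => _ [n _ <-]; rewrite /series /= big_mkord.
by apply: ltW; rewrite ltNge; apply/negP; exact: h.
Qed.

(** With [d] the distance from [y] to its nearest integer, one of the two consecutive multiples of
    [d] that surround 1 is within [d / 2] of it; the same multiple of [y] is then equally close to
    an integer. *)
Lemma nrm_halve y : 0 < nrm y ->
  exists n : nat, (0 < n)%N /\ nrm (n%:R * y) <= nrm y / 2.
Proof.
rewrite {1 3}/nrm; set k := Num.floor _; set d := `|y - _| => d0.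
have d2 : d <= 2^-1 by exact: nrm_half.
have nd (n : nat) : nrm (n%:R * y) <= `|n%:R * d - 1|.
  have [h|h] := leP 0 (y - k%:~R).
    apply: (le_trans (nrm_le _ (n%:Z * k + 1))).
    rewrite /d (ger0_norm h) intrD intrM /= le_eqVlt; apply/orP; left.
    by apply/eqP; congr `| _ |; ring.
  apply: (le_trans (nrm_le _ (n%:Z * k - 1))).
  rewrite /d (ltr0_norm h) intrB intrM /= le_eqVlt; apply/orP; left.
  by apply/eqP; rewrite -normrN; congr `| _ |; ring.
pose m := Num.truncn d^-1.
have [m1 m2] : m%:R * d <= 1 /\ 1 < m%:R * d + d.
  have dV0 : 0 <= d^-1 by rewrite invr_ge0 ltW.
  have /andP[h1 h2] := truncn_itv dV0.
  rewrite -/m -natr1 in h1 h2.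
  have dd : d^-1 * d = 1 by rewrite mulVf // gt_eqF.
  by split; nra.
have [h|h] := leP (1 - m%:R * d) (d / 2).
  exists m; split.
    by rewrite lt0n; apply/eqP => m0; move: h; rewrite m0 mul0r; lra.
  by apply: (le_trans (nd m)); rewrite ler_norml; apply/andP; split; lra.
exists m.+1; split=> //; apply: (le_trans (nd m.+1)).
by rewrite -natr1 mulrDl mul1r ler_norml; apply/andP; split; lra.
Qed.

Definition irrational a := forall n : nat, (0 < n)%N -> nrm (n%:R * a) != 0.

Lemma irrational_small a : irrational a -> forall e, 0 < e ->
  exists n : nat, (0 < n)%N /\ 0 < nrm (n%:R * a) < e.
Proof.
move=> ia e e0.
have pos n : (0 < n)%N -> 0 < nrm (n%:R * a) by move=> n0; rewrite lt0r ia ?nrm_ge0.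
have H j : exists n : nat, (0 < n)%N /\ nrm (n%:R * a) <= 2^-1 ^+ j.
  elim: j => [|j [n [n0 nj]]].
    by exists 1%N; split=> //; rewrite expr0; have := nrm_half (1%:R * a); lra.
  have [m [m0 mn]] := nrm_halve (pos _ n0).
  exists (m * n)%N; split; first by rewrite muln_gt0 m0.
  rewrite natrM -mulrA (le_trans mn) // exprSr.
  by rewrite ler_pM2r // invr_gt0.
have [j je] : exists j, 2^-1 ^+ j < e :> R.
  have := @cvg_expr R 2^-1; rewrite ger0_norm // => /(_ _).
  move=> /(_ ltac:(lra)) /cvgrPdist_lt /(_ _ e0) [j _ /(_ j (leqnn j))] /=.
  by rewrite sub0r normrN ger0_norm ?exprn_ge0 // => ?; exists j.
have [n [n0 nj]] := H j.
by exists n; rewrite n0 pos //=; split => //; exact: le_lt_trans je.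
Qed.

(* A progression of step [d] crosses an integer during its first [1/d] steps,
   and then moves away from it at the rate [d]. *)
Lemma nrm_progression_sum (I L : nat) (d y : R) : 0 < d -> d^-1 + 1 + I%:R <= L%:R ->
  d^-1 * \sum_(i < I) i.+1%:R^-1 <= \sum_(m < L) (Num.max (nrm (y + m%:R * d)) d)^-1.
Proof.
move=> d0 IL; pose j := Num.floor y + 1; pose u := (j%:~R - y) / d.
have [j1 j2] : y < j%:~R /\ j%:~R <= y + 1.
  by split; [exact: floorD1_gt|rewrite intrD1 lerD2r floor_le].
have u0 : 0 <= u by rewrite divr_ge0 ?ltW // subr_gt0.
have ud : u <= d^-1.
  by rewrite /u ler_pdivrMr // mulVf ?gt_eqF //; lra.
(* Index of the first term past [j], which is met at the real time [u]. The term of index [m0 + i]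
   is at most [(i + 1) * d] beyond [j], which produces the harmonic sum. *)
pose m0 := (Num.truncn u).+1.
have /andP[mu1 mu2] := truncn_itv u0.
have m0L : (m0 + I <= L)%N.
  by rewrite -(ler_nat R) natrD /m0 -natr1; lra.
apply: (@le_trans _ _ (\sum_(m0 <= m < m0 + I) (Num.max (nrm (y + m%:R * d)) d)^-1)).
  rewrite -{1}(addn0 m0) (addnC m0 I) addnC big_addn addnK big_mkord mulr_sumr.
  apply: ler_sum => i _; rewrite -invfM lef_pV2 ?posrE; last 2 first.
  - by rewrite mulr_gt0.
  - by rewrite lt_max d0 orbT.
  rewrite ge_max; apply/andP; split; last by rewrite ler_peMr ?ler1n ?ltW.
  apply: (le_trans (nrm_le _ j)).
  have uE : y + u * d = j%:~R by rewrite /u mulfVK ?gt_eqF //; ring.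
  have -> : y + (i + m0)%:R * d - j%:~R = ((i + m0)%:R - u) * d by rewrite -uE; ring.
  rewrite normrM (gtr0_norm d0) (mulrC d) ler_pM2r // ger0_norm natrD /m0 -!natr1; last first.
    by have := ler0n R i; rewrite -natr1 in mu2; lra.
  by rewrite -natr1 in mu2; lra.
rewrite -(big_mkord xpredT (fun m : nat => (Num.max (nrm (y + m%:R * d)) d)^-1)).
rewrite (@big_cat_nat _ _ _ m0 0 L) //=; last by apply: leq_trans m0L; rewrite leq_addr.
rewrite (@big_cat_nat _ _ _ (m0 + I) m0 L) ?leq_addr //=.
have ge0 r s : 0 <= \sum_(r <= m < s) (Num.max (nrm (y + m%:R * d)) d)^-1.
  by apply: sumr_ge0 => m _; rewrite invr_ge0 le_max nrm_ge0.
by rewrite addrCA lerDl addr_ge0.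
Qed.

Lemma sum_nat_mul (F : nat -> R) (q L : nat) :
  \sum_(n < q * L) F n = \sum_(r < q) \sum_(m < L) F (m * q + r)%N.
Proof.
rewrite exchange_big /=; elim: L => [|L IH]; first by rewrite muln0 !big_ord0.
rewrite big_ord_recr /= -IH mulnS addnC -!(big_mkord xpredT F).
rewrite (@big_cat_nat _ _ _ (q * L)) ?leq_addr //=; congr (_ + _).
rewrite -{1}(add0n (q * L)%N) big_addn addnC addnK big_mkord.
by apply: eq_bigr => r _; rewrite mulnC addnC.
Qed.

(** Some multiple [q] moves the rotation by a tiny amount [d] modulo 1. A window of [q * L] steps,
    with [L] of order [1 / d], splits into [q] progressions of step [d] up to sign, each
    contributing [d^-1] times a harmonic sum as large as wished. Neither [Q] nor [e] depends on [y],
    whence the uniformity in the starting point of the orbit. *)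
Lemma irrational_rotation_sum a (K : R) : irrational a ->
  exists (Q : nat) (e : R), [/\ (0 < Q)%N, 0 < e &
    forall y, K * Q%:R <= \sum_(n < Q) (Num.max (nrm (y + n%:R * a)) e)^-1].
Proof.
(* The factor 3 pays for [L <= 3 * d^-1]. *)
move=> ia; have [I HI] := harmonic_unbounded (3 * `|K|).
have I0 : 0 < I.+2%:R^-1 :> R by rewrite invr_gt0.
have [q [q0 /andP[d0 dI]]] := irrational_small ia I0.
set d := nrm _ in d0 dI.
pose L := (Num.truncn d^-1 + I.+2)%N.
exists (q * L)%N, d; split=> //; first by rewrite muln_gt0 q0 /L addnS.
move=> y.
have dV : I.+2%:R < d^-1 by rewrite -[X in X < _]invrK ltf_pV2 ?posrE.
have dV0 : 0 <= d^-1 by rewrite invr_ge0 ltW.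
have /andP[t1 t2] := truncn_itv dV0.
have L1 : d^-1 + 1 + I%:R <= L%:R by rewrite /L natrD -!natr1 in t2 *; lra.
have L2 : L%:R <= 3 * d^-1 by rewrite /L natrD; lra.
rewrite (sum_nat_mul (fun n => (Num.max (nrm (y + n%:R * a)) d)^-1)) natrM mulrCA.
apply: (@le_trans _ _ (\sum_(r < q) K * L%:R)).
  by rewrite sumr_const card_ord mulr_natl.
apply: ler_sum => r _.
apply: (@le_trans _ _ (d^-1 * \sum_(i < I) i.+1%:R^-1)).
  apply: (@le_trans _ _ (`|K| * (3 * d^-1))).
    apply: (@le_trans _ _ (`|K| * L%:R)); first by rewrite ler_wpM2r // ler_norm.
    by rewrite ler_wpM2l.
  by have := ler_wpM2l dV0 HI; lra.
pose k := Num.floor (q%:R * a + 2^-1); pose z := y + r%:R * a.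
have [h|h] := leP 0 (q%:R * a - k%:~R).
  apply: (le_trans (nrm_progression_sum z d0 L1)); apply: ler_sum => m _.
  rewrite (_ : y + _ = z + m%:R * d + (m%:Z * k)%:~R) ?nrmDz //.
  by rewrite /d /nrm -/k (ger0_norm h) intrM natrD natrM /z /=; ring.
(* A negative drift becomes a progression of positive step after a reflection, [nrm] being even. *)
apply: (le_trans (nrm_progression_sum (- z) d0 L1)); apply: ler_sum => m _.
rewrite -(nrmN (y + _)) (_ : - (y + _) = - z + m%:R * d + (- (m%:Z * k))%:~R) ?nrmDz //.
by rewrite /d /nrm -/k (ltr0_norm h) intrN intrM natrD natrM /z /=; ring.
Qed.

End irrational_rotation.

(** * One-variable comparison lemmas and a Gronwall estimate *)

Section one_variable_calculus.
Variable R : realType.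
Implicit Types (a b t : R).

Lemma is_derive_continuous (f df : R -> R) :
  (forall x, is_derive x (1 : R) f (df x)) -> continuous f.
Proof.
by move=> h x; apply/differentiable_continuous/derivable1_diffP; have [] := h x.
Qed.

Lemma derive_le (f df : R -> R) a b (C : R) : a <= b ->
  (forall x, is_derive x (1 : R) f (df x)) ->
  (forall x, a <= x <= b -> df x <= C) -> f b - f a <= C * (b - a).
Proof.
move=> ab hf hC.
have [|c cab ->] := @MVT_segment R f df a b ab (fun x _ => hf x).
  by apply: continuous_subspaceT; exact: is_derive_continuous hf.
by rewrite ler_wpM2r ?subr_ge0 // hC // -in_itv.
Qed.

Lemma derive_ge (f df : R -> R) a b (C : R) : a <= b ->
  (forall x, is_derive x (1 : R) f (df x)) ->
  (forall x, a <= x <= b -> C <= df x) -> C * (b - a) <= f b - f a.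
Proof.
move=> ab hf hC.
suff : (- f) b - (- f) a <= - C * (b - a) by rewrite !fctE; lra.
apply: (derive_le (df := - df) ab) => x xab.
by rewrite fctE lerNl opprK hC.
Qed.

Lemma derive_le_le (f g df dg : R -> R) a b : a <= b ->
  (forall x, is_derive x (1 : R) f (df x)) ->
  (forall x, is_derive x (1 : R) g (dg x)) ->
  (forall x, a <= x <= b -> df x <= dg x) -> f b - f a <= g b - g a.
Proof.
move=> ab hf hg hfg; 
suff : 0 * (b - a) <= (g - f) b - (g - f) a by rewrite !fctE; lra.
apply: (derive_ge (df := dg - df) ab) => x /hfg.
by rewrite !fctE subr_ge0.
Qed.

(** The function [(D^2 + d^2) * exp (- 4 C t)] is nonincreasing for [t >= 0]. Squares avoid
    differentiating an absolute value; negative times follow by reversing time. *)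
Lemma gronwall (D dD : R -> R) (C d : R) : 0 <= C -> 0 <= d -> D 0 = 0 ->
  (forall t, is_derive t (1 : R) D (dD t)) ->
  (forall t, `|dD t| <= C * (d + `|D t|)) ->
  forall t, D t ^+ 2 <= d ^+ 2 * expR (4 * C * `|t|).
Proof.
move=> C0 d0 + + +.
wlog suff pos : D dD / D 0 = 0 -> (forall t, is_derive t (1 : R) D (dD t)) ->
    (forall t, `|dD t| <= C * (d + `|D t|)) ->
    forall t, 0 <= t -> D t ^+ 2 <= d ^+ 2 * expR (4 * C * t).
  move=> D0 hD hdD t; have [t0|t0] := leP 0 t.
    by rewrite ger0_norm //; exact: pos hD hdD _ _.
  rewrite ltr0_norm // -{1}(opprK t).
  apply: (pos (D \o -%R) (fun t => - dD (- t))) => [|x|x|] /=.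
  - by rewrite oppr0.
  - have hD' := hD (- x).
    have hN : is_derive x (1 : R) -%R (- 1) by exact: is_deriveN.
    by apply: (is_derive_eq (is_derive1_comp hD' hN)); rewrite mulrN1.
  - by rewrite normrN.
  - by rewrite oppr_ge0 ltW.
move=> D0 hD hdD t t0.
pose v t := (D t ^+ 2 + d ^+ 2) * expR (- (4 * C) * t).
pose dv t := (2 * D t * dD t) * expR (- (4 * C) * t)
  + (D t ^+ 2 + d ^+ 2) * (- (4 * C) * expR (- (4 * C) * t)).
have hv x : is_derive x (1 : R) v (dv x).
  have hx := hD x.
  have h1 : is_derive x (1 : R) (fun t => D t ^+ 2 + d ^+ 2) (2 * D x * dD x).
    apply: (is_derive_eq (is_deriveD (is_deriveX 2 hx) (is_derive_cst (d ^+ 2) x 1))).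
    by rewrite addr0 expr1.
  have h2 : is_derive x (1 : R) (fun t => expR (- (4 * C) * t))
      (- (4 * C) * expR (- (4 * C) * x)).
    have h3 : is_derive x (1 : R) ( *%R (- (4 * C))) (- (4 * C)).
      apply: (is_derive_eq (is_deriveZ (- (4 * C)) (is_derive_id x (1 : R)))).
      by rewrite /GRing.scale /= mulr1.
    by apply: (is_derive_eq (is_derive1_comp (is_derive_expR _) h3)); rewrite mulrC.
  by apply: (is_derive_eq (is_deriveM h1 h2)); rewrite /dv /GRing.scale /=; ring.
have vle : v t - v 0 <= 0 * (t - 0).
  apply: derive_le => // x _; rewrite /dv.
  have e0 := expR_gt0 (- (4 * C) * x); set e := expR _ in e0 *.
  have h := hdD x.
  have : D x * dD x <= `|D x| * (C * (d + `|D x|)).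
    rewrite (le_trans (ler_norm _)) // normrM ler_wpM2l //.
  have := sqr_ge0 (`|D x| - d); have := real_normK (num_real (D x)).
  set n := `|D x|; move=> <- s1 s2.
  have : 2 * (D x * dD x) <= 4 * C * (n ^+ 2 + d ^+ 2).
    apply: (@le_trans _ _ (2 * (n * (C * (d + n))))); first by lra.
    by rewrite -subr_ge0; have := mulr_ge0 C0 s1; have := mulr_ge0 C0 (sqr_ge0 n);
      have := mulr_ge0 C0 (sqr_ge0 d); lra.
  by move=> s3; have : 0 <= (4 * C * (n ^+ 2 + d ^+ 2) - 2 * (D x * dD x)) * e;
    [rewrite mulr_ge0 ?subr_ge0 // ltW|lra].
have : v t <= d ^+ 2.
  by move: vle; rewrite mul0r subr_le0 => /le_trans; apply; rewrite /v D0 mulr0 expR0 mulr1 expr0n /= add0r.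
rewrite /v mulNr expRN ler_pdivrMr ?expR_gt0 //; apply: le_trans.
by rewrite lerDl sqr_ge0.
Qed.

End one_variable_calculus.

(** * Periodic functions near their zeros *)

Section periodic_functions.
Variable R : realType.
Implicit Types (f g : R * R -> R) (z w v u : R * R) (t : R).

Definition l1 z : R := `|z.1| + `|z.2|.

Lemma l1_ge0 z : 0 <= l1 z. Proof. by rewrite addr_ge0. Qed.

Lemma l1Z t z : l1 (t *: z) = `|t| * l1 z.
Proof. by rewrite /l1 /= !normrM mulrDr. Qed.

Definition biperiodic f :=
  forall z (k l : int), f (z.1 + k%:~R, z.2 + l%:~R) = f z.

Lemma is_derive_line f z v t : derivable f (z + t *: v) v ->
  is_derive t (1 : R) (fun t => f (z + t *: v)) ('D_v f (z + t *: v)).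
Proof.
move=> df; have H :
    (fun h => h^-1 *: (f (z + (h *: 1 + t) *: v) - f (z + t *: v))) =
    (fun h : R => h^-1 *: (f (h *: v + (z + t *: v)) - f (z + t *: v))).
  apply/funext => h; congr (_ *: (f _ - _)).
  by rewrite scalerDl [h *: 1]mulr1 addrCA.
split; first by rewrite /derivable /= H.
by rewrite /derive /= H.
Qed.

Lemma derive_biperiodic f v : biperiodic f -> biperiodic (fun z => 'D_v f z).
Proof.
move=> pf z k l; rewrite /derive.
suff -> : (fun h : R => h^-1 *: ((f \o shift (z.1 + k%:~R, z.2 + l%:~R)) (h *: v) -
    f (z.1 + k%:~R, z.2 + l%:~R))) =
  (fun h => h^-1 *: ((f \o shift z) (h *: v) - f z)) by [].
apply/funext => h /=; rewrite -(pf z k l) -(pf (h *: v + z) k l) /=.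
by congr (_ *: (f _ - _)); apply: injective_projections; rewrite /= addrA.
Qed.

Lemma unit_square_compact : compact (`[0, 1] `*` `[0, 1] : set (R * R)).
Proof. by apply: compact_setX; exact: segment_compact. Qed.

Definition fracpt z : R * R :=
  (z.1 - (Num.floor z.1)%:~R, z.2 - (Num.floor z.2)%:~R).

Lemma fracpt_square z : (`[0, 1] `*` `[0, 1] : set (R * R)) (fracpt z).
Proof.
by split; rewrite /= in_itv /=; have := floor_le; have := floorD1_gt;
  move=> /(_ R) h1 /(_ R) h2; rewrite subr_ge0 h2 /= lerBlDr addrC -intrD1 ltW.
Qed.

Lemma biperiodic_frac f z : biperiodic f -> f (fracpt z) = f z.
Proof. by move=> pf; rewrite -(pf z (- Num.floor z.1) (- Num.floor z.2)) !intrN. Qed.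

Lemma biperiodic_bounded f : biperiodic f -> continuous f ->
  exists M, 0 <= M /\ forall z, `|f z| <= M.
Proof.
move=> pf cf.
have [||c _ hc] := @compact_EVT_max _ R (fun z => `|f z|) _ _ unit_square_compact.
- by exists (fracpt 0); exact: fracpt_square.
- by apply: continuous_subspaceT => z; apply: continuous_comp; [exact: cf|exact: norm_continuous].
exists `|f c|; split=> // z; rewrite -(biperiodic_frac z pf).
by apply: hc; rewrite inE; exact: fracpt_square.
Qed.

(** Where [|g| >= e], a compact set modulo periods, [f] has a positive minimum. With [f] the speed
    of the flow, the integral of [g] along an orbit is thereby controlled by that of [f], which is a
    displacement. *)
Lemma biperiodic_dominated g f (e : R) : biperiodic g -> continuous g ->
  biperiodic f -> continuous f -> (forall z, 0 <= f z) ->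
  (forall z, f z = 0 -> g z = 0) -> 0 < e ->
  exists C, 0 <= C /\ forall z, `|g z| <= e + C * f z.
Proof.
move=> pg cg pf cf f0 fg e0.
pose K := (`[0, 1] `*` `[0, 1] : set (R * R)) `&` [set z | e <= `|g z|].
have cK : compact K.
  apply: compact_closedI; first exact: unit_square_compact.
  apply: (@preimage_closed _ _ (fun z => `|g z|) [set x | e <= x]); last exact: closed_ge.
  by move=> z _; apply: continuous_comp; [exact: cg|exact: norm_continuous].
have [M [M0 HM]] := biperiodic_bounded pg cg.
have [[z0 Kz0]|K0] := pselect (K !=set0); last first.
  exists 0; split=> // z; rewrite mul0r addr0 -(biperiodic_frac z pg).
  rewrite leNgt; apply/negP => /ltW h; apply: K0; exists (fracpt z).
  by split=> //; exact: fracpt_square.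
have [||c cK' hc] := @compact_EVT_min _ R f K _ cK.
- by exists z0.
- exact: continuous_subspaceT.
rewrite inE in cK'.
have fc : 0 < f c.
  rewrite lt0r f0 andbT; apply/eqP => /fg gc.
  by case: cK' => _ /=; rewrite gc normr0 leNgt e0.
exists (M / f c); split; first by rewrite divr_ge0.
move=> z; rewrite -(biperiodic_frac z pg) -(biperiodic_frac z pf).
have [h|h] := leP e `|g (fracpt z)|; last first.
  by rewrite (le_trans (ltW h)) // lerDl mulr_ge0 // divr_ge0.
have /hc : fracpt z \in K by rewrite inE; split=> //; exact: fracpt_square.
move=> fz; apply: (le_trans (HM _)); apply: (@le_trans _ _ (M / f c * f c)).
  by rewrite mulfVK // gt_eqF.
have : M / f c * f c <= M / f c * f (fracpt z) by rewrite ler_wpM2l // divr_ge0.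
lra.
Qed.

Lemma deriveD_coord f z v : differentiable f z ->
  'D_v f z = v.1 * 'D_(1, 0) f z + v.2 * 'D_(0, 1) f z.
Proof.
move=> df; rewrite !deriveE //.
have {1}-> : v = v.1 *: ((1, 0) : R * R) + v.2 *: ((0, 1) : R * R).
  by apply: injective_projections;
    rewrite /= /GRing.scale /= ?mulr1 ?mulr0 ?addr0 ?add0r.
by rewrite linearD !linearZ.
Qed.

Lemma Ck1_lipschitz f : biperiodic f -> Ck 1 f ->
  exists L, 0 <= L /\ forall z w, `|f z - f w| <= L * l1 (z - w).
Proof.
move=> pf [df cf].
have [L1 [L10 HL1]] := biperiodic_bounded (derive_biperiodic (1, 0) pf) (cf (1, 0)).
have [L2 [L20 HL2]] := biperiodic_bounded (derive_biperiodic (0, 1) pf) (cf (0, 1)).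
have H v z (L t : R) : 0 <= L -> (forall z, `|'D_v f z| <= L) ->
    `|f (z + t *: v) - f z| <= L * `|t|.
  move=> L0 HL.
  wlog t0 : t z / 0 <= t => [hw|].
    have [|t0] := leP 0 t; first exact: hw.
    have := hw (- t) (z + t *: v); rewrite scaleNr addrK distrC normrN; apply.
    by rewrite oppr_ge0 ltW.
  have ld x : is_derive x (1 : R) (fun t => f (z + t *: v)) ('D_v f (z + x *: v)).
    by apply: is_derive_line; exact: diff_derivable.
  have b x : - L <= 'D_v f (z + x *: v) <= L by rewrite -ler_norml.
  have l1 := @derive_le R _ _ 0 t L t0 ld (fun x _ => proj2 (andP (b x))).
  have l2 := @derive_ge R _ _ 0 t (- L) t0 ld (fun x _ => proj1 (andP (b x))).
  rewrite scale0r addr0 subr0 in l1 l2.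
  by rewrite (ger0_norm t0) ler_norml l1 -mulNr l2.
exists (L1 + L2); split; first exact: addr_ge0.
move=> z w.
have E1 : z = (w.1, z.2) + (z.1 - w.1) *: ((1, 0) : R * R).
  by apply: injective_projections; rewrite /= /GRing.scale /= ?mulr1 ?mulr0; ring.
have E2 : (w.1, z.2) = w + (z.2 - w.2) *: ((0, 1) : R * R).
  by apply: injective_projections; rewrite /= /GRing.scale /= ?mulr1 ?mulr0; ring.
have h1 := H (1, 0) (w.1, z.2) L1 (z.1 - w.1) L10 HL1; rewrite -E1 in h1.
have h2 := H (0, 1) w L2 (z.2 - w.2) L20 HL2; rewrite -E2 in h2.
apply: (le_trans (ler_distD (f (w.1, z.2)) _ _)).
apply: (le_trans (lerD h1 h2)); rewrite /l1 /=.
have := normr_ge0 (z.1 - w.1); have := normr_ge0 (z.2 - w.2).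
set x := `|_|; set y := `|_|; nra.
Qed.

Lemma continuous_add f g : continuous f -> continuous g -> continuous (fun z => f z + g z).
Proof. by move=> cf cg z; apply: cvgD; [exact: cf|exact: cg]. Qed.

Section zero_of_nonnegative.
Variables (f : R * R -> R) (c : R * R).
Hypothesis (pf : biperiodic f) (f0 : forall z, 0 <= f z) (fc : f c = 0).

Lemma derive_at_zero v : (forall z, differentiable f z) -> 'D_v f c = 0.
Proof.
move=> df; pose g t := f (c + t *: v).
have hg t : is_derive t (1 : R) g ('D_v f (c + t *: v)).
  by apply: is_derive_line; exact: diff_derivable.
have h0 : is_derive (0 : R) (1 : R) g 0.
  apply: (@derive1_at_min R g (- 1) 1 0); first by lra.
  - by move=> t _; have [] := hg t.
  - by rewrite in_itv /=; apply/andP; split; lra.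
  - by move=> t _; rewrite /g scale0r addr0 fc.
have [_ <-] := h0.
by have [_] := hg 0; rewrite scale0r addr0.
Qed.

(** The gradient vanishes at the minimum [c] and is Lipschitz, hence grows at most linearly along
    the segment from [c]. *)
Lemma zero_upper_bound : Ck 2 f -> exists C, 0 <= C /\ forall z, f (c + z) <= C * l1 z ^+ 2.
Proof.
move=> [df cf].
have [L1 [L10 HL1]] := Ck1_lipschitz (derive_biperiodic (1, 0) pf) (cf (1, 0)).
have [L2 [L20 HL2]] := Ck1_lipschitz (derive_biperiodic (0, 1) pf) (cf (0, 1)).
exists (L1 + L2); split=> [|z]; first exact: addr_ge0.
have hg t : is_derive t (1 : R) (fun t => f (c + t *: z)) ('D_z f (c + t *: z)).
  by apply: is_derive_line; exact: diff_derivable.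
have := @derive_le R _ _ 0 1 ((L1 + L2) * l1 z ^+ 2) ler01 hg _.
rewrite scale1r scale0r addr0 fc !subr0 mulr1; apply=> t /andP[t0 t1].
have [d1 [d2 [-> h1 h2]]] : exists d1 d2, [/\ 'D_z f (c + t *: z) = z.1 * d1 + z.2 * d2,
    `|d1| <= L1 * (t * l1 z) & `|d2| <= L2 * (t * l1 z)].
  exists ('D_(1, 0) f (c + t *: z)), ('D_(0, 1) f (c + t *: z)); split.
  - exact: deriveD_coord.
  - have := HL1 (c + t *: z) c.
    by rewrite derive_at_zero // subr0 (addrC c) addrK l1Z (ger0_norm t0).
  - have := HL2 (c + t *: z) c.
    by rewrite derive_at_zero // subr0 (addrC c) addrK l1Z (ger0_norm t0).
have l0 := l1_ge0 z.
have tl : t * l1 z <= l1 z by rewrite ler_piMl.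
have b1 : z.1 * d1 <= `|z.1| * (L1 * l1 z).
  rewrite (le_trans (ler_norm _)) // normrM ler_wpM2l // (le_trans h1) //.
  by rewrite ler_wpM2l.
have b2 : z.2 * d2 <= `|z.2| * (L2 * l1 z).
  rewrite (le_trans (ler_norm _)) // normrM ler_wpM2l // (le_trans h2) //.
  by rewrite ler_wpM2l.
apply: (le_trans (lerD b1 b2)); rewrite /l1 in l0 *.
have n1 := normr_ge0 z.1; have n2 := normr_ge0 z.2.
have := mulr_ge0 L20 (mulr_ge0 n1 l0); have := mulr_ge0 L10 (mulr_ge0 n2 l0); lra.
Qed.

Lemma hessian_coord z v : Ck 2 f -> hessian f z v v =
  v.1 ^+ 2 * hessian f z (1, 0) (1, 0) +
  v.1 * v.2 * (hessian f z (1, 0) (0, 1) + hessian f z (0, 1) (1, 0)) +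
  v.2 ^+ 2 * hessian f z (0, 1) (0, 1).
Proof.
move=> [df cf]; rewrite /hessian.
have [d1 _] := cf (1, 0); have [d2 _] := cf (0, 1).
have -> : (fun w => 'D_v f w) =
    v.1 \*: (fun w => 'D_(1, 0) f w) + v.2 \*: (fun w => 'D_(0, 1) f w).
  by apply/funext => w; rewrite deriveD_coord.
move: (d1 z) (d2 z).
move: (fun w => 'D_(1, 0) f w) (fun w => 'D_(0, 1) f w) => g1 g2 dg1 dg2.
have H1 := derivableP (diff_derivable dg1 : derivable g1 z v).
have H2 := derivableP (diff_derivable dg2 : derivable g2 z v).
have [_ ->] := is_deriveD (is_deriveZ v.1 H1) (is_deriveZ v.2 H2).
rewrite (deriveD_coord v dg1) (deriveD_coord v dg2) /GRing.scale /=.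
by move: ('D_(1, 0) g1 z) ('D_(0, 1) g1 z) ('D_(1, 0) g2 z) ('D_(0, 1) g2 z) => *; ring.
Qed.

(** The lower bound of the quadratic form at [c] survives, halved, where the coefficients have moved
    little. Two integrations along the segment from [c], where [f] and its gradient vanish, give the
    quadratic growth. *)
Lemma zero_lower_bound : Ck 2 f -> positive_definite (hessian f c) ->
  exists k r, [/\ 0 < k, 0 < r & forall z, l1 z < r -> k * l1 z ^+ 2 <= f (c + z)].
Proof.
move=> C2 pd; have [df cf] := C2.
have [a [b [d [[ca cb cd] HQ]]]] : exists a b d : R * R -> R,
    [/\ continuous a, continuous b & continuous d] /\ forall z v,
    hessian f z v v = v.1 ^+ 2 * a z + v.1 * v.2 * b z + v.2 ^+ 2 * d z.
  exists (fun z => hessian f z (1, 0) (1, 0)),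
    (fun z => hessian f z (1, 0) (0, 1) + hessian f z (0, 1) (1, 0)),
    (fun z => hessian f z (0, 1) (0, 1)); split; last by move=> z v; exact: hessian_coord.
  split.
  - exact: (proj2 (cf (1, 0)) (1, 0)).
  - apply: continuous_add; first exact: (proj2 (cf (0, 1)) (1, 0)).
    exact: (proj2 (cf (1, 0)) (0, 1)).
  - exact: (proj2 (cf (0, 1)) (0, 1)).
have nz (x y : R) : (x != 0) || (y != 0) -> ((x, y) : R * R) != 0.
  by apply: contraTN => /eqP[-> ->]; rewrite eqxx.
have a0 : 0 < a c.
  have : 0 < hessian f c (1, 0) (1, 0) by apply: pd; apply: nz; rewrite oner_eq0.
  by rewrite HQ /=; lra.
have d0 : 0 < d c.
  have : 0 < hessian f c (0, 1) (0, 1) by apply: pd; apply: nz; rewrite oner_eq0 orbT.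
  by rewrite HQ /=; lra.
have disc : 0 < 4 * a c * d c - b c ^+ 2.
  have : 0 < hessian f c (b c, - (2 * a c)) (b c, - (2 * a c)).
    by apply: pd; apply: nz; rewrite oppr_eq0 mulf_eq0 pnatr_eq0 (gt_eqF a0) orbT.
  rewrite HQ /= => h.
  have : 0 < a c * (4 * a c * d c - b c ^+ 2) by move: h; congr (0 < _); ring.
  by rewrite pmulr_rgt0.
(* Determinant over trace of the matrix of the form, a quantity below its least eigenvalue; [Qc]
   checks this with a sum of two squares. *)
pose l := (4 * a c * d c - b c ^+ 2) / (4 * (a c + d c)).
have l0 : 0 < l by rewrite divr_gt0 // mulr_gt0 // addr_gt0.
have Qc v : l * (v.1 ^+ 2 + v.2 ^+ 2) <= hessian f c v v.
  have ad : 0 < a c + d c by exact: addr_gt0.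
  rewrite HQ -subr_ge0 -(pmulr_rge0 _ ad).
  have -> : (a c + d c) * (v.1 ^+ 2 * a c + v.1 * v.2 * b c + v.2 ^+ 2 * d c -
      l * (v.1 ^+ 2 + v.2 ^+ 2)) =
      (a c * v.1 + b c * v.2 / 2) ^+ 2 + (b c * v.1 / 2 + d c * v.2) ^+ 2.
    by rewrite /l; field; rewrite gt_eqF.
  by rewrite addr_ge0 ?sqr_ge0.
have l8 : 0 < l / 8 by rewrite divr_gt0.
have : \forall z \near c, `|a c - a z| < l / 8 /\ (`|b c - b z| < l / 8 /\ `|d c - d z| < l / 8).
  near=> z; split; [|split]; near: z.
  - by have /cvgrPdist_lt/(_ _ l8) := ca c.
  - by have /cvgrPdist_lt/(_ _ l8) := cb c.
  - by have /cvgrPdist_lt/(_ _ l8) := cd c.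
move=> /nbhs_ballP[r /= r0 hr].
have Qz z v : l1 z < r -> l / 2 * (v.1 ^+ 2 + v.2 ^+ 2) <= hessian f (c + z) v v.
  move=> zr.
  have /hr[h1 [h2 h3]] : ball c r (c + z).
    rewrite -ball_normE /ball_ /= opprD addrA subrr sub0r normrN.
    apply: le_lt_trans zr; rewrite /Num.norm /= ge_max /l1.
    by rewrite lerDl lerDr !normr_ge0.
  have := Qc v; rewrite !HQ; move: h1 h2 h3.
  rewrite !ltr_norml => /andP[h1 h1'] /andP[h2 h2'] /andP[h3 h3'].
  have s1 := sqr_ge0 v.1; have s2 := sqr_ge0 v.2.
  have xy1 := sqr_ge0 (v.1 + v.2); have xy2 := sqr_ge0 (v.1 - v.2).
  have e1 := mulr_ge0 s1 (ltW (_ : 0 < l / 8 - (a c - a (c + z)))).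
  rewrite subr_gt0 in e1; have {}e1 := e1 h1'.
  have e3 := mulr_ge0 s2 (ltW (_ : 0 < l / 8 - (d c - d (c + z)))).
  rewrite subr_gt0 in e3; have {}e3 := e3 h3'.
  have e4 := mulr_ge0 xy1 (ltW (_ : 0 < l / 8 - (b c - b (c + z)))).
  rewrite subr_gt0 in e4; have {}e4 := e4 h2'.
  have e5 := mulr_ge0 xy2 (ltW (_ : 0 < l / 8 + (b c - b (c + z)))).
  have {}e5 := e5 ltac:(lra).
  have := mulr_ge0 s1 (ltW l0); have := mulr_ge0 s2 (ltW l0); lra.
exists (l / 8), r; split=> // z zr.
pose m := l / 2 * (z.1 ^+ 2 + z.2 ^+ 2).
have m0 : 0 <= m by rewrite mulr_ge0 ?addr_ge0 ?sqr_ge0 // divr_ge0 // ltW.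
have hg t : is_derive t (1 : R) (fun t => f (c + t *: z)) ('D_z f (c + t *: z)).
  by apply: is_derive_line; exact: diff_derivable.
have hG t : is_derive t (1 : R) (fun t => 'D_z f (c + t *: z)) (hessian f (c + t *: z) z z).
  by apply: (@is_derive_line (fun w => 'D_z f w)); apply: diff_derivable; case: (cf z).
have Gt t : 0 <= t <= 1 -> m * t <= 'D_z f (c + t *: z).
  move=> /andP[t0 t1].
  have := @derive_ge R _ _ 0 t m t0 hG _.
  rewrite scale0r addr0 derive_at_zero // !subr0; apply=> x /andP[x0 xt].
  apply: Qz; rewrite l1Z ger0_norm // (le_lt_trans _ zr) // ler_piMl ?l1_ge0 //.
  exact: le_trans t1.
have hq (t : R) : is_derive t (1 : R) (fun t => m / 2 * t ^+ 2) (m * t).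
  have h2 := is_deriveX 2 (is_derive_id t (1 : R)).
  by apply: (is_derive_eq (is_deriveZ (m / 2) h2)); rewrite /GRing.scale /=; field.
have := derive_le_le ler01 hq hg Gt.
rewrite scale1r scale0r addr0 fc expr1n expr0n /= mulr0 !subr0 mulr1.
apply: le_trans; rewrite /m /l1.
have := sqr_ge0 (`|z.1| - `|z.2|); rewrite -(real_normK (num_real z.1)) -(real_normK (num_real z.2)).
move=> s; have := mulr_ge0 (ltW l0) s; lra.
Unshelve. all: by end_near. Qed.

End zero_of_nonnegative.

End periodic_functions.

(** * Displacement along the linear orbit *)

Section torus_lifts.
Variable R : realType.
Implicit Types (z w : R * R) (x y : torus R).

Lemma to_circle_int (r : R) (k : int) : to_circle (r + k%:~R) = to_circle r.
Proof. by apply/to_circleP; rewrite addrC addKr intr_int. Qed.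

Lemma to_torus_biperiodic (g : torus R -> R) : biperiodic (g \o @to_torus R).
Proof. by move=> z k l; rewrite /= /to_torus /= !to_circle_int. Qed.

Lemma torus_repK : cancel (@torus_rep R) (@to_torus R).
Proof. by case=> a b; rewrite /to_torus /torus_rep /= !circle_repK. Qed.

Lemma to_torus_eqP z w : to_torus z = to_torus w ->
  exists k l : int, z = (w.1 + k%:~R, w.2 + l%:~R).
Proof.
case: z w => [z1 z2] [w1 w2] [/to_circleP/intrP[k hk] /to_circleP/intrP[l hl]].
by exists k, l; rewrite -hk -hl /= !(addrC w1, addrC w2) !subrK.
Qed.

End torus_lifts.

Section derive_pair.
Variable R : realType.
Implicit Types (g : R -> R * R) (t : R) (v : R * R).

Lemma is_derive_fst g t v :
  is_derive t (1 : R) g v -> is_derive t (1 : R) (fun t => (g t).1) v.1.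
Proof.
move=> [dg <-].
have H : (fun h : R => h^-1 *: (((fun t => (g t).1) \o shift t) (h *: 1) - (g t).1)) @ 0^' -->
    ('D_1 g t).1.
  have c : {for 'D_1 g t, continuous (@fst R R)} by case: ('D_1 g t) => a b; exact: cvg_fst.
  exact: (@cvg_comp _ _ _ (fun h : R => h^-1 *: ((g \o shift t) (h *: 1) - g t)) fst _ _ _ dg c).
by split; [apply/cvg_ex; exists ('D_1 g t).1|exact: cvg_lim H].
Qed.

Lemma is_derive_snd g t v :
  is_derive t (1 : R) g v -> is_derive t (1 : R) (fun t => (g t).2) v.2.
Proof.
move=> [dg <-].
have H : (fun h : R => h^-1 *: (((fun t => (g t).2) \o shift t) (h *: 1) - (g t).2)) @ 0^' -->
    ('D_1 g t).2.
  have c : {for 'D_1 g t, continuous (@snd R R)} by case: ('D_1 g t) => a b; exact: cvg_snd.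
  exact: (@cvg_comp _ _ _ (fun h : R => h^-1 *: ((g \o shift t) (h *: 1) - g t)) snd _ _ _ dg c).
by split; [apply/cvg_ex; exists ('D_1 g t).2|exact: cvg_lim H].
Qed.

End derive_pair.

Section displacement.
Variables (R : realType) (al : R) (phi : torus R -> R) (Phi : R -> torus R -> torus R).
Let f := phi \o @to_torus R.
Let X0 : R * R := (1, al).
Hypothesis (f_C1 : Ck 1 f).
Hypothesis (flow : flow_generated (fun x => phi x *: (1, al)) Phi).

Implicit Types (z w : R * R) (s : R -> R) (t u : R).

(** The field is parallel to the constant vector [X0], so the lifted orbit of [z] stays on a line
    and the flow reduces to this scalar equation for the multiple of [X0] travelled. *)
Definition solution z s :=
  s 0 = 0 /\ forall t, is_derive t (1 : R) s (f (z + s t *: X0)).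

(** Gives both uniqueness, when [z = w], and continuity in the initial point, from which the
    measurability of the flow is deduced. *)
Lemma solution_gronwall : exists C, 0 <= C /\ forall z w s s',
  solution z s -> solution w s' ->
  forall t, (s t - s' t) ^+ 2 <= l1 (z - w) ^+ 2 * expR (4 * C * `|t|).
Proof.
have [L [L0 HL]] := Ck1_lipschitz (to_torus_biperiodic phi) f_C1.
exists (L * (1 + l1 X0)); split=> [|z w s s' [s0 hs] [s'0 hs']].
  by rewrite mulr_ge0 ?addr_ge0 ?l1_ge0.
apply: (@gronwall R (s - s') (fun t => f (z + s t *: X0) - f (w + s' t *: X0))).
- by rewrite mulr_ge0 ?addr_ge0 ?l1_ge0.
- exact: l1_ge0.
- by rewrite !fctE s0 s'0 subrr.
move=> t; apply: (le_trans (HL _ _)); rewrite -mulrA ler_wpM2l // !fctE.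
set d := s t - s' t.
have : l1 (z + s t *: X0 - (w + s' t *: X0)) <= l1 (z - w) + `|d| * l1 X0.
  rewrite opprD addrACA -scalerBl -/d -l1Z /l1 /= addrACA.
  by apply: lerD; exact: ler_normD.
have A0 := l1_ge0 (z - w); have B0 := l1_ge0 X0; have D0 := normr_ge0 d.
by have := mulr_ge0 A0 B0; nra.
Qed.

Lemma solution_unique z s s' : solution z s -> solution z s' -> s =1 s'.
Proof.
move=> hs hs' t; have [C [_ /(_ z z s s' hs hs' t)]] := solution_gronwall.
rewrite subrr /l1 normr0 addr0 expr0n mul0r => h.
by apply/eqP; rewrite -subr_eq0 -sqrf_eq0 eq_le h sqr_ge0.
Qed.


Lemma displacement_exists z : exists2 s, solution z s &
  forall t, to_torus (z + s t *: X0) = Phi t (to_torus z).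
Proof.
have [_ _ /(_ z)[g [g0 gPhi dg]]] := flow.
pose s t := (g t).1 - z.1.
have dg1 t : is_derive t (1 : R) (fun t => (g t).1) (phi (to_torus (g t))).
  by have := is_derive_fst (dg t); rewrite /= /GRing.scale /= mulr1.
have dg2 t : is_derive t (1 : R) (fun t => (g t).2) (phi (to_torus (g t)) * al).
  by have := is_derive_snd (dg t).
have gE t : g t = z + s t *: X0.
  have H x : is_derive x (1 : R) ((fun t => (g t).2) - al \*: (fun t => (g t).1)) 0.
    apply: (is_derive_eq (is_deriveB (dg2 x) (is_deriveZ al (dg1 x)))).
    by rewrite /GRing.scale /= mulrC subrr.
  have h : (g t).2 - al * (g t).1 = z.2 - al * z.1.
    by rewrite -g0; exact: (@is_derive_0_is_cst R _ t 0 H).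
  apply: injective_projections; rewrite /= /GRing.scale /= /s ?mulr1; first by ring.
  by rewrite -[LHS](subrK (al * (g t).1)) h; ring.
exists s; last by move=> t; rewrite -gE.
split=> [|t]; first by rewrite /s g0 subrr.
rewrite -gE /=.
by apply: (is_derive_eq (is_deriveB (dg1 t) (is_derive_cst z.1 t 1))); rewrite subr0.
Qed.

(** [flow_generated] provides a lift for each initial point separately, so the displacement is
    chosen; [solution_unique] makes the choices at different points compatible (periodicity, cocycle
    relation). *)
Definition disp z : R -> R := sval (cid2 (displacement_exists z)).

Lemma disp_solution z : solution z (disp z).
Proof. by rewrite /disp; case: cid2. Qed.

Lemma to_torus_disp z t : to_torus (z + disp z t *: X0) = Phi t (to_torus z).
Proof. by rewrite /disp; case: cid2. Qed.

Lemma disp0 z : disp z 0 = 0. Proof. by case: (disp_solution z). Qed.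

Lemma is_derive_disp z t : is_derive t (1 : R) (disp z) (f (z + disp z t *: X0)).
Proof. by case: (disp_solution z). Qed.

Lemma disp_continuous z : continuous (disp z).
Proof. exact: is_derive_continuous (is_derive_disp z). Qed.

Lemma disp_periodic z (k l : int) : disp (z.1 + k%:~R, z.2 + l%:~R) =1 disp z.
Proof.
apply: (@solution_unique (z.1 + k%:~R, z.2 + l%:~R)); first exact: disp_solution.
split=> [|t]; first exact: disp0.
have -> : (z.1 + k%:~R, z.2 + l%:~R) + disp z t *: X0 =
    ((z + disp z t *: X0).1 + k%:~R, (z + disp z t *: X0).2 + l%:~R).
  by apply: injective_projections; rewrite /= addrAC.
rewrite (to_torus_biperiodic phi : biperiodic f); exact: is_derive_disp.
Qed.

Lemma disp_torus z w : to_torus z = to_torus w -> disp z =1 disp w.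
Proof. by move=> /to_torus_eqP[k [l ->]]; exact: disp_periodic. Qed.

Lemma disp_cocycle z u t : disp z (u + t) = disp z u + disp (z + disp z u *: X0) t.
Proof.
set w := z + _.
suff /(solution_unique (disp_solution w))/(_ t) -> : solution w (fun t => disp z (u + t) - disp z u).
  by rewrite [RHS]addrC subrK.
split=> [|x]; first by rewrite addr0 subrr.
have -> : w + (disp z (u + x) - disp z u) *: X0 = z + disp z (u + x) *: X0.
  by rewrite /w scalerBl addrACA subrr addr0.
have h : is_derive x (1 : R) (fun x => u + x) 1.
  by apply: (is_derive_eq (is_deriveD (is_derive_cst u x 1) (is_derive_id x (1 : R)))); rewrite add0r.
have h' := is_derive1_comp (is_derive_disp z (u + x)) h.
by apply: (is_derive_eq (is_deriveB h' (is_derive_cst (disp z u) x 1))); rewrite subr0 mulr1.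
Qed.

Lemma disp_stopped z : f z = 0 -> forall t, disp z t = 0.
Proof.
move=> fz; apply: (solution_unique (disp_solution z)); split=> // t.
by rewrite scale0r addr0 fz; exact: is_derive_cst.
Qed.

Lemma flow_stopped x : phi x = 0 -> forall t, Phi t x = x.
Proof.
move=> px t; rewrite -{1}(torus_repK x) -to_torus_disp disp_stopped ?scale0r ?addr0 ?torus_repK //.
by rewrite /f /= torus_repK.
Qed.

Hypothesis phi_ge0 : forall x, 0 <= phi x.

Lemma disp_homo z t u : t <= u -> disp z t <= disp z u.
Proof.
move=> tu; have := derive_ge tu (is_derive_disp z) (C := 0) (fun _ _ => phi_ge0 _).
by rewrite mul0r subr_ge0.
Qed.

Lemma disp_ge0 z t : 0 <= t -> 0 <= disp z t.
Proof. by move=> t0; rewrite -(disp0 z) disp_homo. Qed.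

Lemma disp_continuous_l t : continuous (fun z => disp z t).
Proof.
have [C [C0 HC]] := solution_gronwall.
move=> z; apply/cvgrPdist_lt => e e0.
pose k := expR (4 * C * `|t|).
have k0 : 0 < k by exact: expR_gt0.
pose d := e / (2 * (1 + k)).
have d0 : 0 < d by rewrite divr_gt0 // mulr_gt0 // addr_gt0.
near=> w.
have zw : `|z - w| < d by near: w; exact: cvgr_dist_lt.
have [h1 h2] : `|z.1 - w.1| < d /\ `|z.2 - w.2| < d.
  by move: zw; rewrite {1}/Num.norm /= gt_max => /andP[].
have lzw : l1 (z - w) <= 2 * d by rewrite /l1 /=; lra.
rewrite -(@ltr_pXn2r _ 2) ?nnegrE ?normr_ge0 ?(ltW e0) // real_normK ?num_real //.
apply: (le_lt_trans (HC _ _ _ _ (disp_solution z) (disp_solution w) t)).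
rewrite -/k; have l0 := l1_ge0 (z - w).
apply: (@le_lt_trans _ _ ((2 * d) ^+ 2 * k)).
  by rewrite ler_wpM2r ?(ltW k0) // ler_pXn2r ?nnegrE // mulr_ge0 // ltW.
have -> : 2 * d = e / (1 + k) by rewrite /d; field; rewrite gt_eqF // addr_gt0.
have k1 : 0 < 1 + k by rewrite addr_gt0.
rewrite expr_div_n mulrAC ltr_pdivrMr ?exprn_gt0 //.
by rewrite ltr_pM2l ?exprn_gt0 //; have := sqr_ge0 k; lra.
Unshelve. all: by end_near. Qed.

End displacement.

(** * Encounters of a line with the lattice translates of a point *)

Section columns.
Variable R : realType.
Implicit Types (al s d w : R) (z c : R * R) (n : nat).

(* The orbit of [z] along [(1, al)] meets at time [col] the vertical line of
   abscissa [c.1 + (n - 1)], at height [off] above a lattice translate of [c]. *)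
Definition col c z n : R := c.1 - z.1 - 1 + n%:R.
Definition off al c z n : R := z.2 - c.2 + al * col c z n.

Lemma colS c z n : col c z n.+1 = col c z n + 1.
Proof. by rewrite /col -natr1 addrA. Qed.

Lemma off_add al c z n m : off al c z (m + n)%N = off al c z m + n%:R * al.
Proof. by rewrite /off /col natrD; ring. Qed.

Lemma line_at_col al c z n w (j : int) :
  z + (col c z n + w) *: ((1, al) : R * R) =
  ((c + (w, off al c z n - j%:~R + al * w)).1 + (n%:Z - 1)%:~R,
   (c + (w, off al c z n - j%:~R + al * w)).2 + j%:~R).
Proof.
by apply: injective_projections; rewrite /= /GRing.scale /= /off /col ?intrB; ring.
Qed.

Lemma biperiodic_at_col (f : R * R -> R) al c z n w (j : int) : biperiodic f ->
  f (z + (col c z n + w) *: ((1, al) : R * R)) =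
  f (c + (w, off al c z n - j%:~R + al * w)).
Proof. by move=> pf; rewrite (line_at_col _ _ _ _ _ j) pf. Qed.

(** Three contributions to the distance from the lattice point are at most [d] each: the horizontal
    offset, the height at the column, and the drift of slope [al <= 1]. Hence [(3 * d)^2]. *)
Lemma near_col_upper (f : R * R -> R) al c z n d w C : biperiodic f ->
  0 <= al <= 1 -> 0 <= C -> (forall h, f (c + h) <= C * l1 h ^+ 2) ->
  `|w| <= d -> nrm (off al c z n) <= d ->
  f (z + (col c z n + w) *: ((1, al) : R * R)) <= 9 * C * d ^+ 2.
Proof.
move=> pf /andP[al0 al1] C0 hC wd; rewrite /nrm; set j := Num.floor _ => jd.
rewrite (biperiodic_at_col _ _ _ _ _ j) //; apply: (le_trans (hC _)).
rewrite (mulrC 9) -mulrA ler_wpM2l //.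
have -> : 9 * d ^+ 2 = (3 * d) ^+ 2 by ring.
have d0 : 0 <= d by exact: le_trans wd.
rewrite ler_pXn2r ?nnegrE ?l1_ge0 ?mulr_ge0 // /l1 /=.
have : `|al * w| <= d by rewrite normrM (ger0_norm al0) (le_trans _ wd) // ler_piMl.
have := ler_normD (off al c z n - j%:~R) (al * w); lra.
Qed.

(** Near a stopping point the speed dominates a quantity whose inverse is, in [s], the derivative of
    an arctangent: the time spent there will be bounded through the heights. *)
Lemma near_lattice_lower (f : R * R -> R) al c z s k r : biperiodic f ->
  0 <= al <= 1 -> 0 < k -> (forall h, l1 h < r -> k * l1 h ^+ 2 <= f (c + h)) ->
  c.1 - z.1 < 1 -> - 1 < c.1 - z.1 -> r <= 2^-1 -> 0 <= s ->
  nrm (z.1 + s - c.1) + nrm (z.2 + al * s - c.2) < r ->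
  exists n, n%:R < s + 3 /\ (s - col c z n) ^+ 2 + nrm (off al c z n) ^+ 2 <=
    2 / k * f (z + s *: ((1, al) : R * R)).
Proof.
move=> pf /andP[al0 al1] k0 hk cz1 cz2 r2 s0.
rewrite {1 2}/nrm; set i := Num.floor _; set j := Num.floor _ => hr.
have n1 := normr_ge0 (z.1 + s - c.1 - i%:~R).
have n2 := normr_ge0 (z.2 + al * s - c.2 - j%:~R).
have h1 : `|z.1 + s - c.1 - i%:~R| < 2^-1 by lra.
(* The abscissas of [c] and [z] differ by less than 1 and [0 <= s], so that [i] is at least [- 1];
   the offset [- 1] in [col] makes [i + 1] the index of the column. *)
have iN1 : 0 <= i + 1.
  rewrite -(ler0z R) intrD; move: h1; rewrite ltr_norml => /andP[_ h1].
  have : (-1 - 1)%:~R < i%:~R :> R by rewrite intrB; lra.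
  by rewrite ltr_int => h; rewrite -intrD ler0z; lia.
have [n nE] : exists n : nat, i + 1 = n%:Z by exists (absz (i + 1)); rewrite gez0_abs.
have iE : i%:~R = n%:R - 1 :> R by rewrite -[n%:R]/(n%:~R) -nE intrD addrK.
have sE : z.1 + s - c.1 - i%:~R = s - col c z n by rewrite iE /col; ring.
exists n; split.
  by move: h1; rewrite ltr_norml sE /col => /andP[h1 _]; lra.
pose w := s - col c z n.
have -> : s = col c z n + w by rewrite /w addrC subrK.
rewrite (addrC (col _ _ _)) addrK (addrC w) (biperiodic_at_col _ _ _ _ _ j) //.
set h := (w, _).
have hE : l1 h = `|z.1 + s - c.1 - i%:~R| + `|z.2 + al * s - c.2 - j%:~R|.
  by rewrite /l1 /h /= sE -/w; congr (_ + `|_|); rewrite /w /off; ring.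
have lw : `|w| <= l1 h by rewrite hE sE lerDl.
have lo : nrm (off al c z n) <= l1 h.
  apply: (le_trans (nrm_le _ j)).
  have -> : off al c z n - j%:~R = (z.2 + al * s - c.2 - j%:~R) - al * w.
    by rewrite /off /w; ring.
  apply: (le_trans (ler_normB _ _)); rewrite hE sE -/w addrC lerD2r.
  by rewrite normrM (ger0_norm al0) ler_piMl.
have fk : k * l1 h ^+ 2 <= f (c + h) by apply: hk; rewrite hE.
apply: (@le_trans _ _ (2 / k * (k * l1 h ^+ 2))); last first.
  by rewrite ler_wpM2l // divr_ge0 // ltW.
rewrite mulrA mulfVK ?gt_eqF // mulr2n mulrDl mul1r lerD //.
  by rewrite -(real_normK (num_real w)) ler_pXn2r ?nnegrE ?l1_ge0.
by rewrite ler_pXn2r ?nnegrE ?l1_ge0 ?nrm_ge0.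
Qed.

End columns.

(** * Lower bounds on passage times *)

Section passage_times.
Variables (R : realType) (al : R) (phi : torus R -> R) (Phi : R -> torus R -> torus R).
Let f := phi \o @to_torus R.
Hypothesis (al01 : 0 <= al <= 1) (phi_ge0 : forall x, 0 <= phi x).
Hypothesis (flow : flow_generated (fun x => phi x *: (1, al)) Phi).
Let disp := disp flow.
Let pf : biperiodic f := to_torus_biperiodic phi.
Implicit Types (z c : R * R) (t T d C K : R) (n m : nat).

Lemma disp_ivt z t T v : t <= T -> disp z t <= v <= disp z T ->
  exists2 u, t <= u <= T & disp z u = v.
Proof.
move=> tT /andP[v0 vT].
have [|u] := @IVT R (disp z) t T v tT (continuous_subspaceT (@disp_continuous _ _ _ _ flow z)).
  by rewrite ge_min le_max v0 vT orbT.
by rewrite in_itv /= => tuT uv; exists u.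
Qed.

Lemma disp_lt_homo z t T : disp z t < disp z T -> t <= T.
Proof.
move=> h; rewrite leNgt; apply/negP => /ltW/(disp_homo flow phi_ge0 z).
by rewrite leNgt h.
Qed.

(** A stretch of length [2 * d] is covered at speed at most [9 * C * d^2]. Any [d] above the height
    is allowed, which is why truncated heights enter the sums over columns. *)
Lemma crossing_time z c n d C t T : 0 < C -> (forall h, f (c + h) <= C * l1 h ^+ 2) ->
  0 < d -> nrm (off al c z n) <= d ->
  disp z t <= col c z n - d -> col c z n + d <= disp z T ->
  2 / (9 * C) * d^-1 <= T - t.
Proof.
move=> C0 hC d0 nd ht hT.
have tT : t <= T by apply: (@disp_lt_homo z); lra.
have [|a /andP[ta aT] ha] := @disp_ivt z t T (col c z n - d) tT; first by lra.
have [|b /andP[ab bT] hb] := @disp_ivt z a T (col c z n + d) aT; first by lra.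
have := @derive_le R _ _ a b (9 * C * d ^+ 2) ab (is_derive_disp flow z) _.
rewrite -/disp hb ha => H.
have {}H : 2 * d <= 9 * C * d ^+ 2 * (b - a).
  apply: le_trans (H _); first by lra.
  move=> x /andP[ax xb].
  have h1 := disp_homo flow phi_ge0 z ax; have h2 := disp_homo flow phi_ge0 z xb.
  rewrite -/disp in h1 h2 *.
  rewrite -{1}(subrK (col c z n) (disp z x)) (addrC _ (col c z n)).
  apply: (near_col_upper pf al01 (ltW C0) hC) => //.
  by rewrite ler_norml; apply/andP; split; lra.
apply: (@le_trans _ _ (b - a)); last by lra.
rewrite -(ler_pM2l (_ : 0 < 9 * C * d ^+ 2)); last by rewrite !mulr_gt0 ?exprn_gt0.
apply: le_trans H; rewrite le_eqVlt; apply/orP; left; apply/eqP.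
by field; rewrite !gt_eqF.
Qed.

(** Column [n] lies between [n - 2] and [n], and the crossing extends at most half a unit on each
    side: for [3 <= n] it begins after displacement 0 and ends before [n + 1]. *)
Lemma nth_passage_time z c n C T : 0 < C -> (forall h, f (c + h) <= C * l1 h ^+ 2) ->
  - 1 < c.1 - z.1 < 1 -> (3 <= n)%N -> 0 < nrm (off al c z n) -> n.+1%:R <= disp z T ->
  2 / (9 * C) * (nrm (off al c z n))^-1 <= T.
Proof.
move=> C0 hC cz n3 o0 hT.
have h := nrm_half (off al c z n).
have n3R : 3%:R <= n%:R :> R by rewrite ler_nat.
have [h1 h2] : n%:R - 2 <= col c z n /\ col c z n <= n%:R by rewrite /col; split; lra.
rewrite -natr1 in hT; rewrite -[leRHS]subr0; apply: (crossing_time C0 hC o0 (lexx _)); last by lra.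
by rewrite /disp disp0; lra.
Qed.

(* Passages past successive columns take place during disjoint periods. *)
Lemma passages_time z c e C m T : 0 < C -> (forall h, f (c + h) <= C * l1 h ^+ 2) ->
  - 1 < c.1 - z.1 < 1 -> 0 < e <= 2^-1 ->
  0 <= T -> col c z (2 + m)%N + 2^-1 <= disp z T ->
  2 / (9 * C) * \sum_(n < m) (Num.max (nrm (off al c z (3 + n)%N)) e)^-1 <= T.
Proof.
move=> C0 hC cz /andP[e0 e2]; elim: m T => [|m IH] T T0 hT.
  by rewrite big_ord0 mulr0.
set d := Num.max (nrm (off al c z (3 + m)%N)) e.
have d0 : 0 < d by rewrite lt_max e0 orbT.
have d2 : d <= 2^-1 by rewrite ge_max nrm_half e2.
rewrite addnS colS in hT.
have colge0 : 0 <= col c z (2 + m)%N + 2^-1.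
  by rewrite /col natrD; have := ler0n R m; lra.
have [|t /andP[t0 tT] ht] := @disp_ivt z 0 T (col c z (2 + m)%N + 2^-1) T0.
  by rewrite /disp disp0 -/disp colge0; lra.
have h1 := IH t t0; rewrite ht in h1; have {}h1 := h1 (lexx _).
have c3 : col c z (3 + m)%N = col c z (2 + m)%N + 1 by rewrite -colS.
have h2 : 2 / (9 * C) * d^-1 <= T - t.
  apply: (@crossing_time z c (3 + m)%N d) => //.
  - by rewrite le_max lexx.
  - by rewrite ht c3; lra.
  - by rewrite c3; lra.
rewrite big_ord_recr /= -/d mulrDr; lra.
Qed.

(** Every block of [Q] columns costs a time at least [Q / e], whatever the height at its beginning,
    so that the bound is uniform in [z]. The constant [Q + 3] accounts for an unfinished block and
    the initial columns. *)
Lemma disp_sublinear c C : irrational al -> 0 < C -> (forall h, f (c + h) <= C * l1 h ^+ 2) ->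
  forall e, 0 < e -> exists B, forall z T, - 1 < c.1 - z.1 < 1 -> 0 <= T ->
    disp z T <= e * T + B.
Proof.
move=> ia C0 hC e e0.
pose k := 2 / (9 * C); have k0 : 0 < k by rewrite divr_gt0 ?mulr_gt0.
have [Q [d [Q0 d0 HQ]]] := irrational_rotation_sum (k * e)^-1 ia.
(* Crossings of successive columns are disjoint for half-widths up to 1/2; lowering the truncation
   only increases the sum. *)
pose d' := Num.min d 2^-1.
have d'0 : 0 < d' <= 2^-1 by rewrite lt_min d0 /= ge_min lexx orbT andbT.
have HQ' y : (k * e)^-1 * Q%:R <= \sum_(n < Q) (Num.max (nrm (y + n%:R * al)) d')^-1.
  apply: (le_trans (HQ y)); apply: ler_sum => i _.
  have [d'p _] := andP d'0; have d'd : d' <= d by rewrite ge_min lexx.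
  rewrite lef_pV2 ?posrE ?lt_max ?d0 ?d'p ?orbT //.
  by rewrite ge_max !le_max lexx d'd orbT.
have blocks z b : k * ((k * e)^-1 * Q%:R * b%:R) <=
    k * \sum_(n < Q * b) (Num.max (nrm (off al c z (3 + n)%N)) d')^-1.
  rewrite ler_pM2l //; elim: b => [|b IH]; first by rewrite muln0 mulr0 big_ord0.
  rewrite mulnS addnC -!(big_mkord xpredT (fun n => (Num.max (nrm (off al c z (3 + n)%N)) d')^-1)).
  rewrite (@big_cat_nat _ _ _ (Q * b)) ?leq_addr //= -natr1 mulrDr mulr1 lerD //.
    by rewrite big_mkord.
  rewrite -{1}(add0n (Q * b)%N) big_addn addnC addnK big_mkord.
  apply: (le_trans (HQ' (off al c z (3 + Q * b)%N))); apply: ler_sum => i _.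
  by rewrite -off_add (addnC i) addnA.
exists (Q%:R + 3) => z T cz T0.
rewrite leNgt; apply/negP => hT.
have S0 : 0 <= (disp z T - 3) / Q%:R.
  by rewrite divr_ge0 // subr_ge0; have := mulr_ge0 (ltW e0) T0; have := ler0n R Q; lra.
have QR : 0 < Q%:R :> R by rewrite ltr0n.
pose b := Num.truncn ((disp z T - 3) / Q%:R).
have /andP[b1 b2] := truncn_itv S0; rewrite -/b in b1 b2.
rewrite ler_pdivlMr // in b1; rewrite ltr_pdivrMr // -[b.+1%:R]natr1 mulrDl mul1r in b2.
have := @passages_time z c d' C (Q * b)%N T C0 hC cz d'0 T0 _.
rewrite -/k => /(_ _)/(le_trans (blocks z b)) H.
have {}H : k * ((k * e)^-1 * Q%:R * b%:R) <= T.
  by apply: H; rewrite /col natrD natrM; lra.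
have E : k * ((k * e)^-1 * Q%:R * b%:R) = b%:R * Q%:R / e.
  by field; rewrite !gt_eqF.
rewrite E ler_pdivrMr // in H; lra.
Qed.

(** The speed has a positive minimum on the segment of length [S], which is therefore covered in
    finite time. *)
Lemma disp_reaches z S : (forall s, 0 <= s -> 0 < f (z + s *: (1, al))) ->
  continuous f -> 0 <= S -> exists2 T, 0 <= T & disp z T = S.
Proof.
move=> f0 cf S0.
have [T [T0 hT]] : exists T, 0 <= T /\ S <= disp z T; last first.
  have [|u /andP[u0 _] hu] := @disp_ivt z 0 T S T0; last by exists u.
  by rewrite /disp disp0 -/disp S0.
pose g s := f (z + s *: (1, al)).
have cg : {within `[0, S], continuous g}.
  apply: continuous_subspaceT.
  have cl : continuous (fun s : R => z + s *: ((1, al) : R * R)).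
    by move=> s; apply: cvgD; [exact: cvg_cst|apply: cvgZl; exact: cvg_id].
  move=> s; exact: (continuous_comp (cl s) (cf (z + s *: (1, al)))).
have [x xS hx] := EVT_min S0 cg.
have x0 : 0 < g x by apply: f0; move: xS; rewrite in_itv => /andP[].
exists (S / g x); split; first by rewrite divr_ge0 // ltW.
rewrite leNgt; apply/negP => h.
have T0 : 0 <= S / g x by rewrite divr_ge0 // ltW.
have := @derive_ge R _ _ 0 (S / g x) (g x) T0 (is_derive_disp flow z) _.
rewrite -/disp subr0 (mulrC (g x)) (divfK (lt0r_neq0 x0)) /disp disp0 subr0 -/disp => H.
have := h; apply/negP; rewrite -leNgt; apply: H => t /andP[t0 tT].
apply: hx; rewrite in_itv /= (disp_ge0 flow phi_ge0) //=.
by apply: ltW; apply: le_lt_trans h; exact: disp_homo.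
Qed.

End passage_times.

(** * Integrals of continuous functions *)

Section integrals_of_continuous_functions.
Variable R : realType.
Notation mu := (@lebesgue_measure R).
Implicit Types (h G dG : R -> R) (a b t c : R).

Lemma continuous_integrable h a b : continuous h -> mu.-integrable `[a, b] (EFin \o h).
Proof.
move=> ch; apply: continuous_compact_integrable; first exact: segment_compact.
exact: continuous_subspaceT.
Qed.

(** The bound is an increment of [G] and not an integral of its derivative: in the applications [G]
    combines time, displacement and arctangents. The mean value theorem is applied to [G] minus a
    primitive of [h]. *)
Lemma Rintegral_increment_ub h G dG t : continuous h -> 0 <= t ->
  (forall x, 0 <= x <= t -> is_derive x (1 : R) G (dG x)) ->
  (forall x, 0 <= x <= t -> h x <= dG x) ->
  \int[mu]_(x in `[0, t]) h x <= G t - G 0.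
Proof.
move=> ch; rewrite le_eqVlt => /predU1P[<- _ _|t0 hG hle].
  by rewrite set_itv1 Rintegral_set1 subrr.
(* starting at [-1] makes [0] an interior point, as [continuous_FTC1_closed] requires *)
pose P (u : R) : R := \int[mu]_(x in `[-1, u]) h x.
have dP (u : R) : 0 <= u -> is_derive u (1 : R) P (h u).
  move=> u0; have u1 : u < u + 1 by rewrite ltrDl.
  have [d e] := continuous_FTC1_closed u1 (continuous_integrable (-1) (u + 1) ch)
    (lt_le_trans (ltrN10 R) u0) (ch u).
  exact: (DeriveDef d (etrans (esym (derive1E _ _)) e)).
have dK (u : R) : 0 <= u <= t -> is_derive u (1 : R) (G - P) (dG u - h u).
  move=> u01; have /andP[u0 _] := u01.
  by have dPu := dP u u0; have dGu := hG u u01; exact: (is_deriveB dGu dPu).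
have [||c cab] := @MVT_segment R (G - P) (dG - h) 0 t (ltW t0) _.
- by move=> x; rewrite in_itv /= => /andP[x0 xt]; apply: dK; rewrite !ltW.
- apply: derivable_within_continuous => x; rewrite in_itv /= => x01.
  by have [] := dK x x01.
rewrite subr0 !fctE => E.
have Kt : 0 <= G t - P t - (G 0 - P 0).
  by rewrite E mulr_ge0 ?(ltW t0) // subr_ge0 hle // -in_itv.
suff <- : P t - P 0 = \int[mu]_(x in `[0, t]) h x by lra.
rewrite /P Rintegral_itvB ?bnd_simp ?(ltW t0) //; last exact: continuous_integrable.
rewrite Rintegral_itv_obnd_cbnd //.
apply: integrableS (continuous_integrable (0) (t) ch) => //.
exact: subset_itv_oc_cc.
Qed.

Lemma Rintegral_le_increment h G dG t : continuous h -> 0 <= t ->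
  (forall x, is_derive x (1 : R) G (dG x)) ->
  (forall x, 0 <= x <= t -> h x <= dG x) ->
  \int[mu]_(x in `[0, t]) h x <= G t - G 0.
Proof. by move=> ch t0 hG; apply: Rintegral_increment_ub => // x _; exact: hG. Qed.

Lemma Rintegral_lin h1 h2 c t : continuous h1 -> continuous h2 ->
  \int[mu]_(x in `[0, t]) (h1 x + c * h2 x) =
  \int[mu]_(x in `[0, t]) h1 x + c * \int[mu]_(x in `[0, t]) h2 x.
Proof.
move=> c1 c2; rewrite RintegralD //; last 2 first.
- exact: continuous_integrable.
- apply: (@continuous_integrable (fun x => c * h2 x)) => x.
  by apply: cvgM; [exact: cvg_cst|exact: c2].
by rewrite RintegralZl //; exact: continuous_integrable.
Qed.

Lemma Rintegral_increment h G t : continuous h -> 0 <= t ->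
  (forall x, 0 <= x <= t -> is_derive x (1 : R) G (h x)) ->
  \int[mu]_(x in `[0, t]) h x = G t - G 0.
Proof.
move=> ch t0 hG; apply/eqP; rewrite eq_le (Rintegral_increment_ub ch t0 hG) //=.
have cN : continuous (fun x => - h x) by move=> x; apply: cvgN; exact: ch.
have dN x : 0 <= x <= t -> is_derive x (1 : R) (- G) (- h x).
  by move=> x01; have hx := hG x x01; exact: is_deriveN.
have := Rintegral_increment_ub cN t0 dN (fun _ _ => lexx _).
have -> : \int[mu]_(x in `[0, t]) - h x = - \int[mu]_(x in `[0, t]) h x.
  have := @Rintegral_lin (fun=> 0) h (-1) t (fun=> cvg_cst _) ch.
  rewrite Rintegral_cst //= mul0r add0r mulN1r => <-.
  by under [in RHS]eq_Rintegral do rewrite add0r mulN1r.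
rewrite !fctE; lra.
Qed.

Lemma derive0_constant G a b : a <= b ->
  (forall x, a <= x <= b -> is_derive x (1 : R) G 0) -> G a = G b.
Proof.
move=> ab hG.
have [||c _] := @MVT_segment R G (fun=> 0) a b ab _.
- by move=> x; rewrite in_itv /= => /andP[ax xb]; apply: hG; rewrite !ltW.
- apply: derivable_within_continuous => x; rewrite in_itv /= => x01.
  by have [] := hG x x01.
by rewrite mul0r => /eqP; rewrite subr_eq0 => /eqP.
Qed.

Lemma Rintegral_one t : 0 <= t -> \int[mu]_(x in `[0, t]) 1 = t.
Proof.
move=> t0; rewrite Rintegral_cst //= lebesgue_measure_itv /= lte_fin.
have [t1|t1] := ltP 0 t; first by rewrite mul1r oppr0 addr0.
by rewrite mulr0; apply/eqP; rewrite eq_le t0.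
Qed.

Lemma Rintegral_continuous h t : continuous h -> 0 < t ->
  {for t, continuous (fun t => \int[mu]_(x in `[0, t]) h x)}.
Proof.
move=> ch t0; have t1 : t < t + 1 by rewrite ltrDl.
have [d _] := continuous_FTC1_closed t1 (continuous_integrable (0) (t + 1) ch) t0 (ch t).
exact/differentiable_continuous/derivable1_diffP.
Qed.

End integrals_of_continuous_functions.

Section periodic.
Variable R : realType.
Notation mu := (@lebesgue_measure R).
Variable h : R -> R.
Hypothesis (ch : continuous h) (h1 : forall y, h (y + 1) = h y).

Let P (u : R) : R := \int[mu]_(x in `[0, u]) h x.

Let is_derive_P (u : R) : 0 < u -> is_derive u (1 : R) P (h u).
Proof.
move=> u0; have u1 : u < u + 1 by rewrite ltrDl.
have [d e] := continuous_FTC1_closed u1 (continuous_integrable 0 (u + 1) ch) u0 (@ch u).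
exact: (DeriveDef d (etrans (esym (derive1E _ _)) e)).
Qed.

Let is_derive_affine (k c u : R) : 0 < k * u + c ->
  is_derive u (1 : R) (fun x => P (k * x + c)) (h (k * u + c) * k).
Proof.
move=> h0; have d1 := is_derive_P h0.
have d2 : is_derive u (1 : R) (fun x : R => k * x + c) k.
  apply: (is_derive_eq (is_deriveD (is_deriveZ k (is_derive_id u (1 : R))) (is_derive_cst c u 1))).
  by rewrite /GRing.scale /= mulr1 addr0.
exact: (@is_derive1_comp R P (fun x : R => k * x + c) u (h (k * u + c)) k d1 d2).
Qed.

Let P_step (y : R) : 0 < y -> P (y + 1) - P y = \int[mu]_(x in `[0, 1]) h x.
Proof.
move=> y0.
have d1 (x : R) : 0 < x -> is_derive x (1 : R) (fun x : R => P (x + 1)) (h x).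
  move=> x0; have := @is_derive_affine 1 1 x; rewrite !mul1r mulr1 h1.
  by under [X in is_derive _ _ X _]eq_fun do rewrite mul1r; apply; lra.
have -> : \int[mu]_(x in `[0, 1]) h x = P (1 + 1) - P 1.
  have d2 (x : R) : 0 <= x <= 1 -> is_derive x (1 : R) (fun x : R => P (x + 1)) (h x).
    move=> /andP[x0 _]; have := @is_derive_affine 1 1 x; rewrite !mul1r mulr1 h1.
    by under [X in is_derive _ _ X _]eq_fun do rewrite mul1r; apply; lra.
  by rewrite (Rintegral_increment ch ler01 d2) add0r.
have dW (x : R) : 0 < x -> is_derive x (1 : R) ((fun x : R => P (x + 1)) - P) 0.
  move=> x0; have dx := d1 x x0; have dx' := is_derive_P x0.
  by apply: (is_derive_eq (is_deriveB dx dx')); rewrite subrr.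
have [y1|y1] := leP y 1.
  by have := @derive0_constant _ _ y 1 y1 (fun x xy => dW x (lt_le_trans y0 (proj1 (andP xy)))).
have := @derive0_constant _ _ 1 y (ltW y1) (fun x xy => dW x (lt_le_trans ltr01 (proj1 (andP xy)))).
by move=> /esym.
Qed.

Let P_nat (n : nat) (y : R) : 0 < y -> P (y + n%:R) - P y = n%:R * \int[mu]_(x in `[0, 1]) h x.
Proof.
move=> y0; elim: n => [|n IH]; first by rewrite mul0r addr0 subrr.
have := @P_step (y + n%:R) (ltr_wpDr (ler0n _ n) y0).
move: IH; rewrite -natr1 addrA mulrDl mul1r; lra.
Qed.

Let h_nat (n : nat) (y : R) : h (y + n%:R) = h y.
Proof. by elim: n => [|n IH]; [rewrite addr0|rewrite -natr1 addrA h1]. Qed.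

(** Affine maps of nonzero integer slope preserve Lebesgue measure on the circle: [k * x + c] runs
    through [|k|] periods, over each of which a primitive of [h] gains the same amount. *)
Lemma Rintegral_periodic (k : int) (c : R) : k != 0 ->
  \int[mu]_(x in `[0, 1]) h (k%:~R * x + c) = \int[mu]_(x in `[0, 1]) h x.
Proof.
move=> k0; have kR : k%:~R != 0 :> R by rewrite intr_eq0.
(* a shift by [m] periods keeps the argument positive, where [P] is a primitive *)
pose m := (Num.truncn (`|k%:~R| + `|c| : R)).+1.
have mE : `|k%:~R| + `|c| < m%:R :> R by exact: truncnS_gt.
clearbody m.
pose c' := c + m%:R.
have pos (x : R) : 0 <= x <= 1 -> 0 < k%:~R * x + c'.
  move=> /andP[x0 x1]; rewrite /c'.
  have : - `|k%:~R * x| <= k%:~R * x by rewrite lerNl -normrN ler_norm.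
  have : `|k%:~R * x| <= `|k%:~R| :> R by rewrite normrM (ger0_norm x0) ler_piMr.
  have : - `|c| <= c by rewrite lerNl -normrN ler_norm.
  lra.
have chk : continuous (fun x : R => h (k%:~R * x + c')).
  move=> x; apply: continuous_comp; last exact: ch.
  by apply: cvgD; [apply: cvgM; [exact: cvg_cst|exact: cvg_id]|exact: cvg_cst].
have dG (x : R) : 0 <= x <= 1 ->
    is_derive x (1 : R) (k%:~R^-1 \*: (fun x => P (k%:~R * x + c'))) (h (k%:~R * x + c')).
  move=> x01; have d := is_derive_affine (pos x x01).
  by apply: (is_derive_eq (is_deriveZ k%:~R^-1 d)); rewrite /GRing.scale /= mulrC mulfK.
transitivity (\int[mu]_(x in `[0, 1]) h (k%:~R * x + c')).
  by apply: eq_Rintegral => x _; rewrite /c' addrA h_nat.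
rewrite (Rintegral_increment chk ler01 dG) /= /GRing.scale /= mulr1 mulr0 add0r.
rewrite -mulrBr; apply: (mulfI kR); rewrite mulrA divff // mul1r.
have c'0 : 0 < c' by have := pos 0; rewrite mulr0 add0r; apply; rewrite lexx ler01.
have kc0 : 0 < k%:~R + c' by have := pos 1; rewrite mulr1; apply; rewrite lexx ler01.
case: k k0 kR kc0 {mE pos chk dG} => n _ _ kc0; rewrite ?NegzE.
  by rewrite -!pmulrn (addrC _ c') P_nat.
rewrite NegzE in kc0; have := P_nat n.+1 kc0.
have -> : (- n.+1%:Z)%:~R + c' + n.+1%:R = c' by rewrite intrN addrAC addNr add0r.
by rewrite intrN mulNr => <-; ring.
Qed.

End periodic.

(** * Functions on the torus *)

Section circle_functions.
Variable R : realType.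
Implicit Types (a b : circle R) (r : R) (z w : R * R) (x y p q : torus R).

Lemma circle_rep_to_circle r : exists k : int, circle_rep (to_circle r) = r + k%:~R.
Proof.
have /to_circleP/intrP[k hk] : to_circle (circle_rep (to_circle r)) = to_circle r.
  by rewrite circle_repK.
by exists k; rewrite -hk addrC subrK.
Qed.

Lemma circle_rep_id r : 0 <= r < 1 -> circle_rep (to_circle r) = r.
Proof.
move=> r01; have [k hk] := circle_rep_to_circle r.
have := circle_rep_itv (to_circle r); rewrite hk => /andP[h1 h2].
have : -1 < (k%:~R : R) < 1 by lra.
rewrite -[1]/(1%:~R) -intrN !ltr_int => /andP[k1 k2].
have -> : k = 0 by lia.
by rewrite addr0.
Qed.

Lemma open_to_circle (U : set R) : open U -> open (@to_circle R @` U).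
Proof.
move=> oU; rewrite /open /= /quotient_open.
have -> : @to_circle R @^-1` (@to_circle R @` U) =
    \bigcup_(k in [set: int]) ((fun r => r + k%:~R) @^-1` U).
  apply/seteqP; split=> [r [u Uu]|r [k _ Uk]].
    move=> /(to_circleP u r).1/intrP[k hk]; exists k => //=.
    by rewrite -hk addrC subrK.
  by exists (r + k%:~R) => //; apply/(to_circleP _ r); rewrite addrC addKr intr_int.
apply: bigcup_open => k _; apply: open_comp => // r _.
by apply: cvgD; [exact: cvg_id|exact: cvg_cst].
Qed.

(** The representative jumps at the class of 0, but for [0 <= c] the set where it exceeds [c] is the
    image of an open interval, and such images are open. *)
Lemma measurable_circle_rep : measurable_fun [set: circle R] (@circle_rep R).
Proof.
apply: (measurability _ (measurable_realfun.RGenOInfty.measurableE R)) => // _ [_ [c ->] <-].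
rewrite setTI; have [c0|c0] := ltP c 0.
  rewrite (_ : _ @^-1` _ = setT) //; apply/seteqP; split=> // a _.
  rewrite /= in_itv /= andbT (lt_le_trans c0) //.
  by have /andP[] := circle_rep_itv a.
rewrite (_ : _ @^-1` _ = @to_circle R @` `]c, 1[).
  by apply: sub_sigma_algebra; apply: open_to_circle; exact: interval_open.
apply/seteqP; split=> [a|_ [r + <-]]; rewrite /= !in_itv /= ?andbT => h.
  have /andP[_ a1] := circle_rep_itv a.
  by exists (circle_rep a); [rewrite /= in_itv /= h|exact: circle_repK].
have /andP[h1 h2] := h; rewrite circle_rep_id // h2 andbT.
exact: le_trans (ltW h1).
Qed.

Definition circle_dist r a : R := nrm (circle_rep a - r).

Lemma circle_dist_to_circle r s : circle_dist r (to_circle s) = nrm (s - r).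
Proof.
by rewrite /circle_dist; have [k ->] := circle_rep_to_circle s; rewrite addrAC nrmDz.
Qed.

Lemma continuous_circle_dist r : continuous (circle_dist r).
Proof.
apply/quotient_continuous.
have -> : circle_dist r \o @to_circle R = (fun s => nrm (s - r)).
  by apply/funext => s; exact: circle_dist_to_circle.
move=> s; apply: (@continuous_comp _ _ _ (fun s => s - r) (@nrm R)).
  by apply: cvgB; [exact: cvg_id|exact: cvg_cst].
exact: nrm_continuous.
Qed.

Lemma circle_dist_eq0 a b : circle_dist (circle_rep b) a = 0 -> a = b.
Proof.
move=> /nrm_eq0 h; rewrite -(circle_repK a) -(circle_repK b).
by apply/to_circleP.
Qed.

Lemma circle_dist_self b : circle_dist (circle_rep b) b = 0.
Proof. by rewrite /circle_dist subrr; apply/nrm_eq0; rewrite rpred0. Qed.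

Definition tdist p x : R :=
  circle_dist (torus_rep p).1 x.1 + circle_dist (torus_rep p).2 x.2.

Lemma tdist_to_torus p z : tdist p (to_torus z) =
  nrm (z.1 - (torus_rep p).1) + nrm (z.2 - (torus_rep p).2).
Proof. by rewrite /tdist /to_torus /= !circle_dist_to_circle. Qed.

Lemma tdist_ge0 p x : 0 <= tdist p x.
Proof. by rewrite addr_ge0 ?nrm_ge0. Qed.

Lemma tdist_self p : tdist p p = 0.
Proof. by rewrite /tdist /= !circle_dist_self addr0. Qed.

Lemma tdist_eq0 p x : tdist p x = 0 -> x = p.
Proof.
move=> /eqP; rewrite paddr_eq0 ?nrm_ge0 // => /andP[/eqP h1 /eqP h2].
by case: x p h1 h2 => x1 x2 [p1 p2] /= /circle_dist_eq0 -> /circle_dist_eq0 ->.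
Qed.

Lemma continuous_tdist p : continuous (tdist p).
Proof.
move=> x; apply: cvgD.
  apply: (@continuous_comp _ _ _ fst (circle_dist (torus_rep p).1)).
    by case: x => x1 x2; exact: cvg_fst.
  exact: continuous_circle_dist.
apply: (@continuous_comp _ _ _ snd (circle_dist (torus_rep p).2)).
  by case: x => x1 x2; exact: cvg_snd.
exact: continuous_circle_dist.
Qed.

(** Urysohn function equal to 1 at [p] and 0 at [q]: its integral against a measure carried by the
    two points is the weight of [p]. With this formula, exchanging [p] and [q] replaces it by
    [1 - chi p q]. *)
Definition chi p q x : R := tdist q x / (tdist p x + tdist q x).

Section chi.
Variables (p q : torus R).
Hypothesis pq : p <> q.

Lemma chi_den x : 0 < tdist p x + tdist q x.
Proof.
rewrite lt0r addr_ge0 ?tdist_ge0 // andbT paddr_eq0 ?tdist_ge0 //.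
by apply/negP => /andP[/eqP/tdist_eq0 h /eqP/tdist_eq0 h']; apply: pq; rewrite -h -h'.
Qed.

Lemma chi_ge0 x : 0 <= chi p q x.
Proof. by rewrite divr_ge0 ?tdist_ge0 // ltW // chi_den. Qed.

Lemma chi_le1 x : chi p q x <= 1.
Proof. by rewrite ler_pdivrMr ?chi_den // mul1r lerDr tdist_ge0. Qed.

Lemma chi1 : chi p q p = 1.
Proof. by rewrite /chi tdist_self add0r divff // gt_eqF //; have := chi_den p; rewrite tdist_self add0r. Qed.

Lemma chi0 : chi p q q = 0.
Proof. by rewrite /chi tdist_self mul0r. Qed.

Lemma continuous_chi : continuous (chi p q).
Proof.
move=> x; have cp := @continuous_tdist p x; have cq := @continuous_tdist q x.
apply: (cvgM cq); apply: (cvgV _ (cvgD cp cq)).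
by rewrite gt_eqF // chi_den.
Qed.

Lemma chiC x : chi q p x = 1 - chi p q x.
Proof.
have d := chi_den x; rewrite /chi (addrC (tdist q x)).
by field; rewrite gt_eqF.
Qed.

End chi.

Lemma continuous_to_torus : continuous (@to_torus R).
Proof.
case=> z1 z2.
have c1 : (@fst R R) @ (z1, z2) --> z1 by exact: cvg_fst.
have c2 : (@snd R R) @ (z1, z2) --> z2 by exact: cvg_snd.
have p1 : (@to_circle R : R -> circle R) @ z1 --> (to_circle z1 : circle R).
  exact: (@pi_continuous _ _ z1).
have p2 : (@to_circle R : R -> circle R) @ z2 --> (to_circle z2 : circle R).
  exact: (@pi_continuous _ _ z2).
have d1 := @cvg_comp _ _ _ _ _ _ _ _ c1 p1; have d2 := @cvg_comp _ _ _ _ _ _ _ _ c2 p2.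
exact: (@cvg_pair _ _ _ _ _ _ _ _ _ _ _ d1 d2).
Qed.

End circle_functions.

(** * Continuous functions and the product sigma-algebra *)

Section measurability_on_the_torus.
Variable R : realType.

Lemma open_measurable_pair (U : set (R * R)) : open U -> measurable (U : set (measurableTypeR R * measurableTypeR R)).
Proof.
move=> oU.
pose box (b : rat * rat * rat) : set (R * R) :=
  `](ratr b.1.1 - ratr b.2), (ratr b.1.1 + ratr b.2)[ `*`
  `](ratr b.1.2 - ratr b.2), (ratr b.1.2 + ratr b.2)[.
have -> : U = \bigcup_(b in [set b | box b `<=` U]) box b.
  apply/seteqP; split=> [z Uz|z [b bU]]; last exact: bU.
  have /nbhs_ballP[e /= e0 eU] : nbhs z U by apply: open_nbhs_nbhs.
  have [r r1] : exists r : rat, 0 < (ratr r : R) < e / 2.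
    have /rat_in_itvoo[r] : 0 < e / 2 by rewrite divr_gt0.
    by rewrite in_itv /= => h; exists r.
  have approx (x : R) : exists s : rat, `|x - ratr s| < ratr r.
    have /rat_in_itvoo[s] : x - ratr r < x + ratr r by lra.
    rewrite in_itv /= => h; exists s; rewrite ltr_norml; lra.
  have [s1 h1] := approx z.1; have [s2 h2] := approx z.2.
  exists (s1, s2, r).
    move=> w [] /=; rewrite !in_itv /= => w1 w2; apply: eU; split.
      by move: h1; rewrite /ball /= !ltr_norml; lra.
    by move: h2; rewrite /ball /= !ltr_norml; lra.
  by split; rewrite /= in_itv /=; [move: h1|move: h2]; rewrite ltr_norml; lra.
rewrite bigcup_mkcond; apply: countable_bigcupT_measurable; first exact: countableP.
by move=> b; case: ifP => // _; apply: measurableX; exact: measurable_itv.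
Qed.

Lemma continuous_measurable_pair (h : R * R -> R) : continuous h ->
  measurable_fun [set: measurableTypeR R * measurableTypeR R] h.
Proof.
move=> /continuousP ch; apply: (measurability _ (measurable_realfun.RGenOpens.measurableE R)).
move=> _ [_ [a [b ->]] <-].
rewrite setTI; apply: open_measurable_pair; apply: ch; exact: interval_open.
Qed.

Lemma measurable_torus_rep :
  measurable_fun [set: torus R] (@torus_rep R : torus R -> measurableTypeR R * measurableTypeR R).
Proof.
apply: measurable_fun_pair.
  exact: (measurableT_comp (@measurable_circle_rep R) measurable_fst).
exact: (measurableT_comp (@measurable_circle_rep R) measurable_snd).
Qed.

(** The sigma-algebra of the torus is the product one, on which continuity has no direct hold; [g]
    is factored through the plane, where open sets are countable unions of rational boxes. *)
Lemma continuous_measurable_torus (g : torus R -> R) : continuous g ->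
  measurable_fun [set: torus R] g.
Proof.
move=> cg; have -> : g = (g \o @to_torus R) \o @torus_rep R.
  by apply/funext => x /=; rewrite torus_repK.
apply: (@measurableT_comp _ _ _ _ (measurableTypeR R * measurableTypeR R)%type).
  apply: continuous_measurable_pair => z.
  apply: continuous_comp; [exact: continuous_to_torus|exact: cg].
exact: measurable_torus_rep.
Qed.

End measurability_on_the_torus.

(** * Invariant measures and accumulation points *)

Lemma Ck_pred (R : realType) k (f : R * R -> R) : Ck k.+1 f -> Ck k f.
Proof.
elim: k f => [|k IH] f [df cf]; first by move=> z; exact: differentiable_continuous.
by split=> // v; apply: IH; exact: cf.
Qed.

Section stopped_flow.
Variables (R : realType) (a : circle R) (p q : torus R).
Variables (phi : torus R -> R) (Phi : R -> torus R -> torus R).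
Notation mu := (@lebesgue_measure R).
Let al := circle_rep a.
Let f := phi \o @to_torus R.
Hypothesis (pq : p <> q) (hphi : reparam p q phi) (irr : irrational al).
Hypothesis (flow : flow_generated (fun x => phi x *: (1, al)) Phi).
Let d x := disp flow (torus_rep x).
Implicit Types (x y : torus R) (t T e : R) (g : torus R -> R) (n N : nat).

Let al01 : 0 <= al <= 1.
Proof. by have /andP[h1 h2] := circle_rep_itv a; rewrite h1 ltW. Qed.

Let phi_ge0 := reparam_ge0 hphi.

Let C2 : Ck 2 f. Proof. exact/Ck_pred/(reparam_C3 hphi). Qed.
Let C1 : Ck 1 f. Proof. exact/Ck_pred/C2. Qed.
Let cf : continuous f. Proof. exact: (Ck_pred C1). Qed.
Let pf : biperiodic f := to_torus_biperiodic phi.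

Let rep_dist c x : - 1 < (torus_rep c).1 - (torus_rep x).1 < 1.
Proof.
have /andP[h1 h2] := circle_rep_itv c.1; have /andP[h3 h4] := circle_rep_itv x.1.
rewrite /torus_rep /=; lra.
Qed.

Let f_rep x : f (torus_rep x) = phi x.
Proof. by rewrite /f /= torus_repK. Qed.

Let fp : f (torus_rep p) = 0.
Proof. by rewrite f_rep; apply/(reparam_zero hphi); left. Qed.

Let f_ge0 z : 0 <= f z. Proof. exact: phi_ge0. Qed.

Lemma flow_disp x t : Phi t x = to_torus (torus_rep x + d x t *: (1, al)).
Proof. by rewrite /d to_torus_disp torus_repK. Qed.

Lemma torus_disp_sublinear e : 0 < e ->
  exists B, 0 <= B /\ forall x T, 0 <= T -> d x T <= e * T + B.
Proof.
move=> e0; have [C [C0 hC]] := zero_upper_bound pf f_ge0 fp C2.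
have C10 : 0 < C + 1 by lra.
have hC1 h : f (torus_rep p + h) <= (C + 1) * l1 h ^+ 2.
  by apply: (le_trans (hC h)); rewrite ler_wpM2r ?sqr_ge0 // lerDl.
have [B HB] := disp_sublinear al01 phi_ge0 flow irr C10 hC1 e0.
exists `|B|; split=> // x T T0; apply: (le_trans (HB (torus_rep x) T (rep_dist p x) T0)).
by rewrite lerD2l ler_norm.
Qed.

Lemma torus_dominated g e : continuous g -> g p = 0 -> g q = 0 -> 0 < e ->
  exists C, 0 <= C /\ forall x, `|g x| <= e + C * phi x.
Proof.
move=> cg gp gq e0.
have [] := @biperiodic_dominated R (g \o @to_torus R) f e _ _ pf cf f_ge0 _ e0.
- exact: to_torus_biperiodic.
- by move=> z; apply: continuous_comp; [exact: continuous_to_torus|exact: cg].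
- by move=> z /(reparam_zero hphi)[] /= ->.
by move=> C [C0 hC]; exists C; split=> // x; have := hC (torus_rep x); rewrite /= f_rep torus_repK.
Qed.

Lemma continuous_orbit g x : continuous g -> continuous (fun t => g (Phi t x)).
Proof.
move=> cg t; have -> : (fun t => g (Phi t x)) = fun t => g (to_torus (torus_rep x + d x t *: (1, al))).
  by apply/funext => u; rewrite flow_disp.
have c1 : {for t, continuous (fun t => torus_rep x + d x t *: ((1, al) : R * R))}.
  apply: cvgD; first exact: cvg_cst.
  by apply: cvgZl; exact: disp_continuous.
have c2 := @continuous_to_torus R (torus_rep x + d x t *: (1, al)).
exact: (continuous_comp (continuous_comp c1 c2) (cg _)).
Qed.

Lemma is_derive_d x t : is_derive t (1 : R) (d x) (phi (Phi t x)).
Proof. by apply: (is_derive_eq (is_derive_disp flow _ t)); rewrite flow_disp. Qed.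

(** By domination [|g|] is at most [e / 2] plus a multiple of the speed, and the speed integrates to
    the displacement, sublinear uniformly in [x]. *)
Lemma average_small g e : continuous g -> g p = 0 -> g q = 0 -> 0 < e ->
  exists B, 0 <= B /\ forall x t, 0 <= t ->
    `|\int[mu]_(u in `[0, t]) g (Phi u x)| <= e * t + B.
Proof.
move=> cg gp gq e0; have e20 : 0 < e / 2 by rewrite divr_gt0.
have [C [C0 hC]] := torus_dominated cg gp gq e20.
have e'0 : 0 < e / 2 / (C + 1) by rewrite !divr_gt0 //; lra.
have [B [B0 hB]] := torus_disp_sublinear e'0.
exists (C * B); split=> [|x t t0]; first exact: mulr_ge0.
have H g' : continuous g' -> (forall x, g' x <= e / 2 + C * phi x) ->
    \int[mu]_(u in `[0, t]) g' (Phi u x) <= e * t + C * B.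
  move=> cg' hg'.
  have hG s : is_derive s (1 : R) (fun s => e / 2 * s + C * d x s) (e / 2 + C * phi (Phi s x)).
    apply: (is_derive_eq (is_deriveD (is_deriveZ (e / 2) (is_derive_id s (1 : R)))
      (is_deriveZ C (is_derive_d x s)))).
    by rewrite /GRing.scale /= mulr1.
  have := Rintegral_le_increment (continuous_orbit (x := x) cg') t0 hG _.
  have d0 : d x 0 = 0 by exact: disp0.
  rewrite d0 !mulr0 addr0 subr0 => /(_ (fun u _ => hg' _)) h; apply: (le_trans h).
  have h2 : C * d x t <= C * (e / 2 / (C + 1) * t + B) by rewrite ler_wpM2l // hB.
  have h3 : C * (e / 2 / (C + 1) * t) <= e / 2 * t.
    rewrite mulrA ler_wpM2r // mulrCA ler_piMr ?(ltW e20) // ler_pdivrMr; lra.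
  lra.
rewrite ler_norml; apply/andP; split; last first.
  by apply: H => // y; exact: le_trans (ler_norm _) (hC y).
have c1 := continuous_orbit (x := x) cg.
have E : \int[mu]_(u in `[0, t]) (- g (Phi u x)) = - \int[mu]_(u in `[0, t]) g (Phi u x).
  have := @Rintegral_lin R (fun=> 0) (fun u => g (Phi u x)) (-1) t _ c1.
  under eq_Rintegral do rewrite add0r mulN1r.
  by move=> ->; [rewrite Rintegral_cst //= mul0r add0r mulN1r|exact: cst_continuous].
rewrite lerNl -E; apply: (H (fun y => - g y)).
  by move=> y; apply: cvgN; exact: cg.
by move=> y; rewrite (le_trans (ler_norm _)) // normrN hC.
Qed.

Let chi' := chi p q.

(** Subtracting from [g] the affine function of [chi] with the same values at [p] and [q] leaves a
    function to which [average_small] applies: the averages of [chi] determine all others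
    asymptotically. *)
Lemma average_decomposition g e : continuous g -> 0 < e ->
  exists B, 0 <= B /\ forall x t, 0 <= t ->
    `|\int[mu]_(u in `[0, t]) g (Phi u x) -
      (g q * t + (g p - g q) * \int[mu]_(u in `[0, t]) chi' (Phi u x))| <= e * t + B.
Proof.
move=> cg e0; have cchi : continuous chi' by exact: continuous_chi.
pose g' x := g x + (- 1) * (g q + (g p - g q) * chi' x).
have cg' : continuous g'.
  move=> y; apply: (@cvgD _ _ _ _ _ g); first exact: cg.
  apply: (@cvgM _ _ _ _ (fun=> -1)); first exact: cvg_cst.
  apply: (@cvgD _ _ _ _ _ (fun=> g q)); first exact: cvg_cst.
  by apply: (@cvgM _ _ _ _ (fun=> g p - g q)); [exact: cvg_cst|exact: cchi].
have [||B [B0 hB]] := average_small cg' _ _ e0.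
- by rewrite /g' /chi' chi1 //; ring.
- by rewrite /g' /chi' chi0 //; ring.
exists B; split=> // x t t0; have := hB x t t0.
have c1 := continuous_orbit (x := x) cg.
have c2 := continuous_orbit (x := x) cchi.
have c3 : continuous (fun u => g q + (g p - g q) * chi' (Phi u x)).
  move=> u; apply: (@cvgD _ _ _ _ _ (fun=> g q)); first exact: cvg_cst.
  by apply: (@cvgM _ _ _ _ (fun=> g p - g q)); [exact: cvg_cst|exact: c2].
rewrite /g' (Rintegral_lin _ _ c1 c3) (Rintegral_lin _ _ (fun=> cvg_cst _) c2).
have -> : \int[mu]_(u in `[0, t]) g q = g q * t.
  rewrite -[X in g q * X](Rintegral_one t0) -[RHS]add0r.
  have := @Rintegral_lin R (fun=> 0) (fun=> 1) (g q) t (fun=> cvg_cst _) (fun=> cvg_cst _).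
  under eq_Rintegral do rewrite add0r mulr1.
  by move=> ->; rewrite Rintegral_cst //= mul0r.
by rewrite mulN1r.
Qed.

End stopped_flow.

Section nonnegative_integral.
Context d (T : measurableType d) (R : realType) (P : probability T R).

Lemma ge0_integral_eq0_null (s : T -> R) (N : set T) : measurable_fun setT s ->
  (forall x, 0 <= s x) -> (\int[P]_x (s x)%:E = 0)%E -> measurable N ->
  (forall x, N x -> s x != 0) -> P N = 0%E.
Proof.
move=> ms s0 is0 mN Ns.
have mE : measurable_fun setT (EFin \o s) by exact/measurable_EFinP.
have /(ae_eq_integral_abs _ measurableT mE) h : (\int[P]_x `|(s x)%:E| = 0)%E.
  by rewrite -is0; apply: eq_integral => x _ /=; rewrite ger0_norm.
apply: (measure_negligible mN); apply: negligibleS h => x Nx /= h.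
by have := Ns x Nx; have := h I => -[->]; rewrite eqxx.
Qed.

Lemma bounded_integrable (s : T -> R) (M : R) : measurable_fun setT s ->
  (forall x, `|s x| <= M) -> P.-integrable setT (EFin \o s).
Proof.
move=> ms sM; apply: measurable_bounded_integrable => //.
  exact: fin_num_fun_lty.
exists M; split; first exact: num_real.
by move=> N MN x _ /=; rewrite (le_trans (sM x)) // ltW.
Qed.

End nonnegative_integral.

Lemma Rintegral_cstT (R : realType) (P : probability (torus R) R) (c : R) :
  \int[P]_x c = c.
Proof.
rewrite Rintegral_cst //= [X in fine X](_ : _ = 1%E) ?mulr1 //.
exact: probability_setT.
Qed.

Lemma cluster_ptws (R : realType) (I : eqType) (i : I)
    (F : set_system {ptws I -> R}) (L : {ptws I -> R}) :
  cluster F L -> forall A e, F A -> 0 < e -> exists h, A h /\ `|L i - h i| < e.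
Proof.
move=> clu A e FA e0.
have [h [Ah hh]] := clu _ _ FA (@proj_continuous I (fun=> R) i L _ (nbhsx_ballx (L i) e e0)).
by exists h.
Qed.

Lemma accumulation_close (R : realType) (Phi : R -> torus R -> torus R) x P
    (F : continuousType (torus R) R) e T : accumulation_points Phi x P -> 0 < e ->
  exists2 t, T <= t & `|\int[P]_y F y - empirical Phi x t F| < e.
Proof.
move=> clu e0.
have H := @cluster_ptws R (continuousType (torus R) R) F (empirical Phi x @ +oo) _ clu.
have nA : (empirical Phi x @ +oo) (empirical Phi x @` [set t | T <= t]).
  exists T; split; first exact: num_real.
  by move=> t Tt; exists t => //=; exact: ltW.
by have [_ [[t /= Tt <-] ht]] := H _ _ nA e0; exists t.
Qed.

Section invariant_measures.
Variables (R : realType) (a : circle R) (p q : torus R).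
Variables (phi : torus R -> R) (Phi : R -> torus R -> torus R).
Notation mu := (@lebesgue_measure R).
Let al := circle_rep a.
Let f := phi \o @to_torus R.
Hypothesis (pq : p <> q) (hphi : reparam p q phi) (irr : irrational al).
Hypothesis (flow : flow_generated (fun x => phi x *: (1, al)) Phi).
Let d x := disp flow (torus_rep x).
Implicit Types (x y : torus R) (t T e : R) (g : torus R -> R) (n N : nat).
Implicit Types (P : probability (torus R) R).

Let phi_ge0 := reparam_ge0 hphi.
Let C1 : Ck 1 f. Proof. exact/Ck_pred/Ck_pred/(reparam_C3 hphi). Qed.

Let phip : phi p = 0. Proof. by apply/(reparam_zero hphi); left. Qed.
Let phiq : phi q = 0. Proof. by apply/(reparam_zero hphi); right. Qed.

Definition kappa x : R := tdist p x * tdist q x.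

Lemma kappa_ge0 x : 0 <= kappa x.
Proof. by rewrite mulr_ge0 ?tdist_ge0. Qed.

Lemma kappa_eq0 x : kappa x = 0 -> x = p \/ x = q.
Proof.
by move=> /eqP; rewrite mulf_eq0 => /orP[]/eqP/tdist_eq0; [left|right].
Qed.

Lemma continuous_kappa : continuous kappa.
Proof. by move=> x; exact: (cvgM (@continuous_tdist _ p x) (@continuous_tdist _ q x)). Qed.

Lemma kappap : kappa p = 0. Proof. by rewrite /kappa tdist_self mul0r. Qed.
Lemma kappaq : kappa q = 0. Proof. by rewrite /kappa tdist_self mulr0. Qed.

Lemma measurable_stops : measurable ([set p; q] : set (torus R)).
Proof.
have -> : [set p; q] = kappa @^-1` [set 0].
  apply/seteqP; split=> x; first by case=> ->; [exact: kappap|exact: kappaq].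
  by move/kappa_eq0.
rewrite -[_ @^-1` _]setTI; apply: (continuous_measurable_torus continuous_kappa) => //.
Qed.

Lemma measurable_disp t : measurable_fun setT (fun x => d x t).
Proof.
apply: (@measurableT_comp _ _ _ _ (measurableTypeR R * measurableTypeR R)%type _ (fun z => disp flow z t)).
  apply: continuous_measurable_pair => z.
  exact: (@disp_continuous_l _ _ _ _ C1 flow t z).
exact: measurable_torus_rep.
Qed.

Lemma measurable_flow t : measurable_fun setT (Phi t).
Proof.
have -> : Phi t = fun x => (to_circle ((torus_rep x).1 + d x t), to_circle ((torus_rep x).2 + d x t * al)).
  by apply/funext => x; rewrite (flow_disp flow) /to_torus /= /GRing.scale /= mulr1.
have m1 : measurable_fun setT (fun x => (torus_rep x).1 : measurableTypeR R).
  exact: (measurableT_comp (@measurable_circle_rep R) measurable_fst).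
have m2 : measurable_fun setT (fun x => (torus_rep x).2 : measurableTypeR R).
  exact: (measurableT_comp (@measurable_circle_rep R) measurable_snd).
have md := measurable_disp t.
apply: measurable_fun_pair; apply: (measurableT_comp (@measurable_to_circle R)).
  exact: measurable_funD.
by apply: measurable_funD => //; exact: measurable_funM.
Qed.

Definition supported P := P (~` [set p; q]) = 0%E.

(** Invariance and the cocycle relation make the integrated displacement additive, [I n = n * I 1],
    whereas it grows sublinearly. Hence [I 1 = 0], and almost every point has displacement 0 at time
    1. *)
Lemma invariant_supported P : invariant_probabilities Phi P -> supported P.
Proof.
move=> inv.
have md t := measurable_disp t.
have mE t : measurable_fun setT (fun x => (d x t)%:E) by exact/measurable_EFinP.
have d0 x t : 0 <= t -> 0 <= d x t by exact: disp_ge0.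
have d00 x : d x 0 = 0 by exact: disp0.
pose I t := (\int[P]_x (d x t)%:E)%E.
have flow_inv n : (\int[P]_x (d (Phi n%:R%R x) 1%R)%:E = I 1%R)%E.
  have d10 : {in setT, forall x, (0 <= (d x 1%R)%:E)%E} by move=> x _; rewrite lee_fin d0.
  have := ge0_integral_pushforward (measurable_flow n%:R) P measurableT (mE 1) d10.
  rewrite preimage_setT => <-.
  pose mPhi := isMeasurableFun.Build _ _ _ _ _ (measurable_flow n%:R).
  pose Phin : {mfun torus R >-> torus R} := HB.pack (Phi n%:R) mPhi.
  by apply: (@eq_measure_integral _ _ R setT P (pushforward P Phin)) => A mA _; exact: inv.
have IS n : (I n%:R%R = n%:R%R%:E * I 1%R)%E.
  elim: n => [|n IH].
    rewrite mulr0n mul0e /I -[RHS](integral0 P setT).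
    by apply: eq_integral => x _; rewrite d00.
  rewrite -natr1 EFinD ge0_muleDl ?lee_fin // mul1e -IH -(flow_inv n) /I.
  rewrite -ge0_integralD //.
  - apply: eq_integral => x _; rewrite -EFinD; congr (_%:E).
    rewrite /d (disp_cocycle C1) -/(d x n%:R); congr (_ + _).
    by apply: (disp_torus C1); rewrite torus_repK (flow_disp flow).
  - by move=> x _; rewrite lee_fin d0.
  - by move=> x _; rewrite lee_fin d0.
  - exact: (measurableT_comp (mE 1) (measurable_flow _)).
have I10 : (0 <= I 1%R)%E by apply: integral_ge0 => x _; rewrite lee_fin d0.
have bound e : 0 < e -> exists B, forall n, (n%:R%R%:E * I 1%R <= (e * n%:R + B)%R%:E)%E.
  move=> e0; have [B [B0 hB]] := torus_disp_sublinear hphi irr flow e0.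
  exists B => n; rewrite -IS.
  have -> : (e * n%:R + B)%:E = (\int[P]_x (e * n%:R + B)%R%:E)%E.
    rewrite integral_cst // [X in (_ * X)%E](_ : _ = 1%E) ?mule1 //.
    exact: probability_setT.
  apply: ge0_le_integral => //.
  - by move=> x _; rewrite lee_fin d0.
  - by move=> x _; rewrite lee_fin hB.
have Ifin : I 1%R \is a fin_num.
  have [B /(_ 1%N)] := bound 1 ltr01; rewrite mul1e => h.
  by rewrite ge0_fin_numE // (le_lt_trans h) // ltry.
have I1 : I 1%R = 0%E.
  rewrite -(fineK Ifin) in I10 bound *; move: (fine (I 1%R)) I10 bound => i.
  rewrite lee_fin => i0 bound; congr (_%:E); apply/eqP; rewrite eq_le i0 andbT.
  rewrite leNgt; apply/negP => ip.
  have [B hB] := bound (i / 2) ltac:(lra).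
  have [n nB] : exists n : nat, B < n%:R * (i / 2).
    exists (Num.truncn (`|B| / (i / 2))).+1.
    have := truncnS_gt (`|B| / (i / 2)); rewrite ltr_pdivrMr; last by lra.
    by apply: le_lt_trans; exact: ler_norm.
  by have := hB n; rewrite -EFinM lee_fin; lra.
apply: (ge0_integral_eq0_null (md 1) _ I1) => [x||x Nx].
- exact: d0.
- by apply: measurableC; exact: measurable_stops.
(* By monotonicity a displacement that is 0 at time 1 is 0 on all of [0, 1]; the speed is then
   constant, equal to [phi x], and has integral 0. *)
apply/eqP => dx; apply: Nx; apply/(reparam_zero hphi).
apply/eqP; rewrite eq_le phi_ge0 andbT -(torus_repK x).
have := derive_ge ler01 (is_derive_disp flow (torus_rep x)) (C := phi (to_torus (torus_rep x))).
rewrite -/(d x) dx d00 !subr0 mulr1; apply=> t /andP[t0 t1].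
have dt0 : d x t = 0.
  apply/eqP; rewrite eq_le d0 // andbT -dx; exact: disp_homo.
by rewrite -/(d x t) dt0 scale0r addr0.
Qed.

Lemma continuous_torus_bounded g : continuous g -> exists M, forall x, `|g x| <= M.
Proof.
move=> cg; have [|M [_ hM]] := biperiodic_bounded (to_torus_biperiodic g).
  by move=> z; apply: continuous_comp; [exact: continuous_to_torus|exact: cg].
by exists M => x; rewrite -(torus_repK x); exact: hM.
Qed.

Lemma continuous_torus_integrable P g : continuous g -> P.-integrable setT (EFin \o g).
Proof.
move=> cg; have [M hM] := continuous_torus_bounded cg.
by apply: bounded_integrable hM; exact: continuous_measurable_torus.
Qed.

Let chi' := chi p q.

Lemma supported_integral P g : supported P -> continuous g ->
  \int[P]_x g x = g q + (g p - g q) * \int[P]_x chi' x.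
Proof.
move=> sP cg; have cchi : continuous chi' by exact: continuous_chi.
have ig := continuous_torus_integrable P cg.
have ichi := continuous_torus_integrable P cchi.
have ch' : continuous (fun x => (g p - g q) * chi' x).
  by move=> x; apply: (@cvgM _ _ _ _ (fun=> g p - g q)); [exact: cvg_cst|exact: cchi].
have ch : continuous (fun x => g q + (g p - g q) * chi' x).
  by move=> x; apply: (@cvgD _ _ _ _ _ (fun=> g q)); [exact: cvg_cst|exact: ch'].
transitivity (\int[P]_x (g q + (g p - g q) * chi' x)).
  congr fine; apply: ae_eq_integral => //.
  - by case/integrableP: ig.
  - by case/integrableP: (continuous_torus_integrable P ch).
  exists (~` [set p; q]); split=> //; first by apply: measurableC; exact: measurable_stops.
  move=> x /= h [] xpq; apply: h => _; congr (_%:E).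
    by rewrite xpq /chi' chi1 //; ring.
  by rewrite xpq /chi' chi0 //; ring.
rewrite RintegralD //; last 2 first.
- by apply: continuous_torus_integrable => x; exact: cvg_cst.
- exact: continuous_torus_integrable.
by rewrite RintegralZl // Rintegral_cstT.
Qed.

Lemma chi_average P : 0 <= \int[P]_x chi' x <= 1.
Proof.
have cchi : continuous chi' by exact: continuous_chi.
rewrite Rintegral_ge0 /=; last by move=> x _; exact: chi_ge0.
rewrite -(Rintegral_cstT P 1).
apply: le_Rintegral => //.
- exact: continuous_torus_integrable.
- by apply: continuous_torus_integrable => x; exact: cvg_cst.
- by move=> x _; exact: chi_le1.
Qed.

Lemma supported_invariant P : supported P -> invariant_probabilities Phi P.
Proof.
move=> sP t A mA.
have mK := measurable_stops.
have restr B : measurable B -> P B = P (B `&` [set p; q]).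
  move=> mB; rewrite -{1}(setIT B) -(setUv [set p; q]) setIUr measureU //.
  - rewrite [X in (_ + X)%E](_ : _ = 0%E) ?adde0 //.
    apply/negligibleP; first by apply: measurableI => //; exact: measurableC.
    apply: (@negligibleS _ _ _ _ (~` [set p; q])); first by move=> ? [].
    by apply/negligibleP => //; exact: measurableC.
  - exact: measurableI.
  - by apply: measurableI => //; exact: measurableC.
  - by rewrite setIACA setICr setI0.
have mPA : measurable (Phi t @^-1` A).
  by rewrite -[_ @^-1` _]setTI; exact: measurable_flow.
rewrite (restr _ mPA) (restr _ mA); congr (P _).
have fixed x : [set p; q] x -> Phi t x = x.
  by move=> xpq; apply: (flow_stopped C1 flow); case: xpq => ->.
by apply/seteqP; split=> x [h xpq]; split=> //; move: h; rewrite /= fixed.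
Qed.

Lemma accumulation_supported P x : accumulation_points Phi x P -> supported P.
Proof.
rewrite /accumulation_points /= => clu.
have ck := continuous_kappa.
pose F : continuousType (torus R) R := mkcts ck.
have I0 : \int[P]_y kappa y = 0.
  apply/eqP; rewrite eq_le Rintegral_ge0 ?andbT; last by move=> y _; exact: kappa_ge0.
  apply/ler_addgt0Pl => e e0; rewrite addr0.
  have e3 : 0 < e / 3 by rewrite divr_gt0.
  have [B [B0 hB]] := average_small hphi irr flow ck kappap kappaq e3.
  pose T := 1 + B / (e / 3).
  have T0 : 0 < T by rewrite ltr_wpDr // divr_ge0 // ltW.
  have [t Tt ht] := accumulation_close F T clu e3.
  have t0 : 0 < t by exact: lt_le_trans Tt.
  have ht2 : `|empirical Phi x t F| <= 2 * (e / 3).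
    rewrite /empirical normrM gtr0_norm ?invr_gt0 // mulrC ler_pdivrMr //.
    apply: (le_trans (hB x t (ltW t0))).
    have : B <= e / 3 * t.
      by rewrite -ler_pdivrMl // mulrC (le_trans _ Tt) // /T lerDr.
    lra.
  have := ler_norm (\int[P]_y kappa y - empirical Phi x t F).
  have := ler_norm (empirical Phi x t F); rewrite /=; lra.
apply: (ge0_integral_eq0_null _ kappa_ge0).
- exact: continuous_measurable_torus.
- have := continuous_torus_integrable P ck => /integrable_fin_num h.
  by rewrite -[LHS]fineK ?h //; congr (_%:E).
- by apply: measurableC; exact: measurable_stops.
- by move=> y Ny; apply/eqP => /kappa_eq0.
Qed.

End invariant_measures.

Lemma ptws_cluster (R : realType) (I : Type) (g : R -> {ptws I -> R})
    (t : nat -> R) (L : {ptws I -> R}) :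
  t n @[n --> \oo] --> +oo -> (forall i, g (t n) i @[n --> \oo] --> L i) ->
  cluster (g @ +oo) L.
Proof.
move=> tt gL.
have H : (g \o t) @ \oo --> L.
  apply/cvg_sup => i A /= [_ [[B oB <-] BL BA]].
  apply: (@filterS _ _ _ ((fun f : I -> R => f i) @^-1` B)) => //.
  by apply: gL; exact: open_nbhs_nbhs.
move=> A B gA LB.
have nA : \forall n \near \oo, A (g (t n)) := tt _ gA.
have nB : \forall n \near \oo, B (g (t n)) := H _ LB.
have [n [An Bn]] := filter_ex (filterI nA nB).
by exists (g (t n)).
Qed.

Lemma accumulation_of_sequence (R : realType) (Phi : R -> torus R -> torus R) x
    (P : probability (torus R) R) (t : nat -> R) :
  t n @[n --> \oo] --> +oo ->
  (forall F : continuousType (torus R) R,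
    empirical Phi x (t n) F @[n --> \oo] --> \int[P]_y F y) ->
  accumulation_points Phi x P.
Proof.
move=> tt H.
exact: (@ptws_cluster R (continuousType (torus R) R) (empirical Phi x) t
  (fun F => \int[P]_y F y) tt H).
Qed.

Section accumulation.
Variables (R : realType) (a : circle R) (p q : torus R).
Variables (phi : torus R -> R) (Phi : R -> torus R -> torus R).
Notation mu := (@lebesgue_measure R).
Let al := circle_rep a.
Hypothesis (pq : p <> q) (hphi : reparam p q phi) (irr : irrational al).
Hypothesis (flow : flow_generated (fun x => phi x *: (1, al)) Phi).
Implicit Types (x y : torus R) (t T e v : R) (n N : nat).
Implicit Types (P : probability (torus R) R).

Let time_near_p x t := \int[mu]_(u in `[0, t]) chi p q (Phi u x).

Let cchi x : continuous (fun u => chi p q (Phi u x)).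
Proof. exact: (continuous_orbit flow (continuous_chi pq)). Qed.

Let time_ge0 x t : 0 <= time_near_p x t.
Proof. by apply: Rintegral_ge0 => u _; exact: chi_ge0. Qed.

Let time_le x t : 0 <= t -> time_near_p x t <= t.
Proof.
move=> t0; have hid s : is_derive s (1 : R) (@id R) 1 by exact: is_derive_id.
have := Rintegral_le_increment (cchi (x := x)) t0 hid; rewrite subr0; apply=> u _.
exact: chi_le1.
Qed.

(** [low] and [high] only approach 0 and 1: they serve directly a target [v] within [e] of an end,
    and the intermediate value theorem serves the others. *)
Lemma intermediate_averages x v e T : 0 <= v <= 1 -> 0 < e ->
  (forall e T, 0 < e -> exists t, [/\ T <= t, 0 < t & time_near_p x t <= e * t]) ->
  (forall e T, 0 < e -> exists t, [/\ T <= t, 0 < t & t - time_near_p x t <= e * t]) ->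
  exists t, [/\ T <= t, 0 < t & `|t^-1 * time_near_p x t - v| <= e].
Proof.
move=> /andP[v0 v1] e0 low high.
pose m t := t^-1 * time_near_p x t.
have m0 t : 0 < t -> 0 <= m t by move=> t0; rewrite mulr_ge0 // invr_ge0 ltW.
have m1 t : 0 < t -> m t <= 1.
  by move=> t0; rewrite /m mulrC ler_pdivrMr // mul1r time_le // ltW.
have [t1 [Tt1 t10 ht1]] := low e T e0; have [t2 [Tt2 t20 ht2]] := high e T e0.
have mt1 : m t1 <= e by rewrite /m mulrC ler_pdivrMr.
have mt2 : 1 - e <= m t2.
  by rewrite /m [leRHS]mulrC ler_pdivlMr // mulrBl mul1r; lra.
have := m0 _ t10; have := m1 _ t20 => mt2' mt1'.
have [ve|ve] := leP v e.
  by exists t1; split=> //; rewrite -/(m t1) ler_norml; apply/andP; split; lra.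
have [ve'|ve'] := leP (1 - e) v.
  by exists t2; split=> //; rewrite -/(m t2) ler_norml; apply/andP; split; lra.
have cm t : 0 < t -> {for t, continuous m}.
  move=> t0; apply: cvgM; last exact: (Rintegral_continuous (cchi (x := x)) t0).
  by apply: cvgV; [rewrite gt_eqF|exact: cvg_id].
pose t3 := Num.min t1 t2; pose t4 := Num.max t1 t2.
have t30 : 0 < t3 by rewrite lt_min t10.
have t34 : t3 <= t4 by rewrite ge_min !le_max lexx.
have cm34 : {within `[t3, t4], continuous m}.
  apply: continuous_in_subspaceT => t; rewrite inE /= in_itv /= => /andP[h _].
  by apply: cm; exact: lt_le_trans h.
have [|t] := @IVT R m t3 t4 v t34 cm34.
  rewrite /t3 /t4; have [h|h] := leP t1 t2.
    by rewrite ge_min le_max; apply/andP; split; apply/orP; [left|right]; lra.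
  by rewrite ge_min le_max; apply/andP; split; apply/orP; [right|left]; lra.
rewrite in_itv /= => /andP[h _] mtv; exists t; split.
- by apply: le_trans h; rewrite le_min Tt1.
- exact: lt_le_trans h.
- by rewrite -/(m t) mtv subrr normr0 ltW.
Qed.

(** One sequence of times serves all test functions: once the averages of [chi] converge to the
    weight [v] of [p], [average_decomposition] makes those of every [F] converge to its integral. *)
Lemma accumulation_all x P :
  (forall e T, 0 < e -> exists t, [/\ T <= t, 0 < t & time_near_p x t <= e * t]) ->
  (forall e T, 0 < e -> exists t, [/\ T <= t, 0 < t & t - time_near_p x t <= e * t]) ->
  supported p q P -> accumulation_points Phi x P.
Proof.
move=> low high sP.
pose v := \int[P]_y chi p q y; have v01 : 0 <= v <= 1 by exact: chi_average.
have ex n : exists t, [/\ n.+1%:R <= t, 0 < t & `|t^-1 * time_near_p x t - v| <= n.+1%:R^-1].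
  by apply: intermediate_averages => //; rewrite invr_gt0.
pose t n := sval (cid (ex n)).
have ht n : [/\ n.+1%:R <= t n, 0 < t n & `|(t n)^-1 * time_near_p x (t n) - v| <= n.+1%:R^-1].
  by rewrite /t; case: cid.
apply: (@accumulation_of_sequence _ _ _ _ t).
  apply/cvgryPge => A; near=> n.
  have [h _ _] := ht n; apply: le_trans h.
  rewrite (le_trans (ler_norm A)) // -natr1; apply: (@le_trans _ _ n%:R); last by rewrite lerDl.
  by near: n; exact: nbhs_infty_ger.
move=> F; rewrite (supported_integral pq sP (@cts_fun _ _ F)) -/v.
apply/cvgrPdist_le => e e0.
have e3 : 0 < e / 3 by rewrite divr_gt0.
have [B [B0 hB]] := average_decomposition pq hphi irr flow (@cts_fun _ _ F) e3.
near=> n.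
have [h1 h2 h3] := ht n.
have nB : B <= e / 3 * n%:R.
  rewrite -ler_pdivrMl // mulrC; near: n; exact: nbhs_infty_ger.
have nF : `|F p - F q| <= e / 3 * n%:R.
  rewrite -ler_pdivrMl // mulrC; near: n; exact: nbhs_infty_ger.
have nt : n%:R <= t n by rewrite (le_trans _ h1) // ler_nat.
have := hB x (t n) (ltW h2); rewrite -/(time_near_p x (t n)).
rewrite /empirical; set J := \int[mu]_(u in _) F _; set A := time_near_p x (t n).
rewrite -/A in h3.
have -> : F q + (F p - F q) * v - (t n)^-1 * J =
    - ((t n)^-1 * (J - (F q * t n + (F p - F q) * A))) - (F p - F q) * ((t n)^-1 * A - v).
  by field; rewrite gt_eqF.
move=> hJ; apply: (le_trans (ler_normB _ _)); rewrite normrN !normrM.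
have k1 : `|(t n)^-1| * `|J - (F q * t n + (F p - F q) * A)| <= e / 3 + e / 3.
  have E : `|(t n)^-1| = (t n)^-1 by rewrite gtr0_norm ?invr_gt0.
  rewrite E (mulrC (t n)^-1) (ler_pdivrMr _ _ h2) (le_trans hJ) // mulrDl lerD2l.
  by rewrite (le_trans nB) // ler_wpM2l // ltW.
have k2 : `|F p - F q| * `|(t n)^-1 * A - v| <= e / 3.
  apply: (@le_trans _ _ (`|F p - F q| * n.+1%:R^-1)); first by rewrite ler_wpM2l.
  have n0 : 0 < n.+1%:R :> R by [].
  by rewrite (ler_pdivrMr _ _ n0) (le_trans nF) // ler_wpM2l ?(ltW e3) // ler_nat leqnSn.
apply: (le_trans (lerD k1 k2)); lra.
Unshelve. all: by end_near. Qed.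

Lemma accumulation_points_eq x :
  (forall e T, 0 < e -> exists t, [/\ T <= t, 0 < t & time_near_p x t <= e * t]) ->
  (forall e T, 0 < e -> exists t, [/\ T <= t, 0 < t & t - time_near_p x t <= e * t]) ->
  accumulation_points Phi x = invariant_probabilities Phi.
Proof.
move=> low high; apply/seteqP; split=> P.
  by move=> /(accumulation_supported hphi irr flow)/(supported_invariant hphi flow).
by move=> /(invariant_supported hphi irr flow); exact: accumulation_all.
Qed.

End accumulation.

(** * Approaching a single stopping point *)

Section atan_sums.
Variable R : realType.
Implicit Types (c w : nat -> R) (s : R) (M : nat).

(** Primitive of the sum of the [((s - c n)^2 + w n^2)^-1]. Each term varies by at most [pi / w n]
    in total, so that an increment over any interval is at most [pi] times the sum of the inverses
    of the [w n]. *)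
Definition atan_sum c w M s : R := \sum_(n < M) (w n)^-1 * atan ((w n)^-1 * (s - c n)).

Lemma is_derive_atan_sum c w M s : (forall n, 0 < w n) ->
  is_derive s (1 : R) (atan_sum c w M) (\sum_(n < M) ((s - c n) ^+ 2 + w n ^+ 2)^-1).
Proof.
move=> w0; elim: M => [|M IH].
  have -> : atan_sum c w 0 = cst 0 by apply/funext => x; rewrite /atan_sum big_ord0.
  by rewrite big_ord0; exact: is_derive_cst.
have -> : atan_sum c w M.+1 =
    atan_sum c w M + (w M)^-1 \*: (@atan R \o (fun s => (w M)^-1 * (s - c M))).
  by apply/funext => x; rewrite /atan_sum big_ord_recr.
rewrite big_ord_recr /=.
have h : is_derive s (1 : R) (fun s => (w M)^-1 * (s - c M)) (w M)^-1.
  apply: (is_derive_eq (is_deriveZ (w M)^-1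
    (is_deriveB (is_derive_id s (1 : R)) (is_derive_cst (c M) s 1)))).
  by rewrite subr0 /GRing.scale /= mulr1.
apply: (is_derive_eq (is_deriveD IH (is_deriveZ (w M)^-1
  (is_derive1_comp (is_derive1_atan _) h)))).
congr (_ + _); rewrite /GRing.scale /=; have wM := w0 M.
have s0 := sqr_ge0 (s - c M); have s1 := exprn_gt0 2 wM.
by field; rewrite !gt_eqF //; lra.
Qed.

Lemma atan_sum_bound c w M s : (forall n, 0 < w n) ->
  `|atan_sum c w M s| <= pi / 2 * \sum_(n < M) (w n)^-1.
Proof.
move=> w0; rewrite mulr_sumr (le_trans (ler_norm_sum _ _ _)) //.
apply: ler_sum => n _; have wn := w0 n; have wV : 0 < (w n)^-1 by rewrite invr_gt0.
rewrite normrM (gtr0_norm wV) [leRHS]mulrC.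
rewrite ler_pM2l // ler_norml.
by rewrite (ltW (atan_gtNpi2 _)) (ltW (atan_ltpi2 _)).
Qed.

End atan_sums.

Lemma reparamC (R : realType) (p q : torus R) (phi : torus R -> R) :
  reparam p q phi -> reparam q p phi.
Proof. by case=> h1 h2 h3 h4 h5; split=> // x; rewrite h3; tauto. Qed.

Section low_averages.
Variables (R : realType) (a : circle R) (p q : torus R).
Variables (phi : torus R -> R) (Phi : R -> torus R -> torus R).
Notation mu := (@lebesgue_measure R).
Let al := circle_rep a.
Let f := phi \o @to_torus R.
Hypothesis (pq : p <> q) (hphi : reparam p q phi) (irr : irrational al).
Hypothesis (flow : flow_generated (fun x => phi x *: (1, al)) Phi).
Variable x : torus R.
Let z := torus_rep x.
Let d := disp flow z.
Let U n := nrm (off al (torus_rep p) z n).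
Let V n := nrm (off al (torus_rep q) z n).
Hypothesis (U0 : forall n, 0 < U n) (V0 : forall n, 0 < V n).
Hypothesis close_returns : forall (K : R) (N0 : nat),
  exists2 N, (N0 <= N)%N & K * \sum_(n < N + 4) (U n)^-1 <= (V N)^-1.
Implicit Types (s t T e : R) (n N : nat).

Let al01 : 0 <= al <= 1.
Proof. by have /andP[h1 h2] := circle_rep_itv a; rewrite h1 ltW. Qed.

Let phi_ge0 := reparam_ge0 hphi.
Let C2 : Ck 2 f. Proof. exact/Ck_pred/(reparam_C3 hphi). Qed.
Let cf : continuous f. Proof. exact: (Ck_pred (Ck_pred C2)). Qed.
Let pf : biperiodic f := to_torus_biperiodic phi.
Let f_ge0 w : 0 <= f w. Proof. exact: phi_ge0. Qed.

Let rep_dist c : - 1 < (torus_rep c).1 - z.1 < 1.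
Proof.
have /andP[h1 h2] := circle_rep_itv c.1; have /andP[h3 h4] := circle_rep_itv x.1.
rewrite /z /torus_rep /=; lra.
Qed.

Let lower c : phi c = 0 -> positive_definite (hessian f (torus_rep c)) ->
  exists k r, [/\ 0 < k, 0 < r & forall s, 0 <= s ->
    tdist c (to_torus (z + s *: (1, al))) < r ->
    exists n, n%:R < s + 3 /\ (s - col (torus_rep c) z n) ^+ 2 +
      nrm (off al (torus_rep c) z n) ^+ 2 <= 2 / k * f (z + s *: (1, al))].
Proof.
move=> c0 pd; have fc : f (torus_rep c) = 0 by rewrite /f /= torus_repK.
have [k [r [k0 r0 hr]]] := zero_lower_bound f_ge0 fc C2 pd.
exists k, (Num.min r 2^-1); split=> //; first by rewrite lt_min r0 /= invr_gt0 ltr0n.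
have /andP[z1 z2] := rep_dist c.
have r2 : Num.min r 2^-1 <= 2^-1 by rewrite ge_min lexx orbT.
have hr' h : l1 h < Num.min r 2^-1 -> k * l1 h ^+ 2 <= f (torus_rep c + h).
  by rewrite lt_min => /andP[h1 _]; exact: hr.
move=> s s0.
have -> : tdist c (to_torus (z + s *: (1, al))) =
    nrm (z.1 + s - (torus_rep c).1) + nrm (z.2 + al * s - (torus_rep c).2).
  by rewrite tdist_to_torus /= /GRing.scale /= mulr1 (mulrC s).
exact: (near_lattice_lower pf al01 k0 hr').
Qed.

Let phip : phi p = 0. Proof. by apply/(reparam_zero hphi); left. Qed.
Let phiq : phi q = 0. Proof. by apply/(reparam_zero hphi); right. Qed.

Let not_stopped c : phi c = 0 -> positive_definite (hessian f (torus_rep c)) ->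
  (forall n, 0 < nrm (off al (torus_rep c) z n)) ->
  forall s, 0 <= s -> to_torus (z + s *: (1, al)) <> c.
Proof.
move=> c0 pd nz s s0 E; have [k [r [k0 r0 H]]] := lower c0 pd.
have [|n [_]] := H s s0; first by rewrite E tdist_self.
rewrite /f /= E c0 mulr0; have := sqr_ge0 (s - col (torus_rep c) z n).
have := exprn_gt0 2 (nz n); lra.
Qed.

Let orbit_positive s : 0 <= s -> 0 < f (z + s *: (1, al)).
Proof.
move=> s0; rewrite lt0r f_ge0 andbT; apply/eqP => /(reparam_zero hphi)[].
  exact: (not_stopped phip (reparam_hessp hphi)).
exact: (not_stopped phiq (reparam_hessq hphi)).
Qed.

(** Until the displacement reaches [N + 1], the time near [p] is at most the increment of an
    arctangent sum of the displacement, of order [\sum 1/U n], while crossing column [N] of [q]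
    alone takes a time of order [1/V N]. Away from [p], [chi] is at most [e / 4] plus a multiple of
    the speed, which costs only a displacement. Four terms of size [e / 4 * t] make up the bound. *)
Lemma low_average e T : 0 < e ->
  exists t, [/\ T <= t, 0 < t & \int[mu]_(u in `[0, t]) chi p q (Phi u x) <= e * t].
Proof.
move=> e0; have [k [r [k0 r0 near_p]]] := lower phip (reparam_hessp hphi).
have fq : f (torus_rep q) = 0 by rewrite /f /= torus_repK.
have [C [C0 hC]] := zero_upper_bound pf f_ge0 fq C2.
have C10 : 0 < C + 1 by lra.
have hC1 h : f (torus_rep q + h) <= (C + 1) * l1 h ^+ 2.
  by apply: (le_trans (hC h)); rewrite ler_wpM2r ?sqr_ge0 // lerDl.
have e4 : 0 < e / 4 by rewrite divr_gt0.
have [A [A0 hA]] : exists A, 0 <= A /\ forall y, r <= tdist p y -> chi p q y <= e / 4 + A * phi y.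
  (* This product vanishes at both stopping points, and dividing by [r] recovers [chi] away from
     [p]. *)
  have cg : continuous (fun y => chi p q y * tdist p y).
    by move=> y; apply: cvgM; [exact: continuous_chi|exact: continuous_tdist].
  have [||A [A0 hA]] := torus_dominated hphi cg _ _ (mulr_gt0 e4 r0).
  - by rewrite tdist_self mulr0.
  - by rewrite chi0 mul0r.
  exists (A / r); split; first by rewrite divr_ge0 // ltW.
  move=> y ry; rewrite -(ler_pM2r r0) mulrDl.
  have -> : A / r * phi y * r = A * phi y by field; rewrite gt_eqF.
  have g0 : 0 <= chi p q y * tdist p y by apply: mulr_ge0; [exact: chi_ge0|exact: tdist_ge0].
  apply: le_trans (hA y); rewrite (ger0_norm g0).
  by rewrite ler_wpM2l // chi_ge0.
have e'0 : 0 < e / 4 / (A + 1) by rewrite divr_gt0 //; lra.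
have [B [B0 hB]] := torus_disp_sublinear hphi irr flow e'0.
pose c2 := 2 / (9 * (C + 1)); have c20 : 0 < c2 by rewrite divr_gt0 // mulr_gt0.
(* The first term makes the arctangent increment at most [e / 4 * t]; the second gives [S <= t],
   which puts [t] beyond [N0] since every inverse height is at least 1. *)
pose K := 2 / k * pi / (e / 4 * c2) + c2^-1.
have pi0 : 0 < pi :> R by exact: pi_gt0.
have K1 : 0 < 2 / k * pi / (e / 4 * c2) by rewrite !(divr_gt0, mulr_gt0).
pose N0 := (Num.truncn (`|T| + A * B / (e / 4))).+4.
have N0T : `|T| + A * B / (e / 4) <= N0%:R.
  have := truncnS_gt (`|T| + A * B / (e / 4)) => /ltW h; apply: (le_trans h).
  by rewrite ler_nat; do 3 apply: leqW.
have [N N0N hN] := close_returns K N0.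
have N3 : (3 <= N)%N by apply: leq_trans N0N.
(* At displacement [N + 1] column [N] of [q] has been crossed entirely, and the columns of [p]
   approached so far have index below [N + 1 + 3]: this is the origin of [N + 4]. *)
have [t t0 ht] := @disp_reaches _ _ _ _ phi_ge0 flow z N.+1%:R orbit_positive cf (ler0n _ _).
pose S := \sum_(n < N + 4) (U n)^-1.
have tV : c2 * (V N)^-1 <= t.
  apply: (@nth_passage_time _ _ _ _ al01 phi_ge0 flow _ _ _ _ t C10 hC1 (rep_dist q) N3 (V0 N)).
  by rewrite -ht.
have NS : (N + 4)%:R <= S.
  rewrite -[X in X%:R]card_ord -sum1_card natr_sum; apply: ler_sum => n _.
  rewrite invf_ge1 // (le_trans (nrm_half _)) // invf_le1 //; lra.
have S0 : 0 < S by rewrite (lt_le_trans _ NS) // ltr0n addn4.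
have tS : c2 * (K * S) <= t by rewrite (le_trans _ tV) // ler_pM2l.
have tN : N0%:R <= t.
  apply: le_trans tS; apply: (@le_trans _ _ S).
    by rewrite (le_trans _ NS) // ler_nat (leq_trans N0N) // leq_addr.
  rewrite mulrA ler_peMl ?(ltW S0) // /K mulrDr mulfV ?gt_eqF // lerDr.
  by rewrite mulr_ge0 // ltW.
have Tt : `|T| + A * B / (e / 4) <= t by exact: le_trans tN.
have AB0 : 0 <= A * B / (e / 4) by rewrite divr_ge0 ?mulr_ge0 // ltW.
exists t; split.
- by have := ler_norm T; lra.
- by rewrite (lt_le_trans _ tN) // ltr0n.
pose H := atan_sum (col (torus_rep p) z) U (N + 4).
have hG s : is_derive s (1 : R) (fun s => e / 4 * s + A * d s + 2 / k * H (d s))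
    (e / 4 + A * phi (Phi s x) + 2 / k *
      ((\sum_(n < N + 4) ((d s - col (torus_rep p) z n) ^+ 2 + U n ^+ 2)^-1) * phi (Phi s x))).
  have hd : is_derive s (1 : R) d (phi (Phi s x)) by exact: is_derive_d.
  have hH := is_derive1_comp (is_derive_atan_sum (col (torus_rep p) z) (N + 4) (d s) U0) hd.
  apply: (is_derive_eq (is_deriveD (is_deriveD (is_deriveZ (e / 4) (is_derive_id s (1 : R)))
    (is_deriveZ A hd)) (is_deriveZ (2 / k) hH))).
  by rewrite /GRing.scale /= mulr1.
have cchi : continuous (fun u => chi p q (Phi u x)).
  exact: (continuous_orbit flow (continuous_chi pq)).
have := Rintegral_le_increment cchi t0 hG.
have d0 : d 0 = 0 by exact: disp0.
rewrite d0 !mulr0 !add0r => /(_ _)/le_trans; apply.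
  move=> u /andP[u0 ut].
  have du0 : 0 <= d u by exact: disp_ge0.
  have duN : d u <= N.+1%:R by rewrite -ht; exact: disp_homo.
  have PhiE : Phi u x = to_torus (z + d u *: (1, al)) by exact: flow_disp.
  have sum_ge0 : 0 <= \sum_(n < N + 4) ((d u - col (torus_rep p) z n) ^+ 2 + U n ^+ 2)^-1.
    by apply: sumr_ge0 => n _; rewrite invr_ge0 addr_ge0 ?sqr_ge0.
  have p0 := phi_ge0 (Phi u x).
  have [h|h] := leP r (tdist p (Phi u x)).
    rewrite (le_trans (hA _ h)) // lerDl.
    by apply: mulr_ge0; [rewrite divr_ge0 // ltW|exact: mulr_ge0].
  rewrite (le_trans (chi_le1 pq _)) //.
  have h' : tdist p (to_torus (z + d u *: (1, al))) < r by rewrite -PhiE.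
  have [n [nu hn]] := near_p (d u) du0 h'.
  have nN : (n < N + 4)%N.
    rewrite -(ltr_nat R) (lt_le_trans nu) // natrD; rewrite -natr1 in duN; lra.
  apply: (@le_trans _ _ (2 / k * ((\sum_(n < N + 4)
      ((d u - col (torus_rep p) z n) ^+ 2 + U n ^+ 2)^-1) * phi (Phi u x)))); last first.
    by rewrite lerDr addr_ge0 ?(ltW e4) // mulr_ge0.
  rewrite mulrCA; rewrite /f /= -PhiE -/(U n) in hn.
  have q0 : 0 < (d u - col (torus_rep p) z n) ^+ 2 + U n ^+ 2.
    by rewrite ltr_wpDl ?sqr_ge0 ?exprn_gt0.
  apply: (@le_trans _ _ (((d u - col (torus_rep p) z n) ^+ 2 + U n ^+ 2)^-1 *
      (2 / k * phi (Phi u x)))); first by rewrite mulrC ler_pdivlMr // mul1r.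
  rewrite ler_wpM2r //; first by rewrite mulr_ge0 // divr_ge0 // ltW.
  rewrite (bigD1 (Ordinal nN)) //= lerDl.
  by apply: sumr_ge0 => m _; rewrite invr_ge0 addr_ge0 ?sqr_ge0.
have b1 := atan_sum_bound (col (torus_rep p) z) (N + 4) (d t) U0.
have b2 := atan_sum_bound (col (torus_rep p) z) (N + 4) 0 U0.
rewrite -/S -/H in b1 b2.
have HH : H (d t) - H 0 <= pi * S.
  move: b1 b2; rewrite !ler_norml => /andP[_ b1] /andP[b2 _]; lra.
have HH2 : 2 / k * (H (d t) - H 0) <= e / 4 * t.
  apply: (@le_trans _ _ (2 / k * (pi * S))).
    by rewrite ler_wpM2l // divr_ge0 // ltW.
  apply: (@le_trans _ _ (e / 4 * (c2 * (K * S)))); last by rewrite ler_wpM2l // ltW.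
  have -> : e / 4 * (c2 * (K * S)) = 2 / k * (pi * S) + e / 4 * S.
    by rewrite /K; field; rewrite !gt_eqF.
  by rewrite lerDl mulr_ge0 // ltW.
have Ad : A * d t <= e / 4 * t + e / 4 * t.
  apply: (@le_trans _ _ (A * (e / 4 / (A + 1) * t + B))).
    by rewrite ler_wpM2l // hB.
  rewrite mulrDr; apply: lerD; last first.
    have : A * B / (e / 4) <= t by have := normr_ge0 T; lra.
    by rewrite ler_pdivrMr // (mulrC t).
  rewrite mulrA ler_wpM2r // mulrCA ler_piMr ?(ltW e4) // ler_pdivrMr; lra.
rewrite mulrBr in HH2; lra.
Qed.

End low_averages.

(** The times at which the weight of [p] is almost 1 come from [low_average] with [p] and [q]
    exchanged, through [chi q p = 1 - chi p q]. *)
Theorem historic_orbit (R : realType) (a : circle R) (p q : torus R)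
    (phi : torus R -> R) (Phi : R -> torus R -> torus R) (x : torus R) :
  let al := circle_rep a in
  let U n := nrm (off al (torus_rep p) (torus_rep x) n) in
  let V n := nrm (off al (torus_rep q) (torus_rep x) n) in
  p <> q -> reparam p q phi -> irrational al ->
  flow_generated (fun x => phi x *: (1, al)) Phi ->
  (forall n, 0 < U n) -> (forall n, 0 < V n) ->
  (forall (K : R) (N0 : nat),
    exists2 N, (N0 <= N)%N & K * \sum_(n < N + 4) (U n)^-1 <= (V N)^-1) ->
  (forall (K : R) (N0 : nat),
    exists2 N, (N0 <= N)%N & K * \sum_(n < N + 4) (V n)^-1 <= (U N)^-1) ->
  accumulation_points Phi x = invariant_probabilities Phi.
Proof.
move=> al U V pq hphi irr flow U0 V0 UV VU.
apply: (accumulation_points_eq pq hphi irr flow) => e T e0.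
  exact: (low_average pq hphi irr flow U0 V0 UV).
have qp : q <> p by move=> E; apply: pq.
have [t [Tt t0 ht]] := low_average qp (reparamC hphi) irr flow V0 U0 VU T e0.
exists t; split=> //; apply: le_trans ht.
have cchi := continuous_orbit (x := x) flow (continuous_chi pq).
have := Rintegral_lin (-1) t (fun=> cvg_cst (1 : R)) cchi.
rewrite Rintegral_one ?(ltW t0) // mulN1r => <-.
by under eq_Rintegral do rewrite mulN1r -chiC //.
Qed.

(** * Second moments *)

Section bounded_expectation.
Context d (T : measurableType d) (R : realType) (P : probability T R).
Implicit Types (X Y : T -> R) (A : set T) (c : R).

Definition bm X := measurable_fun setT X /\ exists M : R, forall x, `|X x| <= M.

Notation "'E[' X ]" := (\int[P]_x X x).

Lemma bm_integrable X : bm X -> P.-integrable setT (EFin \o X).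
Proof. by case=> mX [M hM]; exact: bounded_integrable hM. Qed.

Lemma bm_cst c : bm (fun=> c).
Proof. by split; [exact: measurable_cst|exists `|c|]. Qed.

Lemma bmD X Y : bm X -> bm Y -> bm (fun x => X x + Y x).
Proof.
move=> [mX [M hM]] [mY [N hN]]; split; first exact: measurable_funD.
by exists (M + N) => x; rewrite (le_trans (ler_normD _ _)) // lerD.
Qed.

Lemma bmM X Y : bm X -> bm Y -> bm (fun x => X x * Y x).
Proof.
move=> [mX [M hM]] [mY [N hN]]; split; first exact: measurable_funM.
by exists (M * N) => x; rewrite normrM ler_pM.
Qed.

Lemma bmZ c X : bm X -> bm (fun x => c * X x).
Proof. by move=> hX; apply: bmM => //; exact: bm_cst. Qed.

Lemma bm_sum (I : Type) (r : seq I) (X : I -> T -> R) :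
  (forall i, bm (X i)) -> bm (fun x => \sum_(i <- r) X i x).
Proof.
move=> hX; elim: r => [|i r IH].
  have -> : (fun x => \sum_(i <- [::]) X i x) = (fun=> 0) by apply/funext => x; rewrite big_nil.
  exact: bm_cst.
have -> : (fun x => \sum_(j <- i :: r) X j x) = (fun x => X i x + \sum_(j <- r) X j x).
  by apply/funext => x; rewrite big_cons.
exact: bmD.
Qed.

Lemma bm_indic A : measurable A -> bm (\1_A : T -> R).
Proof.
move=> mA; split; first exact: measurable_indic.
by exists 1 => x; rewrite indicE; case: (_ \in _); rewrite /= ?normr1 ?normr0.
Qed.

Lemma bm_continuous X (f : R -> R) (M : R) : measurable_fun setT X -> continuous f ->
  (forall y, `|f y| <= M) -> bm (fun x => f (X x)).
Proof.
move=> mX cf hM; split; last by exists M.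
by apply: (measurableT_comp _ mX); exact: continuous_measurable_fun.
Qed.

Lemma E_cst c : \int[P]_x c = c.
Proof.
rewrite Rintegral_cst //= [X in fine X](_ : _ = 1%E) ?mulr1 //.
exact: probability_setT.
Qed.

Lemma E_D X Y : bm X -> bm Y -> \int[P]_x (X x + Y x) = E[X] + E[Y].
Proof. by move=> hX hY; rewrite RintegralD //; exact: bm_integrable. Qed.

Lemma E_Z c X : bm X -> \int[P]_x (c * X x) = c * E[X].
Proof. by move=> hX; rewrite RintegralZl //; exact: bm_integrable. Qed.

Lemma E_sum (I : Type) (r : seq I) (X : I -> T -> R) : (forall i, bm (X i)) ->
  \int[P]_x (\sum_(i <- r) X i x) = \sum_(i <- r) E[X i].
Proof.
move=> hX; elim: r => [|i r IH].
  by rewrite big_nil; under eq_Rintegral do rewrite big_nil; exact: E_cst.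
under eq_Rintegral do rewrite big_cons.
by rewrite big_cons E_D ?IH //; exact: bm_sum.
Qed.

Lemma E_le X Y : bm X -> bm Y -> (forall x, X x <= Y x) -> E[X] <= E[Y].
Proof. by move=> hX hY h; apply: le_Rintegral => //; exact: bm_integrable. Qed.

Lemma E_ge0 X : (forall x, 0 <= X x) -> 0 <= E[X].
Proof. by move=> h; apply: Rintegral_ge0 => x _. Qed.

Lemma E_indic A : measurable A -> E[\1_A] = fine (P A).
Proof. by move=> mA; rewrite /Rintegral integral_indic // setIT. Qed.

(* On [A] the sum [Y] of the [X i] agrees with [Z], so that either [Z] is at
   least half of the mean [M] of [Y], or [Y] deviates from [M] by at least
   [M / 2]; Markov and Chebyshev are applied together. *)
Lemma second_moment (I : eqType) (r : seq I) (X X' : I -> T -> R) (m : I -> R) A eta :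
  uniq r -> measurable A -> (forall i, bm (X i)) -> (forall i, bm (X' i)) ->
  (forall i x, 0 <= X i x <= 1) -> (forall i x, 0 <= X' i x) ->
  (forall i, E[X i] = m i) ->
  (forall i j, i != j -> \int[P]_x (X i x * X j x) = m i * m j) ->
  (forall i, i \in r -> E[X' i] <= eta * m i) ->
  (forall x, A x -> forall i, i \in r -> X i x = X' i x) ->
  let M := \sum_(i <- r) m i in 0 < M -> fine (P A) <= 4 / M + 2 * eta.
Proof.
move=> ur mA bX bX' X01 X'0 EX EXX EX' AX M M0.
pose Y x := \sum_(i <- r) X i x; pose Z x := \sum_(i <- r) X' i x.
have bY : bm Y by exact: bm_sum.
have bZ : bm Z by exact: bm_sum.
have EY : E[Y] = M by rewrite E_sum //; apply: eq_bigr => i _; exact: EX.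
have EZ : E[Z] <= eta * M.
  rewrite E_sum // mulr_sumr big_seq [leRHS]big_seq.
  by apply: ler_sum => i ir; exact: EX'.
(* Diagonal terms are bounded using [X i^2 <= X i] and the others are products of means: the
   variance of [Y] is at most [M]. *)
have EYY : \int[P]_x (Y x * Y x) <= M + M ^+ 2.
  have -> : (fun x => Y x * Y x) = (fun x => \sum_(i <- r) \sum_(j <- r) X i x * X j x).
    by apply/funext => x; rewrite /Y mulr_suml; apply: eq_bigr => i _; rewrite mulr_sumr.
  rewrite E_sum; last by move=> i; apply: bm_sum => j; exact: bmM.
  rewrite expr2 {2}/M mulr_suml -big_split /= big_seq [leRHS]big_seq.
  apply: ler_sum => i ir; rewrite E_sum; last by move=> j; exact: bmM.
  rewrite (bigD1_seq i) //= mulr_sumr [in leRHS](bigD1_seq i) //= addrA; apply: lerD.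
    apply: (@le_trans _ _ (m i)); last first.
      by rewrite lerDl mulr_ge0 // -EX E_ge0 // => x; case/andP: (X01 i x).
    rewrite -EX; apply: E_le => //; first exact: bmM.
    by move=> x; have /andP[h0 h1] := X01 i x; rewrite ler_piMl.
  rewrite le_eqVlt; apply/orP; left; apply/eqP; apply: eq_bigr => j ji.
  by rewrite EXX // eq_sym.
(* This is [M^2 / 4 <= (Y - M)^2 + M / 2 * Z] on [A], with the square expanded and its negative term
   moved to the left. *)
have key x : M ^+ 2 / 4 * \1_A x + 2 * M * Y x <= Y x * Y x + (M ^+ 2 + M / 2 * Z x).
  have sq := sqr_ge0 (Y x - M).
  have Z0 : 0 <= M / 2 * Z x.
    by rewrite mulr_ge0 ?divr_ge0 ?(ltW M0) // sumr_ge0.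
  rewrite indicE; case: (boolP (x \in A)) => xA; last by rewrite mulr0; lra.
  rewrite mulr1.
  have YZ : Y x = Z x.
    rewrite /Y /Z big_seq [RHS]big_seq; apply: eq_bigr => i ir.
    by apply: AX => //; rewrite inE in xA.
  rewrite -YZ in Z0 *; have [h|h] := leP (Y x) (M / 2).
    have : 0 <= (M / 2 - Y x) * (3 / 2 * M - Y x) by rewrite mulr_ge0 ?subr_ge0 //; lra.
    lra.
  have : 0 <= M / 2 * (Y x - M / 2) by rewrite mulr_ge0 ?divr_ge0 ?(ltW M0) // subr_ge0 ltW.
  lra.
have bA := bm_indic mA.
have b1 := bmZ (M ^+ 2 / 4) bA; have b2 := bmZ (2 * M) bY.
have b3 := bmM bY bY; have b4 := bm_cst (M ^+ 2); have b5 := bmZ (M / 2) bZ.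
have := E_le (bmD b1 b2) (bmD b3 (bmD b4 b5)) key.
rewrite (E_D b1 b2) (E_D b3 (bmD b4 b5)) (E_D b4 b5) (E_cst (M ^+ 2)) !E_Z // E_indic // EY => h.
have {}h : M ^+ 2 / 4 * fine (P A) <= M + M / 2 * (eta * M).
  have : M / 2 * E[Z] <= M / 2 * (eta * M) by rewrite ler_wpM2l // divr_ge0 // ltW.
  lra.
rewrite -(ler_pM2l (_ : 0 < M ^+ 2 / 4)); last by rewrite divr_gt0 ?exprn_gt0.
apply: (le_trans h); rewrite le_eqVlt; apply/orP; left; apply/eqP.
by field; rewrite gt_eqF.
Qed.

End bounded_expectation.

(** * Dyadic majorants of the inverse *)

Section tents.
Variable R : realType.
Implicit Types (th y : R) (j J : nat).

(** Continuous substitute for the indicator of [|y| < th]: composed with the distance to the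
    integers it has a mean given by the integral of a continuous periodic function. *)
Definition tent th y : R := Num.max 0 (1 - `|y| / th).

Lemma tent_ge0 th y : 0 <= tent th y.
Proof. by rewrite le_max lexx. Qed.

Lemma tent_le1 th y : 0 < th -> tent th y <= 1.
Proof. by move=> th0; rewrite ge_max ler01 gerBl divr_ge0 // ltW. Qed.

Lemma tent_gt0 th y : 0 < th -> 0 < tent th y -> `|y| < th.
Proof. by move=> th0; rewrite lt_max ltxx /= subr_gt0 ltr_pdivrMr // mul1r. Qed.

Lemma tent_half th y : 0 < th -> `|y| <= th / 2 -> 2^-1 <= tent th y.
Proof.
move=> th0 h; rewrite le_max; apply/orP; right.
have : `|y| / th <= 2^-1 by rewrite ler_pdivrMr // mulrC.
lra.
Qed.

Lemma continuous_tent th : continuous (tent th).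
Proof.
move=> y.
have c1 : {for y, continuous (fun y : R => 1 - `|y| / th)}.
  apply: cvgB; first exact: cvg_cst.
  by apply: cvgM; [exact: norm_continuous|exact: cvg_cst].
exact: (@continuous_max _ _ (fun=> 0) (fun y => 1 - `|y| / th) y (cvg_cst _) c1).
Qed.

(** Majorant of the inverse truncated at [2^-J]. Scale [j] has height [2^(j+2)] and half-width
    [2^(1-j)], so that its mean stays bounded (by 16 below) and [J] plays the part of a
    logarithm. *)
Definition tents J y : R := 1 + \sum_(j < J) 2 ^+ j.+2 * tent (2 * 2^-1 ^+ j) y.

(** Below [2^-J] the added tent is at least one half and contributes the full [2^(J+1)]; above, the
    left-hand side does not change. *)
Lemma inv_le_tents J y : 0 <= y -> (Num.max y (2^-1 ^+ J))^-1 <= tents J y.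
Proof.
move=> y0; elim: J => [|J IH].
  by rewrite /tents big_ord0 addr0 expr0 invf_le1 ?lt_max ?ltr01 ?orbT // le_max lexx orbT.
rewrite /tents big_ord_recr /= addrA -/(tents J y).
have e0 j : 0 < 2^-1 ^+ j :> R by rewrite exprn_gt0 // invr_gt0.
have t0 := tent_ge0 (2 * 2^-1 ^+ J) y.
have [h|h] := leP (2^-1 ^+ J) y.
  have h' : 2^-1 ^+ J.+1 <= y by rewrite (le_trans _ h) // exprS ler_piMl ?(ltW (e0 _)) //; lra.
  rewrite (max_l h) in IH; rewrite (max_l h') (le_trans IH) // lerDl.
  by apply: mulr_ge0 => //; apply: exprn_ge0; rewrite ler0n.
apply: (@le_trans _ _ (2 ^+ J.+2 * 2^-1)).
  rewrite [2 ^+ J.+2]exprSr mulfK ?gt_eqF // -[leRHS]invrK -exprVn.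
  by rewrite lef_pV2 ?posrE ?lt_max ?e0 ?orbT // le_max lexx orbT.
apply: (@le_trans _ _ (2 ^+ J.+2 * tent (2 * 2^-1 ^+ J) y)).
  rewrite ler_wpM2l ?exprn_ge0 // tent_half ?mulr_gt0 //.
  by rewrite ger0_norm // mulrAC mulfV ?gt_eqF // mul1r ltW.
rewrite lerDr; apply: le_trans IH.
by rewrite invr_ge0 le_max y0.
Qed.

Lemma measurable_inv : measurable_fun [set: R] (@GRing.inv R).
Proof.
have h : [set: R] = [set 0] `|` ~` [set 0] by rewrite setUv.
rewrite h; apply/measurable_funU => //; first exact: measurableC.
split.
  apply: (eq_measurable_fun (fun=> 0 : R)); last exact: measurable_cst.
  by move=> x; rewrite inE => ->; rewrite invr0.
apply: open_continuous_measurable_fun.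
  by apply: closed_openC; exact: closed_eq.
by move=> x; rewrite inE /= => /eqP x0; exact: inv_continuous.
Qed.

End tents.

Lemma sum_ord_cst (R : realType) (k : nat) (c : R) : \sum_(n < k) c = k%:R * c.
Proof. by rewrite sumr_const card_ord mulr_natl. Qed.

(** * Almost sure close returns *)

Section close_returns.
Context d (T : measurableType d) (R : realType) (P : probability T R).
Variables (u v : nat -> T -> R) (I : R -> R).
Notation "'E[' X ]" := (\int[P]_x X x).
Hypotheses (mu : forall n, measurable_fun setT (u n)) (mv : forall n, measurable_fun setT (v n)).
Hypotheses (u0 : forall n x, 0 <= u n x) (v0 : forall n x, 0 <= v n x).
(** What is kept of the randomness: tents of the [u n] and of the [v n] share the mean [I th],
    comparable to [th]; tents of distinct [u n] are uncorrelated, and uncorrelated with the events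
    defined by partial sums over [v]. The section is used twice, with [u] and [v] exchanged. *)
Hypothesis I_ge : forall th, 0 < th <= 2^-1 -> th / 4 <= I th.
Hypothesis I_le : forall th, 0 < th -> I th <= 2 * th.
Hypothesis Eu : forall n th, 0 < th -> E[fun x => tent th (u n x)] = I th.
Hypothesis Ev : forall n th, 0 < th -> E[fun x => tent th (v n x)] = I th.
Hypothesis Euu : forall n m th th', n != m -> 0 < th -> 0 < th' ->
  E[fun x => tent th (u n x) * tent th' (u m x)] = I th * I th'.

Definition inv_sum k x := \sum_(n < k) (v n x)^-1.
Hypothesis Euv : forall n th k c, 0 < th ->
  E[fun x => tent th (u n x) * \1_[set x | c < inv_sum k x] x] =
  I th * E[\1_[set x | c < inv_sum k x]].

Let bm_tent (w : nat -> T -> R) n th : measurable_fun setT (w n) -> 0 < th ->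
  bm (fun x => tent th (w n x)).
Proof.
move=> mw th0; apply: (@bm_continuous _ _ _ (w n) (tent th) 1 mw (@continuous_tent R th)).
by move=> y; rewrite ger0_norm ?tent_ge0 // tent_le1.
Qed.

Let half2_gt0 j : 0 < 2 * 2^-1 ^+ j :> R. Proof. by rewrite mulr_gt0. Qed.

Let bm_tents J n : bm (fun x => tents J (v n x)).
Proof.
apply: bmD; first exact: bm_cst.
by apply: bm_sum => j; apply: bmZ; exact: bm_tent.
Qed.

Let E_tents J n : E[fun x => tents J (v n x)] <= 1 + 16 * J%:R.
Proof.
have b j : bm (fun x => 2 ^+ j.+2 * tent (2 * 2^-1 ^+ j) (v n x)).
  by apply: bmZ; exact: bm_tent.
rewrite E_D; [|exact: bm_cst|by apply: bm_sum => j; exact: b].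
rewrite E_cst lerD2l E_sum //.
rewrite mulrC -(sum_ord_cst J 16); apply: ler_sum => j _.
rewrite E_Z; last exact: bm_tent.
rewrite Ev // (le_trans (ler_wpM2l _ (I_le (half2_gt0 j)))) ?exprn_ge0 //.
rewrite !exprS exprVn le_eqVlt; apply/orP; left; apply/eqP.
by field; rewrite expf_neq0.
Qed.

Lemma measurable_inv_sum k : measurable_fun setT (inv_sum k).
Proof.
rewrite /inv_sum; apply: measurable_sum => n.
by apply: (measurableT_comp (@measurable_inv R)); exact: mv.
Qed.

Lemma measurable_no_close_return (K : R) N0 :
  measurable [set x | forall N, (N0 <= N)%N -> 1 < K * u N x * inv_sum (N + 4) x].
Proof.
set A := [set x | _].
have -> : A = \bigcap_(N in [set N | (N0 <= N)%N])
    ((fun x => K * u N x * inv_sum (N + 4) x) @^-1` `]1, +oo[).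
  by apply/seteqP; split=> x hx N hN; have := hx N hN; rewrite /= in_itv /= andbT.
apply: bigcap_measurableType => N _.
rewrite -[_ @^-1` _]setTI; apply: measurable_funM => //; last exact: measurable_inv_sum.
by apply: measurable_funM => //; exact: measurable_cst.
Qed.

Let mB k c : measurable [set x | c < inv_sum k x].
Proof.
have -> : [set x | c < inv_sum k x] = inv_sum k @^-1` `]c, +oo[.
  by apply/seteqP; split=> x /=; rewrite in_itv /= andbT.
by rewrite -[_ @^-1` _]setTI; apply: measurable_inv_sum.
Qed.

(* On the complement of the rare event that some [v n] is below [2^-J], the
   inverses are dominated by [tents J]. *)
Lemma inv_sum_tail k c J : 0 < c ->
  E[\1_[set x | c < inv_sum k x]] <=
  k%:R * (8 * 2^-1 ^+ J) + c^-1 * (k%:R * (1 + 16 * J%:R)).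
Proof.
move=> c0; have b1 (n : 'I_k) : bm (fun x => 2 * tent (2 * 2^-1 ^+ J) (v n x)).
  by apply: bmZ; exact: bm_tent.
have b2 : bm (fun x => \sum_(n < k) 2 * tent (2 * 2^-1 ^+ J) (v n x)) by exact: bm_sum.
have b3 : bm (fun x => c^-1 * \sum_(n < k) tents J (v n x)).
  by apply: bmZ; apply: bm_sum => n; exact: bm_tents.
have b4 : bm (\1_[set x | c < inv_sum k x] : T -> R) by exact: bm_indic.
apply: (@le_trans _ _ (\int[P]_x (\sum_(n < k) 2 * tent (2 * 2^-1 ^+ J) (v n x) +
    c^-1 * \sum_(n < k) tents J (v n x)))).
  apply: E_le => //; first exact: bmD.
  move=> x; have s1 : 0 <= \sum_(n < k) 2 * tent (2 * 2^-1 ^+ J) (v n x).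
    by apply: sumr_ge0 => n _; rewrite mulr_ge0 // tent_ge0.
  have t0 (n : 'I_k) : (Num.max (v n x) (2^-1 ^+ J))^-1 <= tents J (v n x) by exact: inv_le_tents.
  have s2 : 0 <= \sum_(n < k) tents J (v n x).
    by apply: sumr_ge0 => n _; apply: le_trans (t0 n); rewrite invr_ge0 le_max v0.
  have s3 : 0 <= c^-1 * \sum_(n < k) tents J (v n x) by rewrite mulr_ge0 // invr_ge0 ltW.
  rewrite indicE; case: (boolP (x \in _)); last by rewrite addr_ge0.
  rewrite inE /= => hx.
  have [[n hn]|h] := pselect (exists n : 'I_k, v n x <= 2^-1 ^+ J).
    have : 1 <= \sum_(n < k) 2 * tent (2 * 2^-1 ^+ J) (v n x).
      rewrite (bigD1 n) //=; apply: (@le_trans _ _ (2 * tent (2 * 2^-1 ^+ J) (v n x))).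
        have := @tent_half R (2 * 2^-1 ^+ J) (v n x) (half2_gt0 J) _.
        rewrite ger0_norm // mulrAC mulfV ?gt_eqF // mul1r => /(_ hn); lra.
      by rewrite lerDl sumr_ge0 // => m _; rewrite mulr_ge0 // tent_ge0.
    by move=> h1; rewrite (le_trans h1) // lerDl.
  apply: (@le_trans _ _ (c^-1 * \sum_(n < k) tents J (v n x))); last by rewrite lerDr.
  rewrite mulrC ler_pdivlMr // mul1r (le_trans (ltW hx)) //.
  apply: ler_sum => n _; apply: le_trans (t0 n).
  rewrite max_l // leNgt; apply/negP => hn; apply: h; exists n; exact: ltW.
rewrite (E_D P b2 b3) E_Z; last by apply: bm_sum => n; exact: bm_tents.
apply: lerD.
  rewrite E_sum // -(sum_ord_cst k (8 * 2^-1 ^+ J)); apply: ler_sum => n _.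
  rewrite E_Z; last exact: bm_tent.
  by rewrite Ev //; have := I_le (half2_gt0 J); lra.
rewrite ler_wpM2l ?invr_ge0 ?(ltW c0) // E_sum; last by move=> n; exact: bm_tents.
rewrite -(sum_ord_cst k (1 + 16 * J%:R)); apply: ler_sum => n _.
exact: E_tents.
Qed.

(* the factor is chosen so that [1 + 16 (k + 5 + l) <= (97 + 16 l) k] *)
Let bound l : R := 4 * (97 + 16 * l%:R) * 2 ^+ l.

Let bound_gt0 l : 0 < bound l.
Proof.
have l0 := ler0n R l; apply: mulr_gt0; last exact: exprn_gt0.
by apply: mulr_gt0 => //; lra.
Qed.

(** The [N log N] bound for [N = 2^(k+2)]. The exceptional probability is small in [l] uniformly in
    [k], so that one [eta] serves all scales in the second moment argument. *)
Lemma inv_sum_rarely_large l k : (0 < k)%N ->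
  E[\1_[set x | bound l * k%:R * 2 ^+ k < inv_sum (2 ^ k.+2) x]] <= 2 * 2^-1 ^+ l.
Proof.
move=> k0; have k1 : 1 <= k%:R :> R by rewrite ler1n.
have kp : 0 < k%:R :> R by rewrite ltr0n.
have c0 : 0 < bound l * k%:R * 2 ^+ k by rewrite !mulr_gt0 ?bound_gt0 ?exprn_gt0.
(* At this truncation level the bound for the event that some term is smaller equals [2^-l]; the
   mean of the tents costs at most as much. *)
apply: (le_trans (inv_sum_tail (2 ^ k.+2) (k + 5 + l) c0)).
have e1 : (2 ^ k.+2)%:R = 4 * 2 ^+ k :> R by rewrite natrX !exprS; ring.
have t2 j : 2 ^+ j != 0 :> R by rewrite expf_neq0.
have l0 := ler0n R l.
rewrite e1 !exprD !exprVn; apply: (@le_trans _ _ ((2 ^+ l)^-1 + (2 ^+ l)^-1)); last by rewrite mulr2n mulrDl !mul1r.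
apply: lerD.
  rewrite le_eqVlt; apply/orP; left; apply/eqP.
  have -> : 2 ^+ 5 = 32 :> R by rewrite !exprS expr0; ring.
  by field; rewrite !t2.
rewrite !natrD /bound.
have -> : (4 * (97 + 16 * l%:R) * 2 ^+ l * k%:R * 2 ^+ k)^-1 *
    (4 * 2 ^+ k * (1 + 16 * (k%:R + 5 + l%:R))) =
    (2 ^+ l)^-1 * ((1 + 16 * (k%:R + 5 + l%:R)) / ((97 + 16 * l%:R) * k%:R)) :> R.
  by field; rewrite !t2 !gt_eqF //; lra.
rewrite ler_piMr ?invr_ge0 ?exprn_ge0 // ler_pdivrMr; last by rewrite mulr_gt0 //; lra.
have : 0 <= (81 + 16 * l%:R) * (k%:R - 1) :> R by apply: mulr_ge0; lra.
lra.
Qed.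

(** Positive, constant on dyadic blocks, and such that [N < 2 ^ lvl N]. Thresholds depending on
    [lvl N] alone reduce the series over [N] to a harmonic one by condensation. *)
Let lvl N := (trunc_log 2 N).+1.

Let sum_lvl (F : nat -> R) n :
  \sum_(1 <= N < 2 ^ n) F (trunc_log 2 N) = \sum_(j < n) 2 ^+ j * F j.
Proof.
elim: n => [|n IH]; first by rewrite expn0 big_geq // big_ord0.
rewrite (@big_cat_nat _ _ _ (2 ^ n)) ?expn_gt0 ?leq_exp2l //= IH big_ord_recr /=.
congr (_ + _); rewrite (eq_big_nat _ _ (F2 := fun=> F n)).
  by rewrite sumr_const_nat expnS mul2n -addnn addnK -[LHS]mulr_natl natrX.
by move=> N hN; rewrite (trunc_log_eq (isT : (1 < 2)%N) hN).
Qed.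

(** [second_moment] is applied to the tents of half-width [th N] at [u N] and to their restrictions
    to the event [B N] that the inverse sum is too large. On [A] and off [B N], [u N] exceeds
    [th N], so that both vanish. The sum of the means diverges while [B N] has probability at most
    [2 * 2^-l], which makes [P A] arbitrarily small. *)
Lemma close_returns_null (K : R) N0 :
  P [set x | forall N, (N0 <= N)%N -> 1 < K * u N x * inv_sum (N + 4) x] = 0%E.
Proof.
set A := [set x | _].
have mA : measurable A by exact: measurable_no_close_return.
suff : fine (P A) = 0.
  by move=> h; rewrite -[LHS]fineK ?h // fin_num_measure.
apply/eqP; rewrite eq_le fine_ge0 // andbT; apply/ler_addgt0Pl => e e0; rewrite addr0.
pose K' := Num.max K 1.
have K1 : 1 <= K' by rewrite le_max lexx orbT.
have K'0 : 0 < K' by lra.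
have [l hl] : exists l, 2 * (2 * 2^-1 ^+ l) <= e / 2 :> R.
  have e8 : 0 < e / 8 by rewrite divr_gt0.
  have := @cvg_expr R 2^-1; rewrite ger0_norm // => /(_ ltac:(lra)).
  move=> /cvgrPdist_le /(_ _ e8) [l _ /(_ l (leqnn l))] /=.
  by rewrite sub0r normrN ger0_norm ?exprn_ge0 // => h; exists l; lra.
pose c k := bound l * k%:R * 2 ^+ k.
have c0 k : (0 < k)%N -> 0 < c k by move=> k0; rewrite !mulr_gt0 ?bound_gt0 ?exprn_gt0 ?ltr0n.
have c2 k : (0 < k)%N -> 2 <= c k.
  move=> k0; have h1 : 2 <= bound l.
    rewrite /bound; apply: (@le_trans _ _ (4 * (97 + 16 * l%:R))).
      by have := ler0n R l; lra.
    rewrite ler_peMr ?exprn_ege1 ?ler1n // ; by have := ler0n R l; lra.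
  rewrite /c -mulrA (le_trans h1) // ler_peMr ?(ltW (bound_gt0 l)) //.
  by rewrite mulr_ege1 ?ler1n ?exprn_ege1 ?ler1n.
(* The value of [u N] at which [K' * u N * c (lvl N)] equals 1, the limiting case of a close
   return. *)
pose th N := (K' * c (lvl N))^-1.
have th0 N : 0 < th N by rewrite invr_gt0 mulr_gt0 // c0.
have th2 N : th N <= 2^-1.
  rewrite lef_pV2 ?posrE ?mulr_gt0 ?c0 //; have := c2 (lvl N) isT; nra.
have [n hn] : exists n, 8 / e < \sum_(N <- index_iota N0 (2 ^ n)) I (th N).
  (* The dyadic block [j] contributes [1 / (b * (j + 1))]. Below, the factor 4 answers the one in
     [I_ge], and [N0] the omitted terms, each at most 1. *)
  pose b := 2 * K' * bound l; have b0 : 0 < b by rewrite !mulr_gt0 ?bound_gt0.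
  have [n hn] := harmonic_unbounded (b * (4 * (8 / e + 1) + N0%:R)).
  exists n; apply: (@lt_le_trans _ _ (\sum_(N <- index_iota N0 (2 ^ n)) th N / 4)); last first.
    by apply: ler_sum => N _; apply: I_ge; rewrite th0 th2.
  rewrite -mulr_suml ltr_pdivlMr //.
  have h1 : \sum_(1 <= N < 2 ^ n) th N = b^-1 * \sum_(i < n) i.+1%:R^-1.
    rewrite (sum_lvl (fun j => (K' * c j.+1)^-1)) mulr_sumr; apply: eq_bigr => j _.
    rewrite /c /b exprS; field.
    by rewrite !gt_eqF ?bound_gt0 ?exprn_gt0 ?ltr0n // addrC natr1 ltr0n.
  have h2 : \sum_(1 <= N < 2 ^ n) th N <= \sum_(N0 <= N < 2 ^ n) th N + N0%:R.
    have ge0 i j : 0 <= \sum_(i <= N < j) th N by apply: sumr_ge0 => N _; exact: ltW.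
    have s0 : \sum_(0 <= N < N0) th N <= N0%:R.
      rewrite big_mkord -[leRHS]mulr1 -(sum_ord_cst N0 1); apply: ler_sum => N _.
      by have := th2 N; lra.
    apply: (@le_trans _ _ (\sum_(0 <= N < 2 ^ n) th N)).
      by rewrite [leRHS]big_ltn ?expn_gt0 // lerDr ltW.
    have [h|h] := leqP N0 (2 ^ n).
      by rewrite (@big_cat_nat _ _ _ N0 0 (2 ^ n)) //= addrC lerD2l.
    apply: (@le_trans _ _ N0%:R); last by rewrite lerDr.
    apply: le_trans s0; rewrite (@big_cat_nat _ _ _ (2 ^ n) 0 N0) //=; last exact: ltnW.
    by rewrite lerDl.
  have h3 : 4 * (8 / e + 1) + N0%:R <= \sum_(1 <= N < 2 ^ n) th N.
    by rewrite h1 (mulrC b^-1) ler_pdivlMr // (mulrC _ b).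
  lra.
have M0 : 0 < \sum_(N <- index_iota N0 (2 ^ n)) I (th N) by rewrite (lt_trans _ hn) // divr_gt0.
pose B N := [set x | c (lvl N) < inv_sum (2 ^ (lvl N).+2) x].
have bT N : bm (fun x => tent (th N) (u N x)) by exact: bm_tent.
have bB N : bm (\1_(B N) : T -> R) by apply: bm_indic; exact: mB.
apply: (le_trans (@second_moment _ T R P nat (index_iota N0 (2 ^ n))
  (fun N x => tent (th N) (u N x)) (fun N x => tent (th N) (u N x) * \1_(B N) x)
  (fun N => I (th N)) A (2 * 2^-1 ^+ l) (iota_uniq _ _) mA bT _ _ _ _ _ _ _ M0)).
- by move=> N; exact: bmM.
- by move=> N x; rewrite tent_ge0 tent_le1.
- move=> N x; rewrite mulr_ge0 ?tent_ge0 // indicE; by case: (_ \in _).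
- by move=> N; exact: Eu.
- by move=> N M NM; exact: Euu.
- move=> N _; rewrite Euv // mulrC ler_wpM2r //.
    by apply: (le_trans _ (I_ge _)); rewrite ?divr_ge0 ?(ltW (th0 N)) // th0 th2.
  exact: inv_sum_rarely_large.
- move=> x Ax N; rewrite mem_index_iota => /andP[N0N _].
  rewrite indicE; case: (boolP (x \in B N)); first by rewrite mulr1.
  rewrite notin_setE /B /= => /negP; rewrite -leNgt => hB; rewrite mulr0.
  apply/eqP; rewrite eq_le tent_ge0 andbT leNgt; apply/negP => /(tent_gt0 (th0 N)).
  rewrite ger0_norm // => uth.
  have := Ax N N0N; apply/negP; rewrite -leNgt.
  have S1 : inv_sum (N + 4) x <= c (lvl N).
    apply: le_trans hB; rewrite /inv_sum -!(big_mkord xpredT (fun n => (v n x)^-1)).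
    have Nle : (N + 4 <= 2 ^ (lvl N).+2)%N.
      have := trunc_log_ltn N (isT : (1 < 2)%N); rewrite -/(lvl N) !expnS.
      by have := expn_gt0 2 (lvl N); lia.
    rewrite [leRHS](@big_cat_nat _ _ _ (N + 4)) //= lerDl.
    by apply: sumr_ge0 => i _; rewrite invr_ge0.
  have S0 : 0 <= inv_sum (N + 4) x by apply: sumr_ge0 => i _; rewrite invr_ge0.
  apply: (@le_trans _ _ (K' * th N * c (lvl N))); last first.
    by rewrite /th mulrAC mulfV // gt_eqF // mulr_gt0 // c0.
  apply: (@le_trans _ _ (K' * u N x * inv_sum (N + 4) x)).
    by rewrite ler_wpM2r // ler_wpM2r // le_max lexx.
  apply: ler_pM => //; first by rewrite mulr_ge0 // ltW.
  by rewrite ler_wpM2l // ltW.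
have : 4 / (\sum_(N <- index_iota N0 (2 ^ n)) I (th N)) <= e / 2.
  rewrite ler_pdivrMr //; move: hn; rewrite ltr_pdivrMr // => hn; lra.
lra.
Qed.

End close_returns.

(** * Distribution of the heights *)

Section circle_law.
Variable R : realType.
Notation leb := (@lebesgue_measure R).
Implicit Types (g h : R -> R) (k : int) (b : R).

Lemma circle_integral h : continuous h -> (forall y, 0 <= h y) ->
  (\int[@circle_lebesgue R]_c (h (circle_rep c))%:E = (\int[leb]_(x in `[0, 1]) h x)%:E)%E.
Proof.
move=> ch h0; have mh : measurable_fun setT h by exact: continuous_measurable_fun.
rewrite ge0_integral_distribution; last 2 first.
- by apply/measurable_EFinP; exact: (measurableT_comp mh (@measurable_circle_rep R)).
- by move=> c; rewrite lee_fin.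
have mD := measurable_itv `[0%R : R, 1%R[.
have mF : measurable_fun [set: measurableTypeR R]
    ((fun c => (h (circle_rep c))%:E) \o @to_circle R).
  apply/measurable_EFinP; apply: (measurableT_comp mh).
  exact: (measurableT_comp (@measurable_circle_rep R) (@measurable_to_circle R)).
have D0 : lebesgue01 (~` `[0%R : R, 1%R[) = 0%E.
  by rewrite /lebesgue01 /mrestr setICl measure0.
rewrite (@ge0_negligible_integral _ (measurableTypeR R) R (@lebesgue01 R) setT _ _
  (measurableC mD) measurableT mF _ D0); last by move=> x _; rewrite lee_fin.
rewrite setTD setCK (@eq_measure_integral _ _ _ _ leb); last first.
  by move=> A mA AD; rewrite /= /lebesgue01 /mrestr (setIidl AD).
transitivity (\int[leb]_(x in `[0%R, 1%R[) (h x)%:E)%E.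
  by apply: eq_integral => x; rewrite inE /= in_itv /= => x01; rewrite circle_rep_id.
rewrite integral_itv_bndo_bndc; last first.
  by apply/measurable_EFinP; apply: measurable_funTS.
by rewrite /Rintegral fineK // integrable_fin_num //; exact: continuous_integrable.
Qed.

Definition mean g := \int[leb]_(x in `[0, 1]) g x.

(** Nonzero integer multiples of a uniform point are uniform; [k] will be [1] or [- 1] for heights,
    a difference of indices for correlations, an index for the multiples of the slope. *)
Lemma circle_mean g k b : continuous g -> (forall y, g (y + 1) = g y) ->
  (forall y, 0 <= g y) -> k != 0 ->
  (\int[@circle_lebesgue R]_c (g (k%:~R * circle_rep c + b))%:E = (mean g)%:E)%E.
Proof.
move=> cg g1 g0 k0; rewrite /mean -(Rintegral_periodic cg g1 b k0).
rewrite -(@circle_integral (fun y => g (k%:~R * y + b))) // => y.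
apply: continuous_comp; last exact: cg.
by apply: cvgD; [apply: cvgM; [exact: cvg_cst|exact: cvg_id]|exact: cvg_cst].
Qed.

End circle_law.

Section parameters.
Variable R : realType.
Notation circ := (@circle_lebesgue R).
Notation tor := (@torus_lebesgue R).
Notation par := (@param_lebesgue R).
Implicit Types (g h : R -> R) (k : int) (al b : R) (n m : nat).

Lemma measurable_off d (T : measurableType d) (al : T -> R) (c z : T -> torus R) n :
  measurable_fun setT al -> measurable_fun setT c -> measurable_fun setT z ->
  measurable_fun setT (fun t => off (al t) (torus_rep (c t)) (torus_rep (z t)) n).
Proof.
move=> mal mc mz.
have m1 (f : T -> torus R) : measurable_fun setT f ->
    measurable_fun setT (fun t => circle_rep (f t).1).
  move=> mf; apply: (measurableT_comp (@measurable_circle_rep R)).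
  exact: (measurableT_comp measurable_fst mf).
have m2 (f : T -> torus R) : measurable_fun setT f ->
    measurable_fun setT (fun t => circle_rep (f t).2).
  move=> mf; apply: (measurableT_comp (@measurable_circle_rep R)).
  exact: (measurableT_comp measurable_snd mf).
rewrite /off /col /=; apply: measurable_funD.
  by apply: measurable_funB; [exact: m2|exact: m2].
apply: measurable_funM => //; apply: measurable_funD; last exact: measurable_cst.
apply: measurable_funB; last exact: measurable_cst.
by apply: measurable_funB; [exact: m1|exact: m1].
Qed.

(** Nonnegativity gives access to Tonelli's theorem and periodicity to [circle_mean]; the class is
    stable under the shifted products of [waveM]. *)
Record wave g : Prop := Wave {
  wave_continuous : continuous g ;
  wave_periodic : forall y, g (y + 1) = g y ;
  wave_ge0 : forall y, 0 <= g y }.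

Lemma wave_measurable g : wave g -> measurable_fun setT g.
Proof. by case=> cg _ _; exact: continuous_measurable_fun. Qed.

Lemma waveM g h b : wave g -> wave h -> wave (fun y => g y * h (y + b)).
Proof.
move=> [cg g1 g0] [ch h1 h0]; split=> [y|y|y].
- apply: cvgM; first exact: cg.
  by apply: (@continuous_comp _ _ _ (fun y => y + b)); [apply: cvgD; [exact: cvg_id|exact: cvg_cst]|exact: ch].
- by rewrite g1 addrAC h1.
- by rewrite mulr_ge0.
Qed.

Lemma measurable_wave_comp d (T : measurableType d) g (X : T -> R) : wave g ->
  measurable_fun setT X -> measurable_fun setT (fun t => (g (X t))%:E).
Proof.
by move=> hg mX; apply/measurable_EFinP; apply: (measurableT_comp (wave_measurable hg)).
Qed.

(** At fixed slope and abscissa of [p], the height is a constant minus the ordinate of [p], hence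
    uniform modulo 1: the inner integral is already the mean. *)
Lemma torus_mean g al (z : torus R) n : wave g ->
  (\int[tor]_p (g (off al (torus_rep p) (torus_rep z) n))%:E = (mean g)%:E)%E.
Proof.
move=> hg; have mg : measurable_fun setT
    (fun p : torus R => (g (off al (torus_rep p) (torus_rep z) n))%:E).
  apply: measurable_wave_comp => //.
  by apply: measurable_off; [exact: measurable_cst|exact: measurable_id|exact: measurable_cst].
rewrite /torus_lebesgue fubini_tonelli1 //; last by move=> p; rewrite lee_fin wave_ge0.
rewrite (eq_integral (fun=> (mean g)%:E)); last first.
  move=> a _; rewrite /fubini_F /= /off /col /=.
  rewrite -(@circle_mean R g (-1)
    (circle_rep z.2 + al * (circle_rep a - circle_rep z.1 - 1 + n%:R))) //; try by case: hg.
  by apply: eq_integral => c _; congr (g _)%:E; rewrite mulN1r; ring.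
rewrite integral_cst //= [X in (_ * X)%E](_ : _ = 1%E) ?mule1 //.
exact: probability_setT.
Qed.

(** For independent uniform [a] and [c], the points [c] and [c + k * a] are independent: integrating
    over [a] first, at fixed [c], factors the product. *)
Lemma circle_correlation g h k : wave g -> wave h -> k != 0 ->
  (\int[circ]_a \int[circ]_c (g (circle_rep c) * h (circle_rep c + k%:~R * circle_rep a))%:E
   = (mean g * mean h)%:E)%E.
Proof.
move=> hg hh k0.
have mF : measurable_fun setT (fun t : circle R * circle R =>
    (g (circle_rep t.2) * h (circle_rep t.2 + k%:~R * circle_rep t.1))%:E).
  have m2 : measurable_fun setT (fun t : circle R * circle R => circle_rep t.2).
    exact: (measurableT_comp (@measurable_circle_rep R) measurable_snd).
  have m1 : measurable_fun setT (fun t : circle R * circle R => circle_rep t.1).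
    exact: (measurableT_comp (@measurable_circle_rep R) measurable_fst).
  apply/measurable_EFinP; apply: measurable_funM.
    exact: (measurableT_comp (wave_measurable hg)).
  apply: (measurableT_comp (wave_measurable hh)); apply: measurable_funD => //.
  by apply: measurable_funM => //; exact: measurable_cst.
rewrite (fubini_tonelli _ mF); last by move=> t; rewrite lee_fin mulr_ge0 ?wave_ge0.
under eq_integral => c _.
  rewrite /=; under eq_integral do rewrite EFinM addrC.
  rewrite ge0_integralZl //; first (rewrite circle_mean //; try by case: hh); last 3 first.
  - apply: measurable_wave_comp => //; apply: measurable_funD; last exact: measurable_cst.
    apply: measurable_funM; [exact: measurable_cst|exact: measurable_circle_rep].
  - by move=> a _; rewrite lee_fin wave_ge0.
  - by rewrite lee_fin wave_ge0.
  over.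
rewrite ge0_integralZr //; last 3 first.
- by apply: measurable_wave_comp => //; exact: measurable_circle_rep.
- by move=> a _; rewrite lee_fin wave_ge0.
- by rewrite lee_fin; apply: Rintegral_ge0 => x _; rewrite wave_ge0.
have := @circle_mean R g 1 0; rewrite /= => E.
under eq_integral do rewrite -[circle_rep _]mul1r -[1 * _]addr0.
by rewrite E // -?EFinM //; case: hg.
Qed.

End parameters.

Section parameter_space.
Variable R : realType.
Notation circ := (@circle_lebesgue R).
Notation tor := (@torus_lebesgue R).
Notation par := (@param_lebesgue R).
Notation Omega := (circle R * torus R * torus R)%type.
Implicit Types (g h : R -> R) (n m : nat) (w : Omega) (F : Omega -> \bar R).

Lemma par_integral_fst F : measurable_fun setT F -> (forall w, (0 <= F w)%E) ->
  (\int[par]_w F w = \int[circ \x tor]_x \int[tor]_q F (x, q))%E.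
Proof. by move=> mF F0; rewrite /param_lebesgue fubini_tonelli1. Qed.

Lemma par_integral_q F : measurable_fun setT F -> (forall w, (0 <= F w)%E) ->
  (\int[par]_w F w = \int[circ]_a \int[tor]_p \int[tor]_q F (a, p, q))%E.
Proof.
move=> mF F0; rewrite par_integral_fst // fubini_tonelli1 //.
  exact: measurable_fun_fubini_tonelli_F.
by move=> x; apply: integral_ge0.
Qed.

Lemma par_integral_p F : measurable_fun setT F -> (forall w, (0 <= F w)%E) ->
  (\int[par]_w F w = \int[tor]_q \int[circ]_a \int[tor]_p F (a, p, q))%E.
Proof.
move=> mF F0; rewrite /param_lebesgue fubini_tonelli2 //.
apply: eq_integral => q _; rewrite /fubini_G fubini_tonelli1 //.
exact: (measurableT_comp mF (measurable_pair2 q)).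
Qed.

Variable z : torus R.
Definition height_p n w := off (circle_rep w.1.1) (torus_rep w.1.2) (torus_rep z) n.
Definition height_q n w := off (circle_rep w.1.1) (torus_rep w.2) (torus_rep z) n.

Let m11 : measurable_fun [set: Omega] (fun w => w.1.1).
Proof. exact: (measurableT_comp measurable_fst measurable_fst). Qed.

Let m12 : measurable_fun [set: Omega] (fun w => w.1.2).
Proof. exact: (measurableT_comp measurable_snd measurable_fst). Qed.

Let ma : measurable_fun [set: Omega] (fun w => circle_rep w.1.1).
Proof. exact: (measurableT_comp (@measurable_circle_rep R) m11). Qed.

Lemma measurable_height_p n : measurable_fun setT (height_p n).
Proof. by apply: measurable_off => //; exact: measurable_cst. Qed.

Lemma measurable_height_q n : measurable_fun setT (height_q n).
Proof. by apply: measurable_off => //; exact: measurable_cst. Qed.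

Let int_cst (c : \bar R) : (\int[tor]_p c = c)%E.
Proof.
rewrite integral_cst //= [X in (_ * X)%E](_ : _ = 1%E) ?mule1 //.
exact: probability_setT.
Qed.

(** The height over [p] is uniform as soon as [p] is averaged, with the slope and [q] frozen. It is
    thus independent of any function of these two, such as a sum of inverse heights over [q]. *)
Lemma par_mean_p g n (f : circle R * torus R -> R) : wave g -> measurable_fun setT f ->
  (forall x, 0 <= f x) ->
  (\int[par]_w (g (height_p n w) * f (w.1.1, w.2))%:E =
   (mean g)%:E * \int[par]_w (f (w.1.1, w.2))%:E)%E.
Proof.
move=> hg mf f0.
have m13 : measurable_fun [set: Omega] (fun w => (w.1.1, w.2)).
  by apply: measurable_fun_pair; [exact: m11|exact: measurable_snd].
have mg0 : 0 <= mean g by apply: Rintegral_ge0 => x _; rewrite wave_ge0.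
have mE : measurable_fun setT (fun x => (f x)%:E) by exact/measurable_EFinP.
rewrite par_integral_p; last 2 first.
- apply/measurable_EFinP; apply: measurable_funM; last exact: (measurableT_comp mf m13).
  exact: (measurableT_comp (wave_measurable hg) (measurable_height_p n)).
- by move=> w; rewrite lee_fin mulr_ge0 ?wave_ge0.
rewrite par_integral_p; last 2 first.
- exact: (measurableT_comp mE m13).
- by move=> w; rewrite lee_fin.
rewrite -ge0_integralZl //; last 2 first.
- have := @measurable_fun_fubini_tonelli_G _ _ _ _ R circ (fun x => (f x)%:E) mE.
  move=> /(_ (fun _ => f0 _)); apply: eq_measurable_fun => q _.
  by apply: eq_integral => a _; exact: (esym (int_cst _)).
- by move=> q _; apply: integral_ge0 => a _; apply: integral_ge0 => p _; rewrite lee_fin.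
apply: eq_integral => q _.
rewrite -ge0_integralZl //; last 2 first.
- apply: (eq_measurable_fun (fun a => (f (a, q))%:E)) => [a _|]; first exact: (esym (int_cst _)).
  exact: (measurableT_comp mE (measurable_pair2 q)).
- by move=> a _; apply: integral_ge0 => p _; rewrite lee_fin.
apply: eq_integral => a _; rewrite /= int_cst -(torus_mean (circle_rep a) z n hg).
rewrite -ge0_integralZr //.
- apply: measurable_wave_comp => //.
  by apply: measurable_off; [exact: measurable_cst|exact: measurable_id|exact: measurable_cst].
- by move=> p _; rewrite lee_fin wave_ge0.
- by rewrite lee_fin.
Qed.

Lemma par_mean_q g n (f : circle R * torus R -> R) : wave g -> measurable_fun setT f ->
  (forall x, 0 <= f x) ->
  (\int[par]_w (g (height_q n w) * f w.1)%:E =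
   (mean g)%:E * \int[par]_w (f w.1)%:E)%E.
Proof.
move=> hg mf f0.
have mg0 : 0 <= mean g by apply: Rintegral_ge0 => x _; rewrite wave_ge0.
have mE : measurable_fun setT (fun x => (f x)%:E) by exact/measurable_EFinP.
rewrite par_integral_fst; last 2 first.
- apply/measurable_EFinP; apply: measurable_funM; last exact: (measurableT_comp mf measurable_fst).
  exact: (measurableT_comp (wave_measurable hg) (measurable_height_q n)).
- by move=> w; rewrite lee_fin mulr_ge0 ?wave_ge0.
rewrite par_integral_fst; last 2 first.
- exact: (measurableT_comp mE measurable_fst).
- by move=> w; rewrite lee_fin.
rewrite -ge0_integralZl //; last 2 first.
- apply: (eq_measurable_fun (fun x => (f x)%:E)) => // x _.
  exact: (esym (int_cst _)).
- by move=> x _; apply: integral_ge0 => q _; rewrite lee_fin.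
apply: eq_integral => x _; rewrite /= int_cst -(torus_mean (circle_rep x.1) z n hg).
rewrite -ge0_integralZr //.
- apply: measurable_wave_comp => //.
  by apply: measurable_off; [exact: measurable_cst|exact: measurable_id|exact: measurable_cst].
- by move=> p _; rewrite lee_fin wave_ge0.
- by rewrite lee_fin.
Qed.

(** The heights [n] and [m] differ by [m - n] times the slope. As a function of the uniform height
    [n] the product is a single wave, and averaging over the slope then separates the factors. *)
Let corr g h n m : wave g -> wave h -> n != m ->
  (\int[circ]_a \int[tor]_p (g (off (circle_rep a) (torus_rep p) (torus_rep z) n) *
    h (off (circle_rep a) (torus_rep p) (torus_rep z) m))%:E = (mean g * mean h)%:E)%E.
Proof.
move=> hg hh nm; have k0 : m%:Z - n%:Z != 0 by rewrite subr_eq0 eqz_nat eq_sym.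
rewrite -(circle_correlation hg hh k0); apply: eq_integral => a _.
have hw := waveM ((m%:Z - n%:Z)%:~R * circle_rep a) hg hh.
have := @circle_mean R _ 1 0 (wave_continuous hw) (wave_periodic hw) (wave_ge0 hw) isT.
rewrite -(torus_mean (circle_rep a) z n hw).
under eq_integral do rewrite mul1r addr0.
move=> ->; apply: eq_integral => p _; congr (_ * h _)%:E.
by rewrite /off /col intrB; ring.
Qed.

Lemma par_correlation_p g h n m : wave g -> wave h -> n != m ->
  (\int[par]_w (g (height_p n w) * h (height_p m w))%:E = (mean g * mean h)%:E)%E.
Proof.
move=> hg hh nm; rewrite par_integral_p; last 2 first.
- apply/measurable_EFinP; apply: measurable_funM.
    exact: (measurableT_comp (wave_measurable hg) (measurable_height_p n)).
  exact: (measurableT_comp (wave_measurable hh) (measurable_height_p m)).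
- by move=> w; rewrite lee_fin mulr_ge0 ?wave_ge0.
by under eq_integral do rewrite corr //; exact: int_cst.
Qed.

Lemma par_correlation_q g h n m : wave g -> wave h -> n != m ->
  (\int[par]_w (g (height_q n w) * h (height_q m w))%:E = (mean g * mean h)%:E)%E.
Proof.
move=> hg hh nm; rewrite par_integral_q; last 2 first.
- apply/measurable_EFinP; apply: measurable_funM.
    exact: (measurableT_comp (wave_measurable hg) (measurable_height_q n)).
  exact: (measurableT_comp (wave_measurable hh) (measurable_height_q m)).
- by move=> w; rewrite lee_fin mulr_ge0 ?wave_ge0.
by rewrite /height_q; under eq_integral do rewrite /= int_cst; exact: corr.
Qed.

Lemma par_rotation g n : wave g -> (0 < n)%N ->
  (\int[par]_w (g (n%:R * circle_rep w.1.1))%:E = (mean g)%:E)%E.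
Proof.
move=> hg n0; rewrite par_integral_q; last 2 first.
- apply: measurable_wave_comp => //; apply: measurable_funM => //; exact: measurable_cst.
- by move=> w; rewrite lee_fin wave_ge0.
under eq_integral do rewrite /= !int_cst.
have := @circle_mean R g n 0; rewrite eqz_nat -lt0n n0 => <- //; try by case: hg.
by apply: eq_integral => a _; rewrite addr0.
Qed.

End parameter_space.

Section tent_mean.
Variable R : realType.
Notation leb := (@lebesgue_measure R).
Implicit Types th y : R.

Lemma wave_tent th : wave (fun y => tent th (nrm y)).
Proof.
split=> [y|y|y]; last exact: tent_ge0; last by rewrite -[1]/(1%:R) nrmDnat.
by apply: continuous_comp; [exact: nrm_continuous|exact: continuous_tent].
Qed.

Let EFin_mean th :
  ((mean (fun y => tent th (nrm y)))%:E = \int[leb]_(y in `[0%R, 1%R]) (tent th (nrm y))%:E)%E.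
Proof.
rewrite /mean /Rintegral fineK // integrable_fin_num //; apply: continuous_integrable.
exact: wave_continuous (wave_tent th).
Qed.

Let measurable_tent th : measurable_fun setT (fun y => (tent th (nrm y))%:E).
Proof. by apply/measurable_EFinP; exact: wave_measurable (wave_tent th). Qed.

Lemma tent_mean_ge th : 0 < th <= 2^-1 -> th / 4 <= mean (fun y => tent th (nrm y)).
Proof.
move=> /andP[th0 th2]; rewrite -lee_fin EFin_mean.
apply: (@le_trans _ _ (\int[leb]_(y in `[0%R, (th / 2)%R]) (2^-1)%:E)%E).
  rewrite integral_cst //= lebesgue_measure_itv /= lte_fin divr_gt0 //.
  by rewrite oppr0 adde0 -EFinM lee_fin; lra.
apply: (@le_trans _ _ (\int[leb]_(y in `[0%R, (th / 2)%R]) (tent th (nrm y))%:E)%E).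
  apply: ge0_le_integral => //.
  - by apply: measurable_funTS; exact: measurable_tent.
  - move=> y; rewrite /= in_itv /= => /andP[y0 y1]; rewrite lee_fin tent_half //.
    rewrite ger0_norm ?nrm_ge0 //; have := nrm_le y 0.
    by rewrite subr0 ger0_norm // => h; exact: le_trans y1.
apply: ge0_subset_integral => //.
- by apply: measurable_funTS; exact: measurable_tent.
- by move=> y _; rewrite lee_fin tent_ge0.
- by apply: subset_itvl; rewrite bnd_simp; lra.
Qed.

Lemma tent_mean_le th : 0 < th -> mean (fun y => tent th (nrm y)) <= 2 * th.
Proof.
move=> th0; rewrite -lee_fin EFin_mean.
pose A : set R := `[0, th]%classic; pose B : set R := `[1 - th, 1]%classic.
have mI (C : set R) : measurable C -> measurable_fun setT (fun y => (\1_C y)%:E : \bar R).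
  by move=> mC; apply/measurable_EFinP; exact: measurable_indic.
have mA := mI A (measurable_itv _); have mB := mI B (measurable_itv _).
apply: (@le_trans _ _ (\int[leb]_(y in `[0%R, 1%R]) ((\1_A y)%:E + (\1_B y)%:E))%E).
  apply: ge0_le_integral => //.
  - by move=> y _; rewrite lee_fin tent_ge0.
  - by apply: measurable_funTS; exact: measurable_tent.
  - by apply: emeasurable_funD; apply: measurable_funTS.
  - move=> y; rewrite /= in_itv /= => /andP[y0 y1]; rewrite -EFinD lee_fin !indicE.
    case: (boolP (y \in A)) => yA.
      by apply: (le_trans (tent_le1 _ th0)); rewrite lerDl.
    case: (boolP (y \in B)) => yB; first by rewrite add0r tent_le1.
    rewrite addr0 leNgt; apply/negP => /(tent_gt0 th0).
    rewrite ger0_norm ?nrm_ge0 //.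
    move: yA yB; rewrite !notin_setE /A /B /= !in_itv /= y0 y1 andbT /= => /negP yA /negP yB.
    rewrite -ltNge in yA; rewrite -ltNge in yB.
    rewrite /nrm; set k := Num.floor _; move=> h.
    have : `|y - k%:~R| < 1 /\ True by split => //; have := nrm_half y; rewrite /nrm -/k; lra.
    have k1 := floor_le (y + 2^-1); have k2 := floorD1_gt (y + 2^-1).
    rewrite -/k in k1 k2; rewrite intrD1 in k2; move=> _.
    have kl : (-1 < k < 2)%R.
      by rewrite -!(ltr_int R) intrN; lra.
    have [k0|k0] : k = 0 \/ k = 1 by lia.
      by move: h; rewrite k0 subr0 ger0_norm //; lra.
    by move: h; rewrite k0 distrC ger0_norm; lra.
rewrite ge0_integralD //; last 2 first.
- exact: measurable_funTS.
- exact: measurable_funTS.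
rewrite !integral_indic //; try exact: measurable_itv.
have -> : ((2 * th)%:E = th%:E + th%:E)%E by rewrite -EFinD; congr _%:E; ring.
have leA : (leb A <= th%:E)%E.
  by rewrite /A lebesgue_measure_itv /= lte_fin th0 oppr0 adde0.
have leB : (leb B <= th%:E)%E.
  rewrite /B lebesgue_measure_itv /= lte_fin; case: ifP => _.
    by rewrite -EFinB lee_fin; lra.
  by rewrite lee_fin ltW.
apply: leeD.
  by apply: le_trans leA; apply: le_measure; [rewrite inE; apply: measurableI; exact: measurable_itv|rewrite inE; exact: measurable_itv|exact: subIsetl].
by apply: le_trans leB; apply: le_measure; [rewrite inE; apply: measurableI; exact: measurable_itv|rewrite inE; exact: measurable_itv|exact: subIsetl].
Qed.

End tent_mean.

(** * Exceptional parameters *)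

Section exceptional_set.
Context d (T : measurableType d) (R : realType).
Implicit Types (w u v : nat -> T -> R) (P : probability T R).

(** Negation of the return inequality [K * \sum (v n)^-1 <= (u N)^-1] after clearing the inverse of
    [u N]. *)
Definition no_close_return u v (K : R) N0 : set T :=
  [set t | forall N, (N0 <= N)%N -> 1 < K * u N t * inv_sum v (N + 4) t].

(** All that is to be avoided, as a countable union: rational slopes, seen by [w], lines through a
    stopping point, and missing returns in either direction. Integers [K] are enough by
    monotonicity. *)
Definition exceptional w u v : set T :=
  \bigcup_n ([set t | w n t = 0] `|` [set t | u n t = 0] `|` [set t | v n t = 0]) `|`
  \bigcup_K \bigcup_N0 (no_close_return u v K%:R N0 `|` no_close_return v u K%:R N0).

Let measurable_zero (X : T -> R) : measurable_fun setT X -> measurable [set t | X t = 0].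
Proof.
by move=> mX; rewrite -[X in measurable X]setTI; apply: (mX measurableT [set 0]).
Qed.

Lemma measurable_exceptional w u v : (forall n, measurable_fun setT (w n)) ->
  (forall n, measurable_fun setT (u n)) -> (forall n, measurable_fun setT (v n)) ->
  measurable (exceptional w u v).
Proof.
move=> mw mu mv; apply: measurableU; apply: bigcupT_measurable => n.
  by apply: measurableU; [apply: measurableU|]; exact: measurable_zero.
apply: bigcupT_measurable => N0.
by apply: measurableU;
  [exact: (measurable_no_close_return mu mv n%:R N0)|exact: (measurable_no_close_return mv mu n%:R N0)].
Qed.

Lemma exceptional_null P w u v : (forall n, measurable_fun setT (w n)) ->
  (forall n, measurable_fun setT (u n)) -> (forall n, measurable_fun setT (v n)) ->
  (forall n, P [set t | w n t = 0] = 0%E) -> (forall n, P [set t | u n t = 0] = 0%E) ->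
  (forall n, P [set t | v n t = 0] = 0%E) ->
  (forall K N0, P (no_close_return u v K N0) = 0%E) ->
  (forall K N0, P (no_close_return v u K N0) = 0%E) ->
  P (exceptional w u v) = 0%E.
Proof.
move=> mw mu mv w0 u0 v0 uv0 vu0; apply: measure_negligible.
  exact: measurable_exceptional.
have neg A : P A = 0%E -> measurable A -> P.-negligible A by move=> A0 mA; exists A; split.
apply: negligibleU; apply: negligible_bigcup => n.
  apply: negligibleU; last by apply: (neg _ (v0 n)); exact: measurable_zero.
  apply: negligibleU; first by apply: (neg _ (w0 n)); exact: measurable_zero.
  by apply: (neg _ (u0 n)); exact: measurable_zero.
apply: negligible_bigcup => N0; apply: negligibleU.
  exact: neg (uv0 _ _) (measurable_no_close_return mu mv n%:R N0).
exact: neg (vu0 _ _) (measurable_no_close_return mv mu n%:R N0).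
Qed.

Lemma not_no_close_return u v t (K : R) N0 : (forall n, 0 < u n t) -> (forall n, 0 < v n t) ->
  (forall (k : nat) N0, ~ no_close_return u v k%:R N0 t) ->
  exists2 N, (N0 <= N)%N & K * \sum_(n < N + 4) (v n t)^-1 <= (u N t)^-1.
Proof.
move=> u0 v0 /(_ (Num.truncn `|K|).+1 N0)/existsNP[N /not_implyP[N0N /negP]].
rewrite -leNgt => h; exists N => //.
rewrite -[leRHS]mul1r ler_pdivlMr // mulrAC (le_trans _ h) //.
rewrite /inv_sum ler_wpM2r ?sumr_ge0 // => [n _|]; first by rewrite invr_ge0 ltW.
rewrite ler_wpM2r // ?ltW //; apply: (le_lt_trans (ler_norm K)); exact: truncnS_gt.
Qed.

Lemma zero_null P (X : T -> R) : measurable_fun setT X -> (forall t, 0 <= X t) ->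
  (forall th, 0 < th -> \int[P]_t tent th (X t) <= 2 * th) -> P [set t | X t = 0] = 0%E.
Proof.
move=> mX X0 EX; have mZ := measurable_zero mX.
suff : fine (P [set t | X t = 0]) = 0.
  by move=> h; rewrite -[LHS]fineK ?h // fin_num_measure.
apply/eqP; rewrite eq_le fine_ge0 // andbT; apply/ler_addgt0Pl => e e0; rewrite addr0.
have e2 : 0 < e / 2 by rewrite divr_gt0.
apply: (le_trans _ (_ : 2 * (e / 2) <= e)); last by lra.
apply: le_trans (EX _ e2); rewrite -E_indic //; apply: E_le.
- exact: bm_indic.
- apply: (@bm_continuous _ _ _ X (tent (e / 2)) 1 mX (@continuous_tent R _)) => y.
  by rewrite ger0_norm ?tent_ge0 // tent_le1.
move=> t; rewrite indicE; case: (boolP (t \in _)); last by rewrite tent_ge0.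
by rewrite inE /= => ->; rewrite /tent normr0 mul0r subr0 le_max lexx orbT.
Qed.

End exceptional_set.

Section exceptional_parameters.
Variable R : realType.
Notation par := (@param_lebesgue R).
Notation Omega := (circle R * torus R * torus R)%type.
Implicit Types (n m : nat) (w : Omega) (th : R).

Variable z : torus R.
Let w n (t : Omega) := nrm (n.+1%:R * circle_rep t.1.1).
Let u n (t : Omega) := nrm (height_p z n t).
Let v n (t : Omega) := nrm (height_q z n t).

Let mnrm (f : Omega -> R) : measurable_fun setT f -> measurable_fun setT (fun t => nrm (f t)).
Proof.
move=> mf; apply: (measurableT_comp _ mf).
exact: continuous_measurable_fun (@nrm_continuous R).
Qed.

Let mw n : measurable_fun setT (w n).
Proof.
apply: mnrm; apply: measurable_funM; first exact: measurable_cst.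
apply: (measurableT_comp (@measurable_circle_rep R)).
exact: (measurableT_comp measurable_fst measurable_fst).
Qed.

Let mu n : measurable_fun setT (u n). Proof. by apply: mnrm; exact: measurable_height_p. Qed.
Let mv n : measurable_fun setT (v n). Proof. by apply: mnrm; exact: measurable_height_q. Qed.

Let I th := mean (fun y => tent th (nrm y)).

Let fineM_int (X : Omega -> R) (c : R) : bm X ->
  fine (c%:E * \int[par]_t (X t)%:E) = c * \int[par]_t X t.
Proof. by move=> bX; rewrite fineM // integrable_fin_num //; exact: bm_integrable. Qed.

Let par1 : (\int[par]_t ((fun=> 1) t : R)%:E = 1)%E.
Proof.
rewrite integral_cst //= mul1e; exact: (probability_setT par).
Qed.

Let Eu n th : 0 < th -> \int[par]_t tent th (u n t) = I th.
Proof.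
move=> th0; rewrite /Rintegral.
transitivity (fine ((I th)%:E * \int[par]_t ((fun=> 1) t : R)%:E)); last by rewrite par1 mule1.
rewrite -(par_mean_p z n (wave_tent th) (measurable_cst (1 : R)) (fun=> ler01)).
by congr fine; apply: eq_integral => t _; rewrite /= mulr1.
Qed.

Let Ev n th : 0 < th -> \int[par]_t tent th (v n t) = I th.
Proof.
move=> th0; rewrite /Rintegral.
transitivity (fine ((I th)%:E * \int[par]_t ((fun=> 1) t : R)%:E)); last by rewrite par1 mule1.
rewrite -(par_mean_q z n (wave_tent th) (measurable_cst (1 : R)) (fun=> ler01)).
by congr fine; apply: eq_integral => t _; rewrite /= mulr1.
Qed.

Let Ew n th : 0 < th -> \int[par]_t tent th (w n t) = I th.
Proof. by move=> th0; exact: (congr1 fine (par_rotation (wave_tent th) (ltn0Sn n))). Qed.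

Let nrm_measurable (f : circle R * torus R -> R) : measurable_fun setT f ->
  measurable_fun setT (fun x => nrm (f x)).
Proof.
move=> mf; apply: (measurableT_comp _ mf).
exact: continuous_measurable_fun (@nrm_continuous R).
Qed.

Let s n (x : circle R * torus R) := nrm (off (circle_rep x.1) (torus_rep x.2) (torus_rep z) n).

Let ms n : measurable_fun setT (s n).
Proof.
apply: nrm_measurable; apply: measurable_off; [|exact: measurable_snd|exact: measurable_cst].
exact: (measurableT_comp (@measurable_circle_rep R) measurable_fst).
Qed.

Let f k (c : R) : circle R * torus R -> R := \1_[set x | c < inv_sum s k x].

Let mf k c : measurable [set x | c < inv_sum s k x].
Proof.
have -> : [set x | c < inv_sum s k x] = inv_sum s k @^-1` `]c, +oo[.
  by apply/seteqP; split=> x /=; rewrite in_itv /= andbT.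
by rewrite -[_ @^-1` _]setTI; apply: measurable_inv_sum.
Qed.

Let f0 k c x : 0 <= f k c x. Proof. by rewrite /f indicE. Qed.

Let Euv n th k c : 0 < th ->
  \int[par]_t (tent th (u n t) * \1_[set t | c < inv_sum v k t] t) =
  I th * \int[par]_t \1_[set t | c < inv_sum v k t] t.
Proof.
move=> th0.
have E := par_mean_p z n (wave_tent th) (measurable_indic (mf k c)) (f0 k c).
rewrite -fineM_int; last first.
  apply: bm_indic.
  have -> : [set t | c < inv_sum v k t] = (fun t : Omega => (t.1.1, t.2)) @^-1` [set x | c < inv_sum s k x] by [].
  rewrite -[_ @^-1` _]setTI.
  suff m : measurable_fun setT (fun t : Omega => (t.1.1, t.2)) by exact: m.
  apply: measurable_fun_pair; last exact: measurable_snd.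
  exact: (measurableT_comp measurable_fst measurable_fst).
exact: (congr1 fine E).
Qed.

Let Evu n th k c : 0 < th ->
  \int[par]_t (tent th (v n t) * \1_[set t | c < inv_sum u k t] t) =
  I th * \int[par]_t \1_[set t | c < inv_sum u k t] t.
Proof.
move=> th0.
have E := par_mean_q z n (wave_tent th) (measurable_indic (mf k c)) (f0 k c).
rewrite -fineM_int; last first.
  apply: bm_indic.
  have -> : [set t | c < inv_sum u k t] = (fun t : Omega => t.1) @^-1` [set x | c < inv_sum s k x] by [].
  rewrite -[_ @^-1` _]setTI.
  by have m := @measurable_fst _ _ (circle R * torus R)%type (torus R); exact: m.
exact: (congr1 fine E).
Qed.

Lemma exceptional_parameters_null : par (exceptional w u v) = 0%E.
Proof.
have I_ge th : 0 < th <= 2^-1 -> th / 4 <= I th by exact: tent_mean_ge.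
have I_le th : 0 < th -> I th <= 2 * th by exact: tent_mean_le.
apply: exceptional_null => //.
- by move=> n; apply: zero_null => // [t|th th0]; [exact: nrm_ge0|rewrite Ew // I_le].
- by move=> n; apply: zero_null => // [t|th th0]; [exact: nrm_ge0|rewrite Eu // I_le].
- by move=> n; apply: zero_null => // [t|th th0]; [exact: nrm_ge0|rewrite Ev // I_le].
- move=> K N0; apply: (close_returns_null mu mv _ _ I_ge I_le Eu Ev _ Euv).
  + by move=> n t; exact: nrm_ge0.
  + by move=> n t; exact: nrm_ge0.
  + move=> n m th th' nm _ _; rewrite /Rintegral.
    by rewrite (par_correlation_p z (wave_tent th) (wave_tent th') nm).
- move=> K N0; apply: (close_returns_null mv mu _ _ I_ge I_le Ev Eu _ Evu).
  + by move=> n t; exact: nrm_ge0.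
  + by move=> n t; exact: nrm_ge0.
  + move=> n m th th' nm _ _; rewrite /Rintegral.
    by rewrite (par_correlation_q z (wave_tent th) (wave_tent th') nm).
Qed.

End exceptional_parameters.

Section exceptional_pairs.
Variable R : realType.
Notation par := (@param_lebesgue R).
Notation tor := (@torus_lebesgue R).
Notation Omega := (circle R * torus R * torus R)%type.

Let w n (t : Omega * torus R) := nrm (n.+1%:R * circle_rep t.1.1.1).
Let u n (t : Omega * torus R) :=
  nrm (off (circle_rep t.1.1.1) (torus_rep t.1.1.2) (torus_rep t.2) n).
Let v n (t : Omega * torus R) :=
  nrm (off (circle_rep t.1.1.1) (torus_rep t.1.2) (torus_rep t.2) n).

Let bad := exceptional w u v.

Let mnrm (f : Omega * torus R -> R) : measurable_fun setT f ->
  measurable_fun setT (fun t => nrm (f t)).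
Proof.
move=> mf; apply: (measurableT_comp _ mf).
exact: continuous_measurable_fun (@nrm_continuous R).
Qed.

Let measurable_bad : measurable bad.
Proof.
have m1 : measurable_fun setT (fun t : Omega * torus R => t.1.1).
  exact: (measurableT_comp measurable_fst measurable_fst).
have m2 : measurable_fun setT (fun t : Omega * torus R => t.1.2).
  exact: (measurableT_comp measurable_snd measurable_fst).
have m11 : measurable_fun setT (fun t : Omega * torus R => t.1.1.1).
  exact: (measurableT_comp measurable_fst m1).
have m12 : measurable_fun setT (fun t : Omega * torus R => t.1.1.2).
  exact: (measurableT_comp measurable_snd m1).
have ma : measurable_fun setT (fun t : Omega * torus R => circle_rep t.1.1.1).
  exact: (measurableT_comp (@measurable_circle_rep R) m11).
apply: measurable_exceptional => n; apply: mnrm.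
- by apply: measurable_funM => //; exact: measurable_cst.
- by apply: measurable_off => //; exact: measurable_snd.
- by apply: measurable_off => //; exact: measurable_snd.
Qed.

(** Every section of [bad] at a fixed starting point is null, by the probabilistic part; Tonelli's
    theorem turns this into almost every section at fixed parameters. *)
Let bad_null : {ae par, forall t, tor (xsection bad t) = 0%E}.
Proof.
have h : (\int[par]_t `|tor (xsection bad t)| = 0)%E.
  transitivity (\int[par]_t fubini_F tor (EFin \o \1_bad) t)%E.
    rewrite (indic_fubini_tonelli_FE tor measurable_bad).
    by apply: eq_integral => t _; rewrite gee0_abs.
  rewrite (indic_fubini_tonelli par tor measurable_bad).
  rewrite (indic_fubini_tonelli_GE par measurable_bad).
  apply: integral0_eq => z _ /=.
  by rewrite -[RHS](exceptional_parameters_null z); congr (par _); apply/seteqP;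
    split => t; rewrite ysectionP.
have := (ae_eq_integral_abs par measurableT (measurable_fun_xsection tor measurable_bad)).1 h.
by apply: filterS => t; exact.
Qed.

Lemma typical_parameters : full_measure par [set t | tor (xsection bad t) = 0%E].
Proof. exact: bad_null. Qed.

(** The starting points to discard lie in a section of [bad], which involves neither [phi] nor the
    flow: the same parameters serve all reparametrizations. *)
Lemma typical_historic (a : circle R) (p q : torus R) Phi :
  tor (xsection bad (a, p, q)) = 0%E -> corresponding_flow a p q Phi ->
  extreme_historic Phi.
Proof.
move=> bad0 [pq [phi hphi hPhi]].
exists (xsection bad (a, p, q)); split=> //.
  exact: (measurable_xsection _ measurable_bad).
move=> x; apply: contra_notP => hx.
have nx : ~ bad ((a, p, q), x) by move=> bx; apply: hx; apply/xsectionP.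
have nr K N0 : ~ (no_close_return u v K%:R N0 `|` no_close_return v u K%:R N0) ((a, p, q), x).
  by move=> h; apply: nx; right; exists K => //; exists N0.
have nz n : ~ ([set t | w n t = 0] `|` [set t | u n t = 0] `|` [set t | v n t = 0]) ((a, p, q), x).
  by move=> h; apply: nx; left; exists n.
have u0 n : 0 < u n ((a, p, q), x).
  by rewrite lt0r nrm_ge0 andbT; apply/eqP => e; apply: (nz n); left; right.
have v0 n : 0 < v n ((a, p, q), x).
  by rewrite lt0r nrm_ge0 andbT; apply/eqP => e; apply: (nz n); right.
apply: (historic_orbit pq hphi _ hPhi) => // [n n0|K N0|K N0].
- by apply/eqP => e; apply: (nz n.-1); left; left; rewrite /w /= prednK.
- by apply: (@not_no_close_return _ _ _ v u ((a, p, q), x)) => // k N; apply: contra_not (nr k N); right.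
- by apply: (@not_no_close_return _ _ _ u v ((a, p, q), x)) => // k N; apply: contra_not (nr k N); left.
Qed.

End exceptional_pairs.

Theorem theorem1p7 (R : realType) :
  exists F' : set (circle R * torus R * torus R),
    full_measure (@param_lebesgue R) F' /\
    forall (a : circle R) (p q : torus R), F' (a, p, q) ->
    forall Phi : R -> torus R -> torus R,
      corresponding_flow a p q Phi -> extreme_historic Phi.
Proof.
by eexists; split; [exact: typical_parameters|move=> a p q h Phi; exact: typical_historic].
Qed.
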